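(* Assume that the centralizer problem has a positive answer. Let $G$ be a Kazhdan group and let $H\le G$ be a subgroup that is itself a Kazhdan group and is infranormal in $G$. Let $\mathcal M=\prod_{n\to\mathcal U}M_{d_n}(\mathbb C)$ be a tracial matrix ultraproduct and let $\pi\colon G\to U(\mathcal M)$ be a group homomorphism into its unitary group. Then for every $g\in G$, $$\pi(g)\,\bigl(\pi(H)'\cap\mathcal M\bigr)\,\pi(g)^{-1}=\pi(H)'\cap\mathcal M .$$
   Context: A Kazhdan group is a countable discrete group with Kazhdan's property (T) (in particular it is finitely generated). Tracial matrix ultraproduct: let $\mathcal U$ be a nonprincipal ultrafilter on $\mathbb N$ and $(d_n)$ a sequence of positive integers. Let $\operatorname{tr}_n$ be the normalized trace on $M_{d_n}(\mathbb C)$ and $\|x\|_2=\operatorname{tr}_n(x^*x)^{1/2}$. Then $\prod_{n\to\mathcal U}M_{d_n}(\mathbb C)$ is the quotient of the algebra of operator-norm bounded sequences $(x_n)$, $x_n\in M_{d_n}(\mathbb C)$, by the ideal of sequences with $\lim_{n\to\mathcal U}\|x_n\|_2=0$; it is a finite von Neumann algebra with faithful trace $(x_n)\mapsto\lim_{n\to\mathcal U}\operatorname{tr}_n(x_n)$. For $*$-subalgebras $A_n\subseteq M_{d_n}(\mathbb C)$, $\prod_{n\to\mathcal U}A_n$ denotes the set of classes of bounded sequences $(a_n)$ with $a_n\in A_n$. $S'$ denotes the commutant of $S$. The centralizer problem has a positive answer if: for every Kazhdan group $\Gamma$, every tracial matrix ultraproduct $\mathcal N=\prod_{n\to\mathcal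 U}M_{d_n}(\mathbb C)$ (any nonprincipal ultrafilter $\mathcal U$ on $\mathbb N$, any sequence of positive integers $(d_n)$) and every homomorphism $\sigma\colon \Gamma\to U(\mathcal N)$, there exist finite-dimensional $*$-subalgebras $A_n\subseteq M_{d_n}(\mathbb C)$ such that $\sigma(\Gamma)'\cap\mathcal N=\prod_{n\to\mathcal U}A_n$. For a subgroup $H\le G$ put $P_H=\{t\in G: tHt^{-1}\le H\}$. $H$ is called infranormal in $G$ if $P_H$ generates $G$ as a group. *)

(* Defs.v *)
From HB Require Import structures.
From mathcomp Require Import all_boot all_order all_algebra complex.
From mathcomp Require Import all_classical all_reals all_analysis ring lra.

Set Implicit Arguments.
Unset Strict Implicit.
Unset Printing Implicit Defensive.

Import Order.TTheory GRing.Theory Num.Theory Num.Def.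
Import numFieldNormedType.Exports.
Local Open Scope classical_set_scope.
Local Open Scope ring_scope.
Local Open Scope sesquilinear_scope.
Local Open Scope quotient_scope.

Record hilbert_space (R : realType) := HilbertSpace {
  hs_carrier :> completeNormedModType R[i];
  hs_dot : {dot hs_carrier for conjC};
  hs_dotE : forall v : hs_carrier, `|v| ^+ 2 = hs_dot v v
}.
Arguments hs_dot {R} h.

(* Surjectivity of [rho g] is automatic: [rho g^-1] is its inverse. *)
Definition unitary_representation (R : realType) (G : groupType)
    (V : hilbert_space R) (rho : G -> {linear V -> V}) : Prop :=
  [/\ forall v, rho 1%g v = v,
      forall g h v, rho (g * h)%g v = rho g (rho h v)
    & forall g v w, hs_dot V (rho g v) (rho g w) = hs_dot V v w].

(* [G] is discrete, so its compact subsets are the finite ones. *)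
Definition property_T (R : realType) (G : groupType) : Prop :=
  exists (Q : seq G) (e : R), 0 < e /\
    forall (V : hilbert_space R) (rho : G -> {linear V -> V}),
      unitary_representation rho ->
      (exists2 v : V, v != 0 &
         forall q, q \in Q -> `|rho q v - v| < e%:C%C * `|v|) ->
      exists2 v : V, v != 0 & forall g, rho g v = v.

Definition kazhdan (R : realType) (G : groupType) : Prop :=
  countable [set: G] /\ property_T R G.

Definition generates (G : groupType) (P : set G) : Prop :=
  forall K : {pred G}, group_closed K -> (forall t, P t -> t \in K) ->
  forall g, g \in K.

Definition infranormal (G : groupType) (H : {pred G}) : Prop :=
  generates [set t : G | forall h, h \in H -> (t * h * t^-1)%g \in H].

Section MatrixNorms.
Variable R : realType.
Local Notation C := R[i].

Definition vnorm m (v : 'cV[C]_m) : R :=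
  Num.sqrt (complex.Re ((v ^t* *m v) 0 0)).

Definition opnorm m (A : 'M[C]_m) : R :=
  sup [set vnorm (A *m v) | v in [set v | vnorm v <= 1]].

Definition ntr m (A : 'M[C]_m) : C := \tr A / m%:R.

(* [ntr (A ^t* *m A)] is a nonnegative real. *)
Definition norm2 m (A : 'M[C]_m) : R :=
  Num.sqrt (complex.Re (ntr (A ^t* *m A))).

Definition nsq (z : C) : R := complex.Re z ^+ 2 + complex.Im z ^+ 2.
Definition frob m n (A : 'M[C]_(m, n)) : R := \sum_i \sum_j nsq (A i j).

Lemma nsq_ge0 z : 0 <= nsq z.
Proof. by rewrite addr_ge0 ?sqr_ge0. Qed.

Lemma nsqN z : nsq (- z) = nsq z.
Proof. by case: z => a b; rewrite /nsq /= !sqrrN. Qed.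

Lemma nsqC z : nsq (z^*) = nsq z.
Proof. by case: z => a b; rewrite /nsq /= sqrrN. Qed.

Lemma nsqE z : complex.Re (z^* * z) = nsq z.
Proof. by case: z => a b; rewrite /nsq /= mulNr opprK !expr2. Qed.

Lemma nsqD z w : nsq (z + w) <= 2 * nsq z + 2 * nsq w.
Proof.
case: z w => a b [c d]; rewrite /nsq /=; rewrite -subr_ge0.
have -> : 2 * (a ^+ 2 + b ^+ 2) + 2 * (c ^+ 2 + d ^+ 2)
   - ((a + c) ^+ 2 + (b + d) ^+ 2) = (a - c) ^+ 2 + (b - d) ^+ 2 by ring.
by rewrite addr_ge0 ?sqr_ge0.
Qed.

Lemma ReCS z w (c : R) : 0 < c ->
  2 * complex.Re (z^* * w) <= c * nsq z + c^-1 * nsq w.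
Proof.
case: z w => a b [x y] c0; rewrite /nsq /= -subr_ge0.
have -> : c * (a ^+ 2 + b ^+ 2) + c^-1 * (x ^+ 2 + y ^+ 2)
   - 2 * (a * x - - b * y) = c * ((a - c^-1 * x) ^+ 2 + (b - c^-1 * y) ^+ 2).
  by field; rewrite gt_eqF.
by rewrite mulr_ge0 ?addr_ge0 ?sqr_ge0 ?ltW.
Qed.

Lemma Re_sum (I : finType) (F : I -> C) :
  complex.Re (\sum_i F i) = \sum_i complex.Re (F i).
Proof. by elim/big_rec2: _ => // i x y _ <-; case: (F i) y => a b []. Qed.

Lemma nsq_sum (I : Type) (r : seq I) :
  exists2 K : R, 0 <= K &
    forall F : I -> C, nsq (\sum_(i <- r) F i) <= K * \sum_(i <- r) nsq (F i).
Proof.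
elim: r => [|i r [K K0 IH]].
  by exists 0 => // F; rewrite !big_nil /nsq /= !expr0n /= addr0 mulr0.
exists (2 * K + 2) => [|F]; first by rewrite addr_ge0 ?mulr_ge0.
rewrite !big_cons; apply: le_trans (nsqD _ _) _.
have S0 : 0 <= \sum_(j <- r) nsq (F j) by rewrite sumr_ge0 // => *; exact: nsq_ge0.
have hK := IH F; have x0 := nsq_ge0 (F i).
have -> : (2 * K + 2) * (nsq (F i) + \sum_(j <- r) nsq (F j))
  = 2 * nsq (F i) + 2 * (K * \sum_(j <- r) nsq (F j))
    + (2 * (K * nsq (F i)) + 2 * \sum_(j <- r) nsq (F j)) by ring.
rewrite -[leLHS]addr0 lerD ?addr_ge0 ?mulr_ge0 //.
by rewrite lerD2l ler_wpM2l.
Qed.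

Lemma nsqM z w : nsq (z * w) = nsq z * nsq w.
Proof. by case: z w => a b [c d]; rewrite /nsq /=; ring. Qed.

Lemma frob_ge0 m n (A : 'M[C]_(m, n)) : 0 <= frob A.
Proof. by rewrite sumr_ge0 // => i _; rewrite sumr_ge0 // => j _; exact: nsq_ge0. Qed.

Lemma frobN m n (A : 'M[C]_(m, n)) : frob (- A) = frob A.
Proof. by apply: eq_bigr => i _; apply: eq_bigr => j _; rewrite mxE nsqN. Qed.

Lemma frob0 m n : frob (0 : 'M[C]_(m, n)) = 0.
Proof.
rewrite /frob big1 // => i _; rewrite big1 // => j _.
by rewrite mxE /nsq /= !expr0n addr0.
Qed.

Lemma frobD m n (A B : 'M[C]_(m, n)) : frob (A + B) <= 2 * frob A + 2 * frob B.
Proof.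
rewrite /frob !mulr_sumr -big_split ler_sum // => i _ /=.
rewrite !mulr_sumr -big_split ler_sum // => j _ /=.
by rewrite mxE nsqD.
Qed.

Lemma frobC m n (A : 'M[C]_(m, n)) : frob (A ^t*) = frob A.
Proof.
rewrite /frob exchange_big; apply: eq_bigr => i _; apply: eq_bigr => j _.
by rewrite !mxE nsqC.
Qed.

Lemma frob_tr m n (A : 'M[C]_(m, n)) :
  complex.Re (\tr (A ^t* *m A)) = frob A.
Proof.
rewrite /mxtrace Re_sum /frob exchange_big; apply: eq_bigr => j _.
by rewrite mxE Re_sum; apply: eq_bigr => i _; rewrite !mxE nsqE.
Qed.

Lemma vnormE m (v : 'cV[C]_m) : vnorm v = Num.sqrt (frob v).
Proof. by rewrite /vnorm -frob_tr trace_mx11. Qed.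

Lemma norm2E m (A : 'M[C]_m) : norm2 A = Num.sqrt (frob A / m%:R).
Proof.
rewrite /norm2 /ntr -frob_tr; congr Num.sqrt.
have -> : (m%:R : C)^-1 = ((m%:R : R)^-1)%:C%C by rewrite fmorphV rmorph_nat.
by case: (\tr _) => a b; rewrite /= mulr0 subr0.
Qed.

Lemma vnorm_ge0 m (v : 'cV[C]_m) : 0 <= vnorm v.
Proof. exact: sqrtr_ge0. Qed.

Lemma vnorm_sq m (v : 'cV[C]_m) : vnorm v ^+ 2 = frob v.
Proof. by rewrite vnormE sqr_sqrtr ?frob_ge0. Qed.

Lemma frobZ m n (A : 'M[C]_(m, n)) (c : C) : frob (c *: A) = nsq c * frob A.
Proof.
rewrite /frob mulr_sumr; apply: eq_bigr => i _; rewrite mulr_sumr.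
by apply: eq_bigr => j _; rewrite mxE nsqM.
Qed.

Lemma vnormZ m (v : 'cV[C]_m) (r : R) :
  0 <= r -> vnorm (r%:C%C *: v) = r * vnorm v.
Proof.
move=> r0; rewrite !vnormE frobZ /nsq /= expr0n addr0 sqrtrM ?sqr_ge0 //.
by rewrite sqrtr_sqr ger0_norm.
Qed.

Lemma vnorm_eq0 m (v : 'cV[C]_m) : vnorm v = 0 -> v = 0.
Proof.
move=> v0; have : frob v = 0 by rewrite -vnorm_sq v0 expr0n.
move/eqP; rewrite psumr_eq0; last first.
  by move=> i _; rewrite sumr_ge0 // => j _; exact: nsq_ge0.
move=> /allP h; apply/colP => i.
have /eqP := h i (mem_index_enum _).
rewrite big_ord1 /nsq mxE => /eqP.
rewrite paddr_eq0 ?sqr_ge0 // !sqrf_eq0.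
by case: (v i 0) => a b /= /andP[/eqP-> /eqP->].
Qed.

Lemma frob_mulmx_bound m n (A : 'M[C]_(m, n)) :
  exists2 K : R, 0 <= K & forall v : 'cV[C]_n, frob (A *m v) <= K * frob v.
Proof.
have [K K0 hK] := nsq_sum (index_enum 'I_n).
exists (K * frob A) => [|v]; first by rewrite mulr_ge0 ?frob_ge0.
rewrite {1 2}/frob -!mulrA mulr_suml mulr_sumr ler_sum // => i _.
rewrite big_ord1 mxE; apply: le_trans (hK _) _; apply: ler_wpM2l => //.
rewrite mulr_suml ler_sum // => j _; rewrite nsqM ler_wpM2l ?nsq_ge0 //.
rewrite /frob (bigD1 j) //= big_ord1 lerDl sumr_ge0 // => k _.
by rewrite sumr_ge0 // => l _; exact: nsq_ge0.
Qed.

Lemma opnorm_has_sup m (A : 'M[C]_m) :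
  has_sup [set vnorm (A *m v) | v in [set v | vnorm v <= 1]].
Proof.
split.
  exists (vnorm (A *m 0)), 0 => //=.
  by rewrite vnormE frob0 sqrtr0.
have [K K0 hK] := frob_mulmx_bound A.
exists (Num.sqrt K) => _ [v /= v1 <-].
rewrite vnormE ler_sqrt //; apply: le_trans (hK v) _.
by rewrite ler_piMr // -vnorm_sq exprn_ile1 ?vnorm_ge0.
Qed.

Lemma opnormP m (A : 'M[C]_m) (v : 'cV[C]_m) :
  vnorm (A *m v) <= opnorm A * vnorm v.
Proof.
have [/vnorm_eq0 ->|v0] := eqVneq (vnorm v) 0.
  by rewrite mulmx0 !vnormE !frob0 sqrtr0 mulr0.
have vp : 0 < vnorm v by rewrite lt_def v0 vnorm_ge0.
rewrite -ler_pdivrMr // mulrC -vnormZ ?invr_ge0 ?vnorm_ge0 // scalemxAr.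
apply: (sup_upper_bound (opnorm_has_sup A)).
exists ((vnorm v)^-1%:C%C *: v) => //=.
by rewrite vnormZ ?invr_ge0 ?vnorm_ge0 // mulVf.
Qed.

Lemma opnorm_le m (A : 'M[C]_m) (M : R) : 0 <= M ->
  (forall v, vnorm (A *m v) <= M * vnorm v) -> opnorm A <= M.
Proof.
move=> M0 h; apply: ge_sup; first by case: (opnorm_has_sup A).
by move=> _ [v /= v1 <-]; apply: le_trans (h v) _; rewrite ler_piMr.
Qed.

Lemma opnorm_ge0 m (A : 'M[C]_m) : 0 <= opnorm A.
Proof.
apply: (sup_upper_bound (opnorm_has_sup A)).
by exists 0 => /=; rewrite ?mulmx0 !vnormE !frob0 sqrtr0.
Qed.

Lemma frob_col m n (A : 'M[C]_(m, n)) : frob A = \sum_j frob (col j A).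
Proof.
rewrite {1}/frob exchange_big; apply: eq_bigr => j _.
by apply: eq_bigr => i _; rewrite big_ord1 mxE.
Qed.

Lemma opnorm_frob m (A : 'M[C]_m) (M : R) : opnorm A <= M ->
  forall n (B : 'M[C]_(m, n)), frob (A *m B) <= M ^+ 2 * frob B.
Proof.
move=> AM n B; rewrite !frob_col mulr_sumr ler_sum // => j _.
rewrite colE -mulmxA -colE -!vnorm_sq -exprMn.
have M0 : 0 <= M := le_trans (opnorm_ge0 A) AM.
rewrite ler_pXn2r ?nnegrE ?vnorm_ge0 ?mulr_ge0 ?vnorm_ge0 //.
apply: le_trans (opnormP _ _) _.
by rewrite ler_wpM2r ?vnorm_ge0.
Qed.

Lemma opnorm_le_frob m (A : 'M[C]_m) (M : R) : 0 <= M ->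
  (forall v : 'cV[C]_m, frob (A *m v) <= M ^+ 2 * frob v) -> opnorm A <= M.
Proof.
move=> M0 h; apply: opnorm_le => // v.
have := h v; rewrite -!vnorm_sq -exprMn ler_pXn2r ?nnegrE ?vnorm_ge0 //.
by rewrite mulr_ge0 ?vnorm_ge0.
Qed.

Lemma opnorm_bound0 m : opnorm (0 : 'M[C]_m) <= 0.
Proof. by apply: opnorm_le_frob => // v; rewrite mul0mx frob0 expr0n mul0r. Qed.

Lemma opnorm_bound1 m : opnorm (1%:M : 'M[C]_m) <= 1.
Proof. by apply: opnorm_le_frob => // v; rewrite mul1mx expr1n mul1r. Qed.

Lemma opnorm_boundN m (A : 'M[C]_m) M : opnorm A <= M -> opnorm (- A) <= M.
Proof.
move=> AM; apply: opnorm_le_frob => [|v].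
  exact: le_trans (opnorm_ge0 A) AM.
by rewrite mulNmx frobN opnorm_frob.
Qed.

Lemma opnorm_boundD m (A B : 'M[C]_m) M N :
  opnorm A <= M -> opnorm B <= N -> opnorm (A + B) <= 2 * M + 2 * N.
Proof.
move=> AM BN.
have M0 := le_trans (opnorm_ge0 A) AM; have N0 := le_trans (opnorm_ge0 B) BN.
apply: opnorm_le_frob => [|v]; first by rewrite addr_ge0 ?mulr_ge0.
rewrite mulmxDl; apply: le_trans (frobD _ _) _.
have := opnorm_frob AM v; have := opnorm_frob BN v; have := frob_ge0 v.
move: (frob v) (frob (A *m v)) (frob (B *m v)) => x y z x0 hz hy.
have MN : 0 <= M * N by rewrite mulr_ge0.
have -> : (2 * M + 2 * N) ^+ 2 * x = 2 * (M ^+ 2 * x) + 2 * (N ^+ 2 * x)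
  + (2 * (M ^+ 2 * x) + 2 * (N ^+ 2 * x) + 8 * (M * N * x)) by ring.
rewrite -[leLHS]addr0 lerD ?addr_ge0 ?mulr_ge0 ?sqr_ge0 //.
by rewrite lerD ?ler_wpM2l.
Qed.

Lemma opnorm_boundM m (A B : 'M[C]_m) M N :
  opnorm A <= M -> opnorm B <= N -> opnorm (A *m B) <= M * N.
Proof.
move=> AM BN.
have M0 := le_trans (opnorm_ge0 A) AM; have N0 := le_trans (opnorm_ge0 B) BN.
apply: opnorm_le_frob => [|v]; first by rewrite mulr_ge0.
rewrite -mulmxA; apply: le_trans (opnorm_frob AM _) _.
have -> : (M * N) ^+ 2 * frob v = M ^+ 2 * (N ^+ 2 * frob v) by ring.
by apply: ler_wpM2l; [exact: sqr_ge0|exact: opnorm_frob].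
Qed.

Lemma ctrmxM m n p (A : 'M[C]_(m, n)) (B : 'M[C]_(n, p)) :
  (A *m B) ^t* = B ^t* *m A ^t*.
Proof. by rewrite trmx_mul map_mxM. Qed.

Lemma ctrmxK m n (A : 'M[C]_(m, n)) : A ^t* ^t* = A.
Proof. by apply/matrixP => i j; rewrite !mxE conjCK. Qed.

Lemma frob_inner m n (A : 'M[C]_(m, n)) (B : 'M[C]_(m, n)) (c : R) : 0 < c ->
  2 * complex.Re (\tr (A ^t* *m B)) <= c * frob A + c^-1 * frob B.
Proof.
have E (X : 'M[C]_(m, n)) : frob X = \sum_j \sum_i nsq (X i j).
  by rewrite /frob exchange_big.
move=> c0; rewrite /mxtrace Re_sum !E !mulr_sumr -big_split ler_sum //= => j _.
rewrite mxE Re_sum !mulr_sumr -big_split ler_sum //= => i _.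
by rewrite !mxE ReCS.
Qed.

Lemma opnorm_boundC m (A : 'M[C]_m) M :
  0 < M -> opnorm A <= M -> opnorm (A ^t*) <= M.
Proof.
move=> Mp AM; have M0 := ltW Mp.
apply: opnorm_le_frob => // v; set w := A ^t* *m v.
have hw := opnorm_frob AM w.
have M2 : 0 < M ^+ 2 by rewrite exprn_gt0.
have := frob_inner v (A *m w) M2.
rewrite mulmxA -[v ^t* *m A]ctrmxK ctrmxM ctrmxK -/w frob_tr => h.
have : (M ^+ 2)^-1 * frob (A *m w) <= frob w.
  by rewrite mulrC ler_pdivrMr // mulrC.
by move=> ?; lra.
Qed.

Lemma norm2_mull m (A B : 'M[C]_m) M : opnorm A <= M ->
  norm2 (A *m B) <= M * norm2 B.
Proof.
move=> AM; have M0 := le_trans (opnorm_ge0 A) AM.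
rewrite !norm2E -{1}(ger0_norm M0) -sqrtr_sqr -sqrtrM ?sqr_ge0 //.
rewrite ler_sqrt ?mulr_ge0 ?sqr_ge0 ?invr_ge0 ?ler0n ?frob_ge0 //.
by rewrite mulrA ler_wpM2r ?invr_ge0 ?ler0n ?opnorm_frob.
Qed.

Lemma norm2C m (A : 'M[C]_m) : norm2 (A ^t*) = norm2 A.
Proof. by rewrite !norm2E frobC. Qed.

Lemma norm2_mulr m (A B : 'M[C]_m) M : 0 < M -> opnorm A <= M ->
  norm2 (B *m A) <= M * norm2 B.
Proof.
move=> M0 AM; rewrite -norm2C ctrmxM -(norm2C B).
exact/norm2_mull/opnorm_boundC.
Qed.

Lemma norm2_ge0 m (A : 'M[C]_m) : 0 <= norm2 A.
Proof. exact: sqrtr_ge0. Qed.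

Lemma norm2_0 m : norm2 (0 : 'M[C]_m) = 0.
Proof. by rewrite norm2E frob0 mul0r sqrtr0. Qed.

Lemma norm2N m (A : 'M[C]_m) : norm2 (- A) = norm2 A.
Proof. by rewrite !norm2E frobN. Qed.

Lemma norm2D m (A B : 'M[C]_m) : norm2 (A + B) <= 2 * norm2 A + 2 * norm2 B.
Proof.
rewrite !norm2E; set k : R := m%:R^-1.
have k0 : 0 <= k by rewrite invr_ge0 ler0n.
have h (X : 'M[C]_m) : 0 <= frob X * k by rewrite mulr_ge0 ?frob_ge0.
set a := Num.sqrt (frob A * k); set b := Num.sqrt (frob B * k).
have [a0 b0] : 0 <= a /\ 0 <= b by rewrite !sqrtr_ge0.
have ea : frob A * k = a ^+ 2 by rewrite sqr_sqrtr.
have eb : frob B * k = b ^+ 2 by rewrite sqr_sqrtr.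
have ab0 : 0 <= 2 * a + 2 * b by rewrite addr_ge0 ?mulr_ge0.
rewrite -(ger0_norm ab0) -sqrtr_sqr ler_sqrt ?sqr_ge0 //.
apply: (@le_trans _ _ (2 * a ^+ 2 + 2 * b ^+ 2)).
  by rewrite -ea -eb !mulrA -mulrDl ler_wpM2r ?frobD.
have -> : (2 * a + 2 * b) ^+ 2 = 2 * a ^+ 2 + 2 * b ^+ 2
  + (2 * a ^+ 2 + 2 * b ^+ 2 + 8 * (a * b)) by ring.
by rewrite lerDl !addr_ge0 ?mulr_ge0 ?sqr_ge0.
Qed.

End MatrixNorms.

Record nonprincipal_ultrafilter := NonprincipalUltrafilter {
  npu_sets :> set_system nat;
  npu_ultra : UltraFilter npu_sets;
  npu_free : forall n, ~ npu_sets [set n]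
}.
#[global] Existing Instance npu_ultra.

Section BoundedSequences.
Variables (R : realType) (d : nat -> nat).
Local Notation C := R[i].

Definition mxseq_bounded (x : forall n, 'M[C]_(d n)) : Prop :=
  exists M : R, forall n, opnorm (x n) <= M.

Record bseq := BSeq {
  bseq_val :> forall n, 'M[C]_(d n);
  bseq_bounded : mxseq_bounded bseq_val
}.

Lemma bseqP (x y : bseq) : (forall n, x n = y n) -> x = y.
Proof.
case: x y => x bx [y yb] /= xy; have {}xy : x = y by apply: functional_extensionality_dep.
by case: y / xy yb => yb; congr BSeq; exact: Prop_irrelevance.
Qed.

Lemma bseq_pos (x : bseq) : exists2 M : R, 0 < M & forall n, opnorm (x n) <= M.
Proof.
have [M hM] := bseq_bounded x; exists (M + 1) => [|n].
  by rewrite ltr_wpDl // (le_trans (opnorm_ge0 (x 0%N))).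
by rewrite (le_trans (hM n)) // lerDl.
Qed.

HB.instance Definition _ := gen_eqMixin bseq.
HB.instance Definition _ := gen_choiceMixin bseq.

Fact bseq0_bounded : mxseq_bounded (fun=> 0).
Proof. by exists 0 => n; exact: opnorm_bound0. Qed.
Definition bseq0 := BSeq bseq0_bounded.

Fact bseq1_bounded : mxseq_bounded (fun=> 1%:M).
Proof. by exists 1 => n; exact: opnorm_bound1. Qed.
Definition bseq1 := BSeq bseq1_bounded.

Fact bseqN_bounded (x : bseq) : mxseq_bounded (fun n => - x n).
Proof.
by have [M h] := bseq_bounded x; exists M => n; exact: opnorm_boundN.
Qed.
Definition bseqN x := BSeq (bseqN_bounded x).

Fact bseqD_bounded (x y : bseq) : mxseq_bounded (fun n => x n + y n).
Proof.
have [M h] := bseq_bounded x; have [N h'] := bseq_bounded y.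
by exists (2 * M + 2 * N) => n; exact: opnorm_boundD.
Qed.
Definition bseqD x y := BSeq (bseqD_bounded x y).

Fact bseqM_bounded (x y : bseq) : mxseq_bounded (fun n => x n *m y n).
Proof.
have [M h] := bseq_bounded x; have [N h'] := bseq_bounded y.
by exists (M * N) => n; exact: opnorm_boundM.
Qed.
Definition bseqM x y := BSeq (bseqM_bounded x y).

Fact bseq_star_bounded (x : bseq) : mxseq_bounded (fun n => x n ^t*).
Proof.
by have [M M0 h] := bseq_pos x; exists M => n; exact: opnorm_boundC.
Qed.
Definition bseq_star x := BSeq (bseq_star_bounded x).

Fact bseq_addA : associative bseqD.
Proof. by move=> x y z; apply: bseqP => n /=; rewrite addrA. Qed.
Fact bseq_addC : commutative bseqD.
Proof. by move=> x y; apply: bseqP => n /=; rewrite addrC. Qed.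
Fact bseq_add0 : left_id bseq0 bseqD.
Proof. by move=> x; apply: bseqP => n /=; rewrite add0r. Qed.
Fact bseq_addN : left_inverse bseq0 bseqN bseqD.
Proof. by move=> x; apply: bseqP => n /=; rewrite addNr. Qed.
Fact bseq_mulA : associative bseqM.
Proof. by move=> x y z; apply: bseqP => n /=; rewrite mulmxA. Qed.
Fact bseq_mul1 : left_id bseq1 bseqM.
Proof. by move=> x; apply: bseqP => n /=; rewrite mul1mx. Qed.
Fact bseq_1mul : right_id bseq1 bseqM.
Proof. by move=> x; apply: bseqP => n /=; rewrite mulmx1. Qed.
Fact bseq_mulDl : left_distributive bseqM bseqD.
Proof. by move=> x y z; apply: bseqP => n /=; rewrite mulmxDl. Qed.
Fact bseq_mulDr : right_distributive bseqM bseqD.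
Proof. by move=> x y z; apply: bseqP => n /=; rewrite mulmxDr. Qed.

HB.instance Definition _ := GRing.isPzRing.Build bseq
  bseq_addA bseq_addC bseq_add0 bseq_addN
  bseq_mulA bseq_mul1 bseq_1mul bseq_mulDl bseq_mulDr.

Fact bseq_starK : involutive bseq_star.
Proof. by move=> x; apply: bseqP => n /=; rewrite ctrmxK. Qed.
Fact bseq_starM (x y : bseq) : bseq_star (x * y) = bseq_star y * bseq_star x.
Proof. by apply: bseqP => n /=; rewrite ctrmxM. Qed.
Fact bseq_starB (x y : bseq) : bseq_star (x - y) = bseq_star x - bseq_star y.
Proof. by apply: bseqP => n; apply/matrixP => i j; rewrite !mxE rmorphB. Qed.
Fact bseq_star1 : bseq_star 1 = 1.
Proof. by apply: bseqP => n /=; rewrite trmx1 map_mx1. Qed.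

End BoundedSequences.

Section Ultraproduct.
Variables (R : realType) (U : nonprincipal_ultrafilter) (d : nat -> nat).
Local Notation bseq := (bseq R d).

Definition null_ideal : {pred bseq} :=
  [pred x : bseq | `[< (fun n => norm2 (x n)) @ npu_sets U --> (0 : R) >] ].

Lemma null_idealP (x : bseq) :
  reflect ((fun n => norm2 (x n)) @ npu_sets U --> (0 : R)) (x \in null_ideal).
Proof. exact: asboolP. Qed.

Lemma null_dom (x y z : bseq) (K L : R) :
  (forall n, norm2 (z n) <= K * norm2 (x n) + L * norm2 (y n)) ->
  x \in null_ideal -> y \in null_ideal -> z \in null_ideal.
Proof.
move=> h /null_idealP hx /null_idealP hy; apply/null_idealP.
have hf : (fun n => K * norm2 (x n) + L * norm2 (y n)) @ npu_sets U --> (0 : R).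
  rewrite -[0 : R](addr0 0) -{1}(mulr0 K) -{2}(mulr0 L).
  by apply: cvgD; apply: cvgMr.
apply: (squeeze_cvgr _ (cvg_cst (0 : R)) hf).
by apply: filterE => n; rewrite norm2_ge0 h.
Qed.

Fact null_zmod_closed : zmod_closed null_ideal.
Proof.
split.
  apply/null_idealP; under eq_fun do rewrite norm2_0; exact: cvg_cst.
move=> x y; apply: null_dom => n /=.
by rewrite (le_trans (norm2D _ _)) // norm2N.
Qed.
HB.instance Definition _ := GRing.isZmodClosed.Build bseq null_ideal
  null_zmod_closed.

Lemma null_mull (x y : bseq) : y \in null_ideal -> x * y \in null_ideal.
Proof.
have [M _ h] := bseq_pos x => hy; apply: (null_dom (K := M) (L := 0) _ hy hy).
by move=> n; rewrite mul0r addr0 norm2_mull.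
Qed.

Lemma null_mulr (x y : bseq) : x \in null_ideal -> x * y \in null_ideal.
Proof.
have [M M0 h] := bseq_pos y => hx; apply: (null_dom (K := M) (L := 0) _ hx hx).
by move=> n; rewrite mul0r addr0 norm2_mulr.
Qed.

Lemma null_star (x : bseq) : x \in null_ideal -> bseq_star x \in null_ideal.
Proof.
move=> hx; apply: (null_dom (K := 1) (L := 0) _ hx hx).
by move=> n; rewrite mul0r addr0 mul1r norm2C.
Qed.

Definition ultraproduct : Type := Quotient.quot null_ideal.

HB.instance Definition _ := GRing.Zmodule.on ultraproduct.
HB.instance Definition _ := EqQuotient.on ultraproduct.

Definition upclass (x : bseq) : ultraproduct := \pi_ultraproduct x.

Lemma upclass_eq (x y : bseq) :
  (upclass x = upclass y) <-> (x - y \in null_ideal).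
Proof. by rewrite Quotient.idealrBE; split=> [e|/eqP]; first exact/eqP. Qed.

Lemma upclass_ind (P : ultraproduct -> Prop) :
  (forall x : bseq, P (upclass x)) -> forall x, P x.
Proof. by move=> h x; rewrite -[x]reprK; exact: h. Qed.

Lemma upclass_repr (x : bseq) : repr (upclass x) - x \in null_ideal.
Proof. by apply/upclass_eq; rewrite /upclass reprK. Qed.

Definition up_mul (x y : ultraproduct) : ultraproduct :=
  upclass (repr x * repr y).

Definition up_star (x : ultraproduct) : ultraproduct :=
  upclass (bseq_star (repr x)).

Lemma upclassD (x y : bseq) : upclass (x + y) = upclass x + upclass y.
Proof. exact: (raddfD (\pi_(Quotient.quot null_ideal))). Qed.

Lemma upclass_up_mul (x y : bseq) : upclass (x * y) = up_mul (upclass x) (upclass y).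
Proof.
apply/esym/upclass_eq; set x' := repr _; set y' := repr _.
have -> : x' * y' - x * y = x' * (y' - y) + (x' - x) * y.
  by rewrite mulrBr mulrBl addrA subrK.
by apply: rpredD; [apply: null_mull|apply: null_mulr]; exact: upclass_repr.
Qed.

Lemma upclass_star (x : bseq) : upclass (bseq_star x) = up_star (upclass x).
Proof.
apply/esym/upclass_eq; rewrite -bseq_starB.
by apply: null_star; exact: upclass_repr.
Qed.

Fact up_mulA : associative up_mul.
Proof.
elim/upclass_ind=> x; elim/upclass_ind=> y; elim/upclass_ind=> z.
by rewrite -!upclass_up_mul mulrA.
Qed.
Fact up_mul1 : left_id (upclass 1) up_mul.
Proof. by elim/upclass_ind=> x; rewrite -upclass_up_mul mul1r. Qed.
Fact up_1mul : right_id (upclass 1) up_mul.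
Proof. by elim/upclass_ind=> x; rewrite -upclass_up_mul mulr1. Qed.
Fact up_mulDl : left_distributive up_mul +%R.
Proof.
elim/upclass_ind=> x; elim/upclass_ind=> y; elim/upclass_ind=> z.
by rewrite -upclassD -!upclass_up_mul -upclassD mulrDl.
Qed.
Fact up_mulDr : right_distributive up_mul +%R.
Proof.
elim/upclass_ind=> x; elim/upclass_ind=> y; elim/upclass_ind=> z.
by rewrite -upclassD -!upclass_up_mul -upclassD mulrDr.
Qed.

HB.instance Definition _ := GRing.Zmodule_isPzRing.Build ultraproduct
  up_mulA up_mul1 up_1mul up_mulDl up_mulDr.

Lemma upclassM (x y : bseq) : upclass (x * y) = upclass x * upclass y.
Proof. exact: upclass_up_mul. Qed.

Lemma upclass1 : upclass 1 = 1.
Proof. by []. Qed.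

Lemma up_starM (x y : ultraproduct) : up_star (x * y) = up_star y * up_star x.
Proof.
elim/upclass_ind: x => x; elim/upclass_ind: y => y.
by rewrite -upclassM -!upclass_star -upclassM bseq_starM.
Qed.

Lemma up_starK : involutive up_star.
Proof. by elim/upclass_ind=> x; rewrite -!upclass_star bseq_starK. Qed.

Lemma up_star1 : up_star 1 = 1.
Proof. by rewrite -upclass1 -upclass_star bseq_star1. Qed.

Definition is_unitary (x : ultraproduct) : bool :=
  (up_star x * x == 1) && (x * up_star x == 1).

Record up_unitary := UpUnitary {
  uval : ultraproduct;
  uvalP : is_unitary uval
}.
HB.instance Definition _ := [isSub for uval].
HB.instance Definition _ := [Choice of up_unitary by <:].

Lemma uval_starl (u : up_unitary) : up_star (uval u) * uval u = 1.
Proof. by have /andP[/eqP] := uvalP u. Qed.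

Lemma uval_starr (u : up_unitary) : uval u * up_star (uval u) = 1.
Proof. by have /andP[_ /eqP] := uvalP u. Qed.

Fact unitary1 : is_unitary 1.
Proof. by rewrite /is_unitary up_star1 mulr1 eqxx. Qed.
Definition uone := UpUnitary unitary1.

Fact unitaryM (u v : up_unitary) : is_unitary (uval u * uval v).
Proof.
rewrite /is_unitary up_starM -[_ * (uval u * _)]mulrA (mulrA (up_star (uval u))).
rewrite uval_starl mul1r uval_starl -[_ * (up_star (uval v) * _)]mulrA.
by rewrite (mulrA (uval v)) uval_starr mul1r uval_starr eqxx.
Qed.
Definition umul u v := UpUnitary (unitaryM u v).

Fact unitaryV (u : up_unitary) : is_unitary (up_star (uval u)).
Proof. by rewrite /is_unitary up_starK uval_starl uval_starr eqxx. Qed.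
Definition uinv u := UpUnitary (unitaryV u).

Fact umulA : associative umul.
Proof. by move=> u v w; apply: val_inj; rewrite /= mulrA. Qed.
Fact umul1 : left_id uone umul.
Proof. by move=> u; apply: val_inj; rewrite /= mul1r. Qed.
Fact u1mul : right_id uone umul.
Proof. by move=> u; apply: val_inj; rewrite /= mulr1. Qed.
Fact umulV : left_inverse uone uinv umul.
Proof. by move=> u; apply: val_inj; rewrite /= uval_starl. Qed.
Fact uVmul : right_inverse uone uinv umul.
Proof. by move=> u; apply: val_inj; rewrite /= uval_starr. Qed.

HB.instance Definition _ :=
  isGroup.Build up_unitary umulA umul1 u1mul umulV uVmul.

(* The commutant relative to the ultraproduct: [S' :&: N]. *)
Definition commutant (S : set ultraproduct) : set ultraproduct :=
  [set x | forall s, S s -> x * s = s * x].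

Definition internal_set (A : forall n, {vspace 'M[R[i]]_(d n)}) :
    set ultraproduct :=
  [set x | exists2 a : bseq, (forall n, a n \in A n) & x = upclass a].

End Ultraproduct.

(* Not required to contain the identity matrix. *)
Definition star_subalgebra (R : realType) m (A : {vspace 'M[R[i]]_m}) : Prop :=
  (forall x y, x \in A -> y \in A -> x *m y \in A) /\
  (forall x, x \in A -> x ^t* \in A).

Definition centralizer_problem (R : realType) : Prop :=
  forall G : groupType, kazhdan R G ->
  forall (U : nonprincipal_ultrafilter) (d : nat -> nat),
  (forall n, (0 < d n)%N) ->
  forall sigma : {multiplicative G -> up_unitary R U d},
  exists2 A : forall n, {vspace 'M[R[i]]_(d n)},
    (forall n, star_subalgebra (A n)) &
    commutant (range (fun g => uval (sigma g))) = internal_set A.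

(* Main.v *)
(* Write [pi(H)' = prod A_n] and [pi(G)' = prod D_n] with unital star subalgebras.
   For [t] in [P_H] lift [pi(t)] to unitaries [u_n] and put [B_n = u_n^* A_n u_n]; then
   [B_n] is almost contained in [A_n] and [D_n] almost commutes with [u_n].  To a matrix
   block of [A_n] of size [k] and minimal trace weight [w] attach the ratio [x = k / w].
   Averaging over unitaries, almost containment of [B_n] in [A_n] forces the ratio of a
   block of [B_n] to be at most that of the [A_n]-blocks it overlaps, up to small mass; the
   reverse inequality would give almost containment of [A_n] in [B_n].  It follows from
   rigidity of the ratios: let [z_j] be minimal projections of [D_n], [y_j] a median of the
   ratios under [z_j], and [S] the sum of the [(x_i - y_j) / (x_i + y_j)] weighted
   compressions of [z_j] to the blocks.  As the weight increases with [x_i] and traces are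
   preserved, [S] almost commutes with each [u_n], so [S] is almost in [D_n]; but the
   medians make [S] almost orthogonal to [D_n], so [S] is small and ratios are almost
   functions of [D_n], hence almost invariant under [u_n]. *)
Require Import Defs.
From mathcomp Require Import all_boot all_order all_algebra perm complex.
From mathcomp Require Import all_classical all_reals all_analysis ring lra.

Set Implicit Arguments.
Unset Strict Implicit.
Unset Printing Implicit Defensive.

Import Order.TTheory GRing.Theory Num.Theory.
Import numFieldNormedType.Exports.
Local Open Scope classical_set_scope.
Local Open Scope ring_scope.
Local Open Scope sesquilinear_scope.

(** * Traces and Frobenius norms *)

(** A unitary of a finite von Neumann algebra can conjugate a subalgebra properly into itself, and
    the dimension count that forbids this inside one matrix algebra fails for almost containment,
    since dimensions are not stable under errors small in the trace norm. The ratio [k / w] survives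
    such errors for the following reason. If a block of size [l] and weight [v] of an exact
    subalgebra meets a block of size [k] and weight [w], then [l <= k] and [w <= v]; so the ratio
    cannot fall, and equality of ratios forces both equalities. Monotonicity becomes rigidity by one
    device: a bounded quantity that can hardly decrease and whose mean is preserved changes little
    in mean square. The operator built from the ratios must not depend on [t], because only an
    element commuting with every [pi t] at once, [t] in [P_H], is known to lie in [pi(G)'].
    Projections of [A_n] and [D_n] commute only approximately, so joint distributions are replaced
    by the nonnegative traces of products of positive operators. *)

Section RealTrace.
Variable R : realType.
Local Notation C := R[i].

Lemma ReD (x y : C) : complex.Re (x + y) = complex.Re x + complex.Re y.
Proof. by case: x; case: y. Qed.

Lemma ReN (x : C) : complex.Re (- x) = - complex.Re x.
Proof. by case: x. Qed.

Lemma ReZ (r : R) (x : C) : complex.Re (r%:C%C * x) = r * complex.Re x.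
Proof. by case: x => a b /=; rewrite mul0r subr0. Qed.

Lemma ReJ (x : C) : complex.Re x^* = complex.Re x.
Proof. by case: x. Qed.

Lemma nsq_real (r : R) : nsq r%:C%C = r ^+ 2.
Proof. by rewrite /nsq /= expr0n addr0. Qed.

Lemma conj_real (r : R) : (r%:C%C : C)^* = r%:C%C.
Proof. by apply/eqP; rewrite eq_complex /= oppr0 !eqxx. Qed.

Lemma ctrmxD m n (A B : 'M[C]_(m, n)) : (A + B)^t* = A^t* + B^t*.
Proof. by rewrite linearD map_mxD. Qed.

Lemma ctrmxN m n (A : 'M[C]_(m, n)) : (- A)^t* = - A^t*.
Proof. by rewrite linearN map_mxN. Qed.

Lemma ctrmxB m n (A B : 'M[C]_(m, n)) : (A - B)^t* = A^t* - B^t*.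
Proof. by rewrite ctrmxD ctrmxN. Qed.

Lemma ctrmxZ m n (c : C) (A : 'M[C]_(m, n)) : (c *: A)^t* = c^* *: A^t*.
Proof. by rewrite linearZ map_mxZ. Qed.

Lemma ctrmx0 m n : (0 : 'M[C]_(m, n))^t* = 0.
Proof. by rewrite trmx0 map_mx0. Qed.

Lemma ctrmx1 m : (1%:M : 'M[C]_m)^t* = 1%:M.
Proof. by rewrite trmx1 map_mx1. Qed.

Lemma ctrmx_sum m n (I : Type) (r : seq I) (P : pred I) (F : I -> 'M[C]_(m, n)) :
  (\sum_(i <- r | P i) F i)^t* = \sum_(i <- r | P i) (F i)^t*.
Proof. by rewrite linear_sum map_mx_sum. Qed.

Definition rtr m (A : 'M[C]_m) : R := complex.Re (\tr A).

Lemma rtrD m (A B : 'M[C]_m) : rtr (A + B) = rtr A + rtr B.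
Proof. by rewrite /rtr mxtraceD ReD. Qed.

Lemma rtrN m (A : 'M[C]_m) : rtr (- A) = - rtr A.
Proof. by rewrite /rtr linearN ReN. Qed.

Lemma rtrB m (A B : 'M[C]_m) : rtr (A - B) = rtr A - rtr B.
Proof. by rewrite rtrD rtrN. Qed.

Lemma rtr0 m : rtr (0 : 'M[C]_m) = 0.
Proof. by rewrite /rtr mxtrace0. Qed.

Lemma rtr1 m : rtr (1%:M : 'M[C]_m) = m%:R.
Proof. by rewrite /rtr mxtrace1 -(rmorph_nat (real_complex R)). Qed.

Lemma rtr_sum m (I : Type) (r : seq I) (P : pred I) (F : I -> 'M[C]_m) :
  rtr (\sum_(i <- r | P i) F i) = \sum_(i <- r | P i) rtr (F i).
Proof.
by elim/big_rec2: _ => [|i x y _ <-]; rewrite ?rtr0 ?rtrD.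
Qed.

Lemma rtrC m n (A : 'M[C]_(m, n)) B : rtr (A *m B) = rtr (B *m A).
Proof. by rewrite /rtr mxtrace_mulC. Qed.

Lemma mxtrace_ctr m (A : 'M[C]_m) : \tr (A^t*) = (\tr A)^*.
Proof. by rewrite /mxtrace rmorph_sum; apply: eq_bigr => i _; rewrite !mxE. Qed.

Lemma rtr_ctr m (A : 'M[C]_m) : rtr (A^t*) = rtr A.
Proof. by rewrite /rtr mxtrace_ctr ReJ. Qed.

Lemma rtrZ m (r : R) (A : 'M[C]_m) : rtr (r%:C%C *: A) = r * rtr A.
Proof. by rewrite /rtr mxtraceZ ReZ. Qed.

Lemma frobE m n (A : 'M[C]_(m, n)) : frob A = rtr (A^t* *m A).
Proof. by rewrite -frob_tr. Qed.

Lemma frobEr m n (A : 'M[C]_(m, n)) : frob A = rtr (A *m A^t*).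
Proof. by rewrite frobE rtrC. Qed.

Lemma mxtrace_frob m n (A : 'M[C]_(m, n)) : \tr (A^t* *m A) = (frob A)%:C%C.
Proof.
have h : (\tr (A^t* *m A))^* = \tr (A^t* *m A).
  by rewrite -mxtrace_ctr ctrmxM ctrmxK.
rewrite frobE /rtr; move: (\tr _) h => [a b] [/eqP].
by rewrite -subr_eq0 -opprD oppr_eq0 -mulr2n mulrn_eq0 /= => /eqP ->.
Qed.

Definition ip m n (A B : 'M[C]_(m, n)) : R := rtr (A^t* *m B).

Lemma ipC m n (A B : 'M[C]_(m, n)) : ip A B = ip B A.
Proof. by rewrite /ip -rtr_ctr ctrmxM ctrmxK. Qed.

Lemma ipDl m n (A B D : 'M[C]_(m, n)) : ip (A + B) D = ip A D + ip B D.
Proof. by rewrite /ip ctrmxD mulmxDl rtrD. Qed.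

Lemma ipNl m n (A B : 'M[C]_(m, n)) : ip (- A) B = - ip A B.
Proof. by rewrite /ip ctrmxN mulNmx rtrN. Qed.

Lemma ipDr m n (A B D : 'M[C]_(m, n)) : ip D (A + B) = ip D A + ip D B.
Proof. by rewrite !(ipC D) ipDl. Qed.

Lemma ipNr m n (A B : 'M[C]_(m, n)) : ip A (- B) = - ip A B.
Proof. by rewrite !(ipC A) ipNl. Qed.

Lemma ip_suml m n (I : Type) (r : seq I) (P : pred I) (F : I -> 'M[C]_(m, n)) A :
  ip (\sum_(i <- r | P i) F i) A = \sum_(i <- r | P i) ip (F i) A.
Proof. by rewrite /ip ctrmx_sum mulmx_suml rtr_sum. Qed.

Lemma ip_sumr m n (I : Type) (r : seq I) (P : pred I) (F : I -> 'M[C]_(m, n)) A :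
  ip A (\sum_(i <- r | P i) F i) = \sum_(i <- r | P i) ip A (F i).
Proof. by rewrite ipC ip_suml; under eq_bigr do rewrite ipC. Qed.

Lemma ipAA m n (A : 'M[C]_(m, n)) : ip A A = frob A.
Proof. by rewrite frobE. Qed.

Lemma frob_add m n (A B : 'M[C]_(m, n)) :
  frob (A + B) = frob A + 2 * ip A B + frob B.
Proof. by rewrite -!ipAA !(ipDl, ipDr) (ipC B A); ring. Qed.

Lemma frob_sub m n (A B : 'M[C]_(m, n)) :
  frob (A - B) = frob A - 2 * ip A B + frob B.
Proof. by rewrite frob_add ipNr frobN mulrN. Qed.

Lemma frob_eq0 m n (A : 'M[C]_(m, n)) : frob A = 0 -> A = 0.
Proof.
move=> A0; apply/matrixP => i j; rewrite mxE.
have n0 k l : 0 <= nsq (A k l) by exact: nsq_ge0.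
have /eqP : nsq (A i j) = 0.
  apply/eqP; rewrite eq_le n0 andbT -A0 /frob (bigD1 i) //= (bigD1 j) //=.
  by rewrite -addrA lerDl addr_ge0 ?sumr_ge0 // => *; rewrite sumr_ge0.
rewrite /nsq paddr_eq0 ?sqr_ge0 // !sqrf_eq0.
by case: (A i j) => a b /= /andP[/eqP-> /eqP->].
Qed.

Lemma frob_gt0 m n (A : 'M[C]_(m, n)) : A != 0 -> 0 < frob A.
Proof.
by move=> A0; rewrite lt_def frob_ge0 andbT; apply: contra_neq A0 => /frob_eq0.
Qed.

Lemma frob1 m : frob (1%:M : 'M[C]_m) = m%:R.
Proof. by rewrite frobE ctrmx1 mul1mx rtr1. Qed.

Lemma frob_unitaryl m n (u : 'M[C]_m) (A : 'M[C]_(m, n)) :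
  u^t* *m u = 1%:M -> frob (u *m A) = frob A.
Proof. by move=> uu; rewrite frobE ctrmxM mulmxA -(mulmxA _ _ u) uu mulmx1 -frobE. Qed.

Lemma frob_unitaryr m n (u : 'M[C]_n) (A : 'M[C]_(m, n)) :
  u *m u^t* = 1%:M -> frob (A *m u) = frob A.
Proof. by move=> uu; rewrite frobEr ctrmxM mulmxA -(mulmxA _ u) uu mulmx1 -frobEr. Qed.

Lemma opnorm_unitary m (u : 'M[C]_m) : u^t* *m u = 1%:M -> opnorm u <= 1.
Proof.
by move=> uu; apply: opnorm_le_frob => // v; rewrite frob_unitaryl // expr1n mul1r.
Qed.

Lemma unitary_swap m (u : 'M[C]_m) : u^t* *m u = 1%:M -> u *m u^t* = 1%:M.
Proof. exact: mulmx1C. Qed.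

Lemma frob_sum_orth m n (I : finType) (P : pred I) (F : I -> 'M[C]_(m, n)) :
  (forall i j, P i -> P j -> i != j -> ip (F i) (F j) = 0) ->
  frob (\sum_(i | P i) F i) = \sum_(i | P i) frob (F i).
Proof.
move=> h; rewrite -ipAA ip_suml; apply: eq_bigr => i Pi.
rewrite ip_sumr (bigD1 i) //= ipAA big1 ?addr0 // => j /andP[Pj ji].
by rewrite h // eq_sym.
Qed.

Lemma frobMl_le m n (A : 'M[C]_m) (B : 'M[C]_(m, n)) :
  opnorm A <= 1 -> frob (A *m B) <= frob B.
Proof. by move=> A1; have := opnorm_frob A1 B; rewrite expr1n mul1r. Qed.

End RealTrace.

(** * Functional calculus *)

Section FunctionalCalculus.
Variable R : realType.
Local Notation C := R[i].

Lemma interpolate (f : R -> R) (s : seq R) :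
  exists p : {poly R}, {in s, forall x, p.[x] = f x}.
Proof.
elim: s => [|x s [p hp]]; first by exists 0.
have [xs|xs] := boolP (x \in s).
  by exists p => y; rewrite inE => /orP[/eqP->|]; exact: hp.
pose q : {poly R} := \prod_(y <- s) ('X - y%:P).
have qx : q.[x] != 0.
  by rewrite -[_ == 0]/(root q x) root_prod_XsubC.
exists (p + ((f x - p.[x]) / q.[x]) *: q) => y.
rewrite inE hornerD hornerZ => /orP[/eqP->|ys]; first by rewrite divfK // subrKC.
have -> : q.[y] = 0 by apply/eqP; rewrite -[_ == 0]/(root q y) root_prod_XsubC.
by rewrite mulr0 addr0 hp.
Qed.

Definition unital_star_algebra m (A : {vspace 'M[C]_m}) : Prop :=
  star_subalgebra A /\ 1%:M \in A.

Variable m : nat.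
Implicit Types (h A B : 'M[C]_m) (f g : R -> R).

Definition ev h (i : 'I_m) : R := complex.Re (spectral_diag h 0 i).

(** Only real parts of the eigenvalues enter, so [fc f h] is self-adjoint for every [h]; it is the
    functional calculus of [h] when [h] is self-adjoint. *)
Definition fc f h : 'M[C]_m :=
  (spectralmx h)^t* *m diag_mx (\row_i (f (ev h i))%:C%C) *m spectralmx h.

Lemma spectralmxl h : (spectralmx h)^t* *m spectralmx h = 1%:M.
Proof. by apply: mulmx1C; apply/unitarymxP/spectral_unitarymx. Qed.

Lemma spectralmxr h : spectralmx h *m (spectralmx h)^t* = 1%:M.
Proof. by apply/unitarymxP/spectral_unitarymx. Qed.

Lemma fc_ext f g h : (forall i, f (ev h i) = g (ev h i)) -> fc f h = fc g h.
Proof.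
by move=> fg; congr (_ *m diag_mx _ *m _); apply/rowP => i; rewrite !mxE fg.
Qed.

Lemma fc_id h : h^t* = h -> fc id h = h.
Proof.
move=> hh; have hs : h \is hermsymmx.
  by apply/is_hermitianmxP; rewrite expr0 scale1r hh.
have /orthomx_spectralP {2}-> := hermitian_normalmx hs.
rewrite invmx_unitary ?spectral_unitarymx //; congr (_ *m diag_mx _ *m _).
apply/rowP => i; rewrite mxE /ev RRe_real //.
by have /mxOverP := hermitian_spectral_diag_real hs; apply.
Qed.

Lemma fcM f g h : fc f h *m fc g h = fc (fun x => f x * g x) h.
Proof.
rewrite /fc !mulmxA -(mulmxA _ (spectralmx h)) spectralmxr mulmx1.
rewrite -(mulmxA _ (diag_mx _) (diag_mx _)) mulmx_diag; congr (_ *m diag_mx _ *m _).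
by apply/rowP => i; rewrite !mxE rmorphM.
Qed.

Lemma fcD f g h : fc f h + fc g h = fc (fun x => f x + g x) h.
Proof.
rewrite /fc -mulmxDl -mulmxDr -linearD; congr (_ *m diag_mx _ *m _).
by apply/rowP => i; rewrite !mxE rmorphD.
Qed.

Lemma fcC c h : fc (fun=> c) h = c%:C%C%:M.
Proof.
rewrite /fc; have -> : diag_mx (\row__ c%:C%C) = c%:C%C%:M :> 'M[C]_m.
  by apply/matrixP => i j; rewrite !mxE.
by rewrite mul_mx_scalar -scalemxAl spectralmxl scalemx1.
Qed.

Lemma fc1 h : fc (fun=> 1) h = 1%:M.
Proof. by rewrite fcC. Qed.

Lemma fc_sum (I : Type) (r : seq I) (F : I -> R -> R) h :
  fc (fun x => \sum_(i <- r) F i x) h = \sum_(i <- r) fc (F i) h.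
Proof.
elim: r => [|i r IH].
  rewrite (@fc_ext _ (fun=> 0)) => [|j]; last by rewrite big_nil.
  by rewrite fcC big_nil -scalemx1 scale0r.
rewrite (@fc_ext _ (fun x => F i x + \sum_(i <- r) F i x)) => [|j].
  by rewrite -fcD IH big_cons.
by rewrite big_cons.
Qed.

Lemma fc_ctr f h : (fc f h)^t* = fc f h.
Proof.
rewrite /fc !ctrmxM ctrmxK mulmxA tr_diag_mx map_diag_mx.
by congr (_ *m diag_mx _ *m _); apply/rowP => i; rewrite !mxE; exact: conj_real.
Qed.

Lemma fc_eq0 f h i : fc f h = 0 -> f (ev h i) = 0.
Proof.
move=> /(congr1 (fun X => spectralmx h *m X *m (spectralmx h)^t*)).
rewrite /fc !mulmxA spectralmxr mul1mx -mulmxA spectralmxr mulmx1.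
rewrite mulmx0 mul0mx => /matrixP /(_ i i); rewrite !mxE eqxx mulr1n.
by case.
Qed.

(* [fc f h] is a polynomial in [h] because [f] can be interpolated on the spectrum. *)
Lemma fc_poly_mem (P : 'M[C]_m -> Prop) h : h^t* = h -> P 1%:M ->
  (forall X, P X -> P (X *m h)) -> (forall X c, P X -> P (c *: X)) ->
  (forall X Y, P X -> P Y -> P (X + Y)) ->
  forall f, P (fc f h).
Proof.
move=> hh P1 PM PZ PD f.
have [p hp] := interpolate f [seq ev h i | i <- enum 'I_m].
have -> : fc f h = fc (fun x => p.[x]) h.
  by apply: fc_ext => i; rewrite hp // map_f // mem_enum.
elim/poly_ind: p {hp} => [|p c IH].
  rewrite (@fc_ext _ (fun=> 0)) => [|j]; last by rewrite horner0.
  by rewrite fcC -scalemx1; exact: PZ.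
rewrite (@fc_ext _ (fun x => p.[x] * x + c)) => [|j]; last first.
  by rewrite hornerD hornerMX hornerC.
rewrite -(fcD (fun x => p.[x] * x)) fcC -scalemx1; apply: PD; last exact: PZ.
by rewrite -(fcM (fun x => p.[x]) id) fc_id //; apply: PM.
Qed.

Lemma fc_mem (A : {vspace 'M[C]_m}) f h :
  unital_star_algebra A -> h^t* = h -> h \in A -> fc f h \in A.
Proof.
move=> [[AM _] A1] hh hA; apply: (fc_poly_mem (P := fun X => X \in A)) => //.
- by move=> X XA; apply: AM.
- by move=> X c; apply: memvZ.
- by move=> X Y; apply: memvD.
Qed.

Lemma fc_comm f h A : h^t* = h -> A *m h = h *m A -> A *m fc f h = fc f h *m A.
Proof.
move=> hh Ah; apply: (fc_poly_mem (P := fun X => A *m X = X *m A)) => //.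
- by rewrite mulmx1 mul1mx.
- by move=> X XA; rewrite mulmxA XA -!mulmxA Ah.
- by move=> X c XA; rewrite -scalemxAr XA scalemxAl.
- by move=> X Y XA YA; rewrite mulmxDr mulmxDl XA YA.
Qed.

End FunctionalCalculus.

(** * Minimal projections and matrix units *)

Section MinimalProjections.
Variables (R : realType) (m : nat).
Local Notation C := R[i].
Implicit Types (A : {vspace 'M[C]_m}) (p q h x : 'M[C]_m).

Lemma usalg_mul A x y : unital_star_algebra A -> x \in A -> y \in A -> x *m y \in A.
Proof. by case=> [[AM _] _]; apply: AM. Qed.

Lemma usalg_ctr A x : unital_star_algebra A -> x \in A -> x^t* \in A.
Proof. by case=> [[_ AS] _]; apply: AS. Qed.

Definition projection A p := [/\ p \in A, p^t* = p, p *m p = p & p != 0].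

(** Some spectral projection of [h] has a nonzero product with [p]. It commutes with [p], and the
    product differs from [p], since otherwise [h] would be the eigenvalue times [p]. *)
Lemma projection_split A p h : unital_star_algebra A -> projection A p ->
  h \in A -> h^t* = h -> p *m h = h -> (forall c, h <> c *: p) ->
  exists2 q, projection A q & q *m p = q /\ q != p.
Proof.
move=> uA [pA pp ppp p0] hA hh ph hN.
have hp : h *m p = h by rewrite -{1}hh -{1}pp -ctrmxM ph hh.
(* [undup] keeps each eigenvalue once, so that the indicators sum to 1 on the spectrum. *)
pose L := undup [seq ev h i | i <- enum 'I_m].
pose ind (l x : R) : R := (x == l)%:R.
have sumL : \sum_(l <- L) fc (ind l) h = 1%:M.
  rewrite -fc_sum -(fc1 h); apply: fc_ext => i.
  have iL : ev h i \in L by rewrite mem_undup map_f ?mem_enum.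
  rewrite (bigD1_seq _ iL) ?undup_uniq //= /ind eqxx big1 ?addr0 // => l.
  by rewrite eq_sym => /negPf->.
have [l l0] : exists l, fc (ind l) h *m p != 0.
  apply/not_existsP => h0; move/eqP: p0; apply.
  rewrite -[p]mul1mx -sumL mulmx_suml big1 // => l _.
  by apply/eqP; rewrite -[_ == _]negbK; apply/negP => /h0.
have pc : p *m fc (ind l) h = fc (ind l) h *m p by apply: fc_comm; rewrite ?ph.
exists (fc (ind l) h *m p); split => //.
- by apply: usalg_mul => //; apply: fc_mem.
- by rewrite ctrmxM fc_ctr pp pc.
- rewrite mulmxA -(mulmxA _ p) pc mulmxA fcM -mulmxA ppp.
  by congr (_ *m p); apply: fc_ext => i; rewrite /ind; case: eqP; rewrite ?mul1r ?mul0r.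
- by rewrite -mulmxA ppp.
apply/eqP => e; apply: (hN l%:C%C); rewrite -{1}hp -{1}e mulmxA.
rewrite -{1}(fc_id hh) fcM (fc_ext (g := fun x : R => l * ind l x)) => [|i]; last first.
  by rewrite /ind /=; case: eqP => [->|]; rewrite ?mulr0.
by rewrite -(fcM (fun=> l)) fcC -mulmxA e mul_scalar_mx.
Qed.

Definition minimal_projection A p :=
  projection A p /\ forall x, x \in A -> exists c, p *m x *m p = c *: p.

(** If [p] has no proper subprojection, self-adjoint elements of the corner of [p] are multiples of
    [p]; real and imaginary parts then settle every element of the corner. *)
Lemma nonminimal_split A p : unital_star_algebra A -> projection A p ->
  ~ minimal_projection A p ->
  exists2 q, projection A q & q *m p = q /\ q != p.
Proof.
move=> uA pP; have [pA pp ppp p0] := pP; apply: contra_notP => noq; split=> // x xA.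
have H h : h \in A -> h^t* = h -> p *m h = h -> exists c, h = c *: p.
  move=> hA hh ph; apply: contra_notP noq => hN.
  by apply: (projection_split uA pP hA hh ph) => c hc; apply: hN; exists c.
set y := p *m x *m p.
have yA : y \in A by rewrite !usalg_mul.
have py : p *m y = y by rewrite /y !mulmxA ppp.
have yp : y^t* = p *m x^t* *m p by rewrite /y !ctrmxM pp mulmxA.
have pyc : p *m y^t* = y^t* by rewrite yp !mulmxA ppp.
have ycA : y^t* \in A by apply: usalg_ctr.
have [|||a ha] := H (y + y^t*).
- by rewrite memvD.
- by rewrite ctrmxD ctrmxK addrC.
- by rewrite mulmxDr py pyc.
have [|||b hb] := H ('i *: (y - y^t*)).
- by rewrite memvZ // memvB.
- by rewrite ctrmxZ ctrmxB ctrmxK conjCi scaleNr -scalerN opprB.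
- by rewrite -scalemxAr mulmxBr py pyc.
exists (2^-1 * (a - 'i * b)).
have -> : y = 2^-1 *: ((y + y^t*) + (y - y^t*)).
  by rewrite addrACA subrr addr0 -mulr2n -(scaler_nat 2 y) scalerA mulVf ?scale1r ?pnatr_eq0.
rewrite ha -scalerA scalerBl; congr (_ *: (_ + _)).
by rewrite -scalerA -hb scalerA -expr2 sqrCi scaleN1r opprK.
Qed.

Definition proj_family A r (p : 'I_r -> 'M[C]_m) :=
  [/\ forall a, projection A (p a),
      forall a b, a != b -> p a *m p b = 0 & \sum_a p a = 1%:M].

(** Nonzero orthogonal projections are linearly independent. The bound makes a longest family
    exist. *)
Lemma proj_family_bound A r (p : 'I_r -> 'M[C]_m) :
  proj_family A p -> (r <= \dim {:'M[C]_m})%N.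
Proof.
case=> pP p_orth _; pose X := [tuple p i | i < r].
have : free X.
  apply/freeP => k; under eq_bigr do rewrite -tnth_nth tnth_mktuple.
  move=> k0 i; have [_ _ ppp /negPf p0] := pP i.
  have : k i *: p i = 0.
    rewrite -(mul0mx _ (p i)) -k0 mulmx_suml (bigD1 i) //= big1 => [|j ji].
      by rewrite addr0 -scalemxAl ppp.
    by rewrite -scalemxAl p_orth // scaler0.
  by move/eqP; rewrite scaler_eq0 p0 orbF => /eqP.
by rewrite /free size_tuple => /eqP <-; apply/dimvS/subvf.
Qed.

(** In a longest family every member is minimal: splitting [p a] into [q] and [p a - q] would give
    one member more. *)
Lemma minimal_proj_family A : (0 < m)%N -> unital_star_algebra A ->
  exists r (p : 'I_r -> 'M[C]_m),
    proj_family A p /\ forall a, minimal_projection A (p a).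
Proof.
move=> m0 uA; pose F r := `[< exists p : 'I_r -> 'M[C]_m, proj_family A p >].
have F1 : exists r, F r.
  exists 1%N; apply/asboolP; exists (fun=> 1%:M); split.
  - move=> _; split; rewrite ?ctrmx1 ?mulmx1 //; first by case: uA.
    apply/eqP => e1; have /esym/eqP := frob1 R m.
    by rewrite e1 frob0 pnatr_eq0 eqn0Ngt m0.
  - by move=> a b; rewrite !ord1.
  - by rewrite big_ord1.
have Fb r : F r -> (r <= \dim {:'M[C]_m})%N.
  by move=> /asboolP [p]; apply: proj_family_bound.
have [r /asboolP[p pF] rmax] := ex_maxnP F1 Fb.
exists r, p; split => // a; apply: contrapT => /(nonminimal_split uA).
have [pP p_orth psum] := pF; have [pA pp ppp p0] := pP a.
case/(_ (pP a)) => q [qA qq qqq q0] [qp qNp].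
have pq : p a *m q = q by rewrite -{1}qq -{1}pp -ctrmxM qp qq.
have qb b : b != a -> q *m p b = 0 /\ p b *m q = 0.
  move=> ba; split; first by rewrite -qp -mulmxA p_orth ?mulmx0 // eq_sym.
  by rewrite -pq mulmxA p_orth ?mul0mx.
suff : F r.+1 by move=> /rmax; rewrite ltnn.
apply/asboolP.
pose p2 b := if b == a then p a - q else p b.
exists (fun i => oapp p2 q (unlift ord0 i)).
have p2q b : p2 b *m q = 0 /\ q *m p2 b = 0.
  rewrite /p2; case: eqP => [_|/eqP /qb []] //.
  by rewrite mulmxBl mulmxBr pq qp qqq subrr.
have p2p2 b c : b != c -> p2 b *m p2 c = 0.
  move=> bc; rewrite /p2; case: ifP => [/eqP ba|/negbT ba]; case: ifP => [/eqP ca|/negbT ca].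
  - by rewrite ba ca eqxx in bc.
  - by rewrite mulmxBl (qb _ ca).1 p_orth ?subr0 // eq_sym.
  - by rewrite mulmxBr (qb _ ba).2 p_orth ?subr0.
  - by rewrite p_orth.
split.
- move=> i; case: unliftP => [b _|_] //=.
  rewrite /p2; case: eqP => // _; split.
  + by rewrite memvB.
  + by rewrite ctrmxB pp qq.
  + by rewrite mulmxBl !mulmxBr ppp pq qp qqq subrr subr0.
  + by rewrite subr_eq0 eq_sym.
- move=> i j; case: unliftP => [b ->|->]; case: unliftP => [c ->|->] //=.
  + by rewrite (inj_eq (@lift_inj _ _)); apply: p2p2.
  + by rewrite (p2q b).1.
  + by rewrite (p2q c).2.
- rewrite big_ord_recl unlift_none /=; under eq_bigr do rewrite liftK /=.
  rewrite (bigD1 a) //= {1}/p2 eqxx addrA subrKC -psum [in RHS](bigD1 a) //=.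
  by congr (_ + _); apply: eq_bigr => b /negPf ba; rewrite /p2 ba.
Qed.

End MinimalProjections.

(* [cl a] is a representative of the matrix block of [a]; off-block units are [0]. *)
Record matrix_units (R : realType) m (A : {vspace 'M[R[i]]_m}) (r : nat)
    (cl : 'I_r -> 'I_r) (e : 'I_r -> 'I_r -> 'M[R[i]]_m) : Prop := MatrixUnits {
  mu_cl : forall a, cl (cl a) = cl a;
  mu_mem : forall a b, e a b \in A;
  mu_off : forall a b, cl a != cl b -> e a b = 0;
  mu_mul : forall a b c d, cl a = cl b ->
    e a b *m e c d = if b == c then e a d else 0;
  mu_ctr : forall a b, (e a b)^t* = e b a;
  mu_sum : \sum_a e a a = 1%:M;
  mu_neq0 : forall a, e a a != 0;
  mu_span : forall x, x \in A ->
    exists k : 'I_r -> 'I_r -> R[i], x = \sum_a \sum_b k a b *: e a b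
}.

Section MatrixUnits.
Variables (R : realType) (m : nat) (A : {vspace 'M[R[i]]_m}).
Hypothesis uA : unital_star_algebra A.
Local Notation C := R[i].

Lemma projection_frob (p : 'M[C]_m) : projection A p -> \tr p = (frob p)%:C%C.
Proof. by case=> _ pp ppp _; rewrite -{1}ppp -{1}pp mxtrace_frob. Qed.

(** Taking traces identifies the scalar as a quotient of two squared norms, hence positive. *)
Lemma minimal_scalar (p w : 'M[C]_m) : minimal_projection A p -> w != 0 ->
  w *m p = w -> w \in A -> exists2 k : R, 0 < k & w^t* *m w = k%:C%C *: p.
Proof.
case=> pP pmin w0 wp wA; have [pA pp ppp p0] := pP.
have [c hc] := pmin _ (usalg_mul uA (usalg_ctr uA wA) wA).
have hw : w^t* *m w = c *: p.
  by rewrite -hc mulmxA -mulmxA wp -{1}pp -ctrmxM wp.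
exists (frob w / frob p); first by rewrite divr_gt0 ?frob_gt0.
rewrite hw; congr (_ *: _).
have := mxtrace_frob w; rewrite hw mxtraceZ (projection_frob pP) => h.
rewrite rmorphM fmorphV /= -h mulfK //.
by rewrite -(rmorph0 (real_complex R)) (inj_eq (@complexI R)) gt_eqF ?frob_gt0.
Qed.

(** Polar decomposition reduces to a scaling: by minimality [w^t* *m w] and [w *m w^t*] are
    multiples [k] and [l] of [q] and [p], and squaring the second shows [k = l]. *)
Lemma partial_isometry (p q w : 'M[C]_m) :
  minimal_projection A p -> minimal_projection A q -> w \in A -> w != 0 ->
  p *m w = w -> w *m q = w ->
  exists2 v, v \in A & v *m v^t* = p /\ v^t* *m v = q.
Proof.
move=> pM qM wA w0 pw wq.
have [[pA pp ppp p0] _] := pM; have [[qA qq qqq q0] _] := qM.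
have wc0 : w^t* != 0 by apply: contra_neq w0 => /(congr1 (fun x => x^t*)); rewrite ctrmxK ctrmx0.
have [k k0 hk] := minimal_scalar qM w0 wq wA.
have wcp : w^t* *m p = w^t* by rewrite -{1}pp -ctrmxM pw.
have [l l0 hl] := minimal_scalar pM wc0 wcp (usalg_ctr uA wA).
rewrite ctrmxK in hl.
have kl : k = l.
  have : (w *m w^t*) *m (w *m w^t*) = k%:C%C *: (w *m w^t*).
    by rewrite mulmxA -(mulmxA w) hk -scalemxAr -scalemxAl wq.
  rewrite hl -scalemxAl -scalemxAr ppp => /eqP.
  rewrite -subr_eq0 !scalerA -scalerBl scaler_eq0 (negPf p0) orbF -mulrBl.
  rewrite mulf_eq0 subr_eq0 (inj_eq (@complexI R)) orbC.
  by rewrite -(rmorph0 (real_complex R)) (inj_eq (@complexI R)) gt_eqF //= => /eqP.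
have s2 : ((Num.sqrt k)^-1%:C%C * (Num.sqrt k)^-1%:C%C) * k%:C%C = 1 :> C.
  rewrite -!rmorphM /= -invfM -expr2 sqr_sqrtr ?ltW // mulVf ?gt_eqF //.
exists ((Num.sqrt k)^-1%:C%C *: w); first exact: memvZ.
rewrite ctrmxZ conj_real -!scalemxAl -!scalemxAr !scalerA hk hl -kl !scalerA s2.
by rewrite !scale1r.
Qed.

Lemma matrix_units_exist : (0 < m)%N ->
  exists r cl (e : 'I_r -> 'I_r -> 'M[C]_m), matrix_units A cl e.
Proof.
move=> m0; have [r [p [[pP p_orth psum] pM]]] := minimal_proj_family m0 uA.
(* [L] is Murray-von Neumann equivalence inside [A]; its classes are the matrix blocks. *)
pose L a b := `[< exists2 v, v \in A & v *m v^t* = p a /\ v^t* *m v = p b >].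
have pv v a : v *m v^t* = p a -> p a *m v = v.
  move=> va; apply/eqP; rewrite -subr_eq0; apply/eqP; apply: frob_eq0.
  have [_ pp ppp _] := pP a.
  rewrite frobEr ctrmxB ctrmxM pp mulmxBl !mulmxBr !mulmxA.
  by rewrite -!(mulmxA (p a) v) !va !ppp !subrr rtr0.
have Lrefl a : L a a.
  have [pA pp ppp _] := pP a.
  by apply/asboolP; exists (p a) => //; rewrite pp ppp.
have Lsym a b : L a b -> L b a.
  move=> /asboolP[v vA [va vb]]; apply/asboolP; exists (v^t*); first exact: usalg_ctr.
  by rewrite ctrmxK.
have Ltrans a b c : L a b -> L b c -> L a c.
  move=> /asboolP[v vA [va vb]] /asboolP[w wA [wb wc]]; apply/asboolP.
  exists (v *m w); first exact: usalg_mul.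
  rewrite ctrmxM !mulmxA -(mulmxA v w) wb -(mulmxA _ (v^t*) v) vb.
  have vp : v *m p b = v.
    have h : p b *m v^t* = v^t* by apply: pv; rewrite ctrmxK.
    have [_ pp _ _] := pP b.
    by rewrite -[v in RHS]ctrmxK -h ctrmxM ctrmxK pp.
  by rewrite vp va -mulmxA pv.
(* [L] is reflexive, so the default is never taken, and [pick] depends only on the class of [a]. *)
pose cl a := odflt a [pick b | L a b].
have Lcl a : L a (cl a) by rewrite /cl; case: pickP => //= /(_ a); rewrite Lrefl.
have cl_eq a b : L a b -> cl a = cl b.
  move=> ab; rewrite /cl; have -> : [pick c | L a c] = [pick c | L b c].
    by apply: eq_pick => c; apply/idP/idP; apply: Ltrans => //; apply: Lsym.
  by case: pickP => //= /(_ b); rewrite Lrefl.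
have clK a : cl (cl a) = cl a by apply/esym/cl_eq.
have {}Lcl a : exists v, [/\ v \in A, v *m v^t* = p a & v^t* *m v = p (cl a)].
  by have /asboolP[v vA [va vb]] := Lcl a; exists v.
have [g gP] := choice Lcl.
have gA a : g a \in A by case: (gP a).
have pg a : p a *m g a = g a by apply: pv; case: (gP a).
have gp a : g a *m p (cl a) = g a.
  have [_ _ h] := gP a; have [_ pp _ _] := pP (cl a).
  by rewrite -[g a in LHS]ctrmxK -{1}pp -ctrmxM pv ?ctrmxK.
have gpc a : (g a)^t* *m p a = (g a)^t*.
  by have [_ pp _ _] := pP a; rewrite -{1}pp -ctrmxM pg.
have pgc a : p (cl a) *m (g a)^t* = (g a)^t*.
  by have [_ pp _ _] := pP (cl a); rewrite -{1}pp -ctrmxM gp.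
(* All units of a block factor through its representative: [g a] carries [p (cl a)] to [p a]. *)
pose e a b := if cl a == cl b then g a *m (g b)^t* else 0.
have ee a : e a a = p a by rewrite /e eqxx; case: (gP a).
exists r, cl, e; split.
- exact: clK.
- move=> a b; rewrite /e; case: ifP => _; rewrite ?mem0v // usalg_mul //.
  exact: usalg_ctr.
- by move=> a b; rewrite /e => /negPf->.
- move=> a b c d ab; rewrite /e {1}ab eqxx.
  have [<-|bc] := eqVneq b c.
    rewrite ab; case: ifP => [/eqP bd|_]; last by rewrite mulmx0.
    have [_ _ h] := gP b.
    by rewrite mulmxA -(mulmxA (g a)) h bd -mulmxA pgc.
  case: ifP => _; last by rewrite mulmx0.
  rewrite mulmxA -(mulmxA (g a)) -gpc -(pg c) -!mulmxA (mulmxA (p b)) p_orth //.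
  by rewrite mul0mx !mulmx0.
- move=> a b; rewrite /e eq_sym; case: ifP => _; last exact: ctrmx0.
  by rewrite ctrmxM ctrmxK.
- by under eq_bigr do rewrite ee.
- by move=> a; rewrite ee; case: (pP a).
move=> x xA.
(* A nonzero corner yields a partial isometry, so it lies inside one block; pulled back to the
   minimal projection [p (cl a)] it is a scalar. *)
have H a b : exists k, p a *m x *m p b = k *: e a b.
  have [xab0|xab] := eqVneq (p a *m x *m p b) 0.
    by exists 0; rewrite scale0r.
  have [pA pp ppp _] := pP a; have [qA qq qqq _] := pP b.
  have : L a b.
    apply/asboolP; apply: (partial_isometry (pM a) (pM b) _ xab).
    - by rewrite !usalg_mul.
    - by rewrite !mulmxA ppp.
    - by rewrite -mulmxA qqq.
  move/cl_eq => ab; have [_ /(_ ((g a)^t* *m x *m g b))] := pM (cl a).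
  rewrite !usalg_mul ?usalg_ctr // => /(_ isT) [k hk]; exists k.
  rewrite /e ab eqxx.
  have [_ ha _] := gP a; have [_ hb _] := gP b.
  have E : g a *m (p (cl a) *m ((g a)^t* *m x *m g b) *m p (cl a)) *m (g b)^t*
      = p a *m x *m p b.
    by rewrite !mulmxA gp -(mulmxA _ (p (cl a)) ((g b)^t*)) ab pgc -ha -hb !mulmxA.
  by rewrite -E hk -scalemxAr -scalemxAl gp.
have [k hk] := choice (fun ab : 'I_r * 'I_r => H ab.1 ab.2).
exists (fun a b => k (a, b)).
rewrite -[LHS]mul1mx -[LHS]mulmx1 -psum !mulmx_suml; apply: eq_bigr => a _.
by rewrite mulmx_sumr; apply: eq_bigr => b _; rewrite (hk (a, b)).
Qed.

End MatrixUnits.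

(** * Conditional expectations *)

Section Expectation.
Variables (R : realType) (m : nat) (A : {vspace 'M[R[i]]_m}).
Variables (r : nat) (cl : 'I_r -> 'I_r) (e : 'I_r -> 'I_r -> 'M[R[i]]_m).
Hypothesis uA : unital_star_algebra A.
Hypothesis mu : matrix_units A cl e.
Local Notation C := R[i].
Implicit Types (x y X Y : 'M[C]_m) (a b c d : 'I_r).

(** The squared norm of a projection is its unnormalized trace. *)
Definition mu_wt a : R := frob (e a a).
Definition mu_size a : R := (#|[pred b | cl b == cl a]|)%:R.
Definition mu_ratio a : R := mu_size a / mu_wt a.

Lemma mu_wt_gt0 a : 0 < mu_wt a.
Proof. exact/frob_gt0/(mu_neq0 mu). Qed.

Lemma mu_size_gt0 a : 0 < mu_size a.
Proof. by rewrite ltr0n; apply/card_gt0P; exists a; rewrite inE. Qed.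

Lemma mu_ratio_gt0 a : 0 < mu_ratio a.
Proof. by rewrite divr_gt0 ?mu_wt_gt0 ?mu_size_gt0. Qed.

Lemma mu_size_cl a b : cl a = cl b -> mu_size a = mu_size b.
Proof. by rewrite /mu_size => ->. Qed.

Lemma mu_diag a : e a a *m e a a = e a a.
Proof. by rewrite (mu_mul mu) ?eqxx. Qed.

Lemma mxtrace_mu a b : \tr (e a b) = if a == b then (mu_wt a)%:C%C else 0.
Proof.
case: eqVneq => [<-|ab].
  by rewrite /mu_wt -mxtrace_frob (mu_ctr mu) mu_diag.
have [cab|/(mu_off mu)->] := eqVneq (cl a) (cl b); last by rewrite mxtrace0.
have <- : e a a *m e a b = e a b by rewrite (mu_mul mu) ?eqxx.
by rewrite mxtrace_mulC (mu_mul mu) // eq_sym (negPf ab) mxtrace0.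
Qed.

Lemma rtr_mu a : rtr (e a a) = mu_wt a.
Proof. by rewrite /rtr mxtrace_mu eqxx. Qed.

Lemma mu_wt_cl a b : cl a = cl b -> mu_wt a = mu_wt b.
Proof.
move=> ab; rewrite -!rtr_mu.
have <- : e a b *m e b a = e a a by rewrite (mu_mul mu) ?eqxx.
by rewrite rtrC (mu_mul mu) ?eqxx.
Qed.

Lemma mu_ratio_cl a b : cl a = cl b -> mu_ratio a = mu_ratio b.
Proof. by move=> ab; rewrite /mu_ratio (mu_size_cl ab) (mu_wt_cl ab). Qed.

Lemma frob_mu a b : cl a = cl b -> frob (e a b) = mu_wt a.
Proof.
by move=> ab; rewrite frobEr (mu_ctr mu) (mu_mul mu) ?eqxx ?rtr_mu.
Qed.

Lemma mxtrace_mu2 a b c d : cl a = cl b ->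
  \tr ((e a b)^t* *m e c d) = if (a == c) && (b == d) then (mu_wt a)%:C%C else 0.
Proof.
move=> ab; rewrite (mu_ctr mu) (mu_mul mu) //; case: eqVneq => [_|_] /=.
  by rewrite mxtrace_mu (mu_wt_cl ab).
exact: mxtrace0.
Qed.

Definition mu_coef X a b : C := (mu_wt a)^-1%:C%C * \tr ((e a b)^t* *m X).

(** The trace-preserving conditional expectation onto [A], as an orthogonal expansion; the zero
    units between different blocks contribute nothing. *)
Definition cexp X : 'M[C]_m := \sum_a \sum_b mu_coef X a b *: e a b.

Lemma cexpD X Y : cexp (X + Y) = cexp X + cexp Y.
Proof.
rewrite /cexp -big_split; apply: eq_bigr => a _ /=.
rewrite -big_split; apply: eq_bigr => b _ /=.
by rewrite -scalerDl /mu_coef mulmxDr mxtraceD mulrDr.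
Qed.

Lemma cexpN X : cexp (- X) = - cexp X.
Proof.
rewrite /cexp -sumrN; apply: eq_bigr => a _.
rewrite -sumrN; apply: eq_bigr => b _.
by rewrite -scaleNr /mu_coef mulmxN linearN mulrN.
Qed.

Lemma cexp_mem X : cexp X \in A.
Proof.
rewrite memv_suml // => a _; rewrite memv_suml // => b _.
by rewrite memvZ ?(mu_mem mu).
Qed.

Lemma cexp_orth X y : y \in A -> \tr (y^t* *m (X - cexp X)) = 0.
Proof.
case/(mu_span mu) => k ->; rewrite ctrmx_sum mulmx_suml linear_sum big1 //= => a _.
rewrite ctrmx_sum mulmx_suml linear_sum big1 //= => b _.
rewrite ctrmxZ -scalemxAl mxtraceZ.
have [ab|/(mu_off mu)->] := eqVneq (cl a) (cl b); last first.
  by rewrite ctrmx0 mul0mx mxtrace0 mulr0.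
suff -> : \tr ((e a b)^t* *m (X - cexp X)) = 0 by rewrite mulr0.
rewrite mulmxBr linearB /=; apply/eqP; rewrite subr_eq0 eq_sym; apply/eqP.
rewrite mulmx_sumr linear_sum /= (bigD1 a) //= [X in _ + X]big1 => [|c ca]; last first.
  rewrite mulmx_sumr linear_sum big1 //= => d _.
  by rewrite -scalemxAr mxtraceZ mxtrace_mu2 // eq_sym (negPf ca) mulr0.
rewrite addr0 mulmx_sumr linear_sum /= (bigD1 b) //= [X in _ + X]big1 => [|d db]; last first.
  by rewrite -scalemxAr mxtraceZ mxtrace_mu2 // (eq_sym b) (negPf db) andbF mulr0.
rewrite addr0 -scalemxAr mxtraceZ mxtrace_mu2 // !eqxx /= /mu_coef mulrAC.
by rewrite -rmorphM /= mulVf ?gt_eqF ?mu_wt_gt0 // mul1r.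
Qed.

Lemma cexp_pyth X y : y \in A -> frob (X - y) = frob (X - cexp X) + frob (cexp X - y).
Proof.
move=> yA; rewrite -[X - y](subrKA (cexp X)) [LHS]frob_add.
suff -> : ip (X - cexp X) (cexp X - y) = 0 by rewrite mulr0 addr0.
by rewrite ipC /ip /rtr cexp_orth // memvB ?cexp_mem.
Qed.

Lemma cexp_dist X y : y \in A -> frob (X - cexp X) <= frob (X - y).
Proof. by move=> yA; rewrite (cexp_pyth X yA) lerDl frob_ge0. Qed.

Lemma cexp_frob X : frob X = frob (X - cexp X) + frob (cexp X).
Proof. by have := cexp_pyth X (mem0v A); rewrite !subr0. Qed.

Lemma cexp_uniq X z : z \in A ->
  (forall y, y \in A -> \tr (y^t* *m (X - z)) = 0) -> cexp X = z.
Proof.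
move=> zA hz; apply/eqP; rewrite -subr_eq0; apply/eqP/frob_eq0.
have zEA : cexp X - z \in A by rewrite memvB ?cexp_mem.
apply: (@complexI R); rewrite -mxtrace_frob.
have {2}-> : cexp X - z = (X - z) - (X - cexp X) by rewrite opprB [RHS]addrC subrKA.
by rewrite mulmxBr linearB /= cexp_orth // hz // subr0.
Qed.

Lemma cexp_modr X y : y \in A -> cexp (X *m y) = cexp X *m y.
Proof.
move=> yA; apply: cexp_uniq; first by rewrite usalg_mul ?cexp_mem.
move=> z zA; rewrite -mulmxBl mulmxA mxtrace_mulC mulmxA.
have -> : y *m z^t* = (z *m y^t*)^t* by rewrite ctrmxM ctrmxK.
by rewrite cexp_orth // usalg_mul ?usalg_ctr.
Qed.

Lemma frob_lincomb (k : 'I_r -> 'I_r -> C) :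
  frob (\sum_a \sum_b k a b *: e a b)
    = \sum_a \sum_(b | cl b == cl a) nsq (k a b) * mu_wt a.
Proof.
pose F a := \sum_(b | cl b == cl a) k a b *: e a b.
have -> : \sum_a \sum_b k a b *: e a b = \sum_a F a.
  apply: eq_bigr => a _; rewrite [RHS]big_mkcond; apply: eq_bigr => b _ /=.
  by case: eqVneq => // /eqP h; rewrite (mu_off mu) ?scaler0 // eq_sym; apply/eqP.
have ipe a b c d : cl b = cl a -> (a, b) != (c, d) -> ip (k a b *: e a b) (k c d *: e c d) = 0.
  move=> ba; rewrite xpair_eqE => abcd.
  rewrite /ip /rtr ctrmxZ -scalemxAl -scalemxAr !mxtraceZ mxtrace_mu2 //.
  by rewrite (negPf abcd) !mulr0.
rewrite frob_sum_orth => [|a c _ _ ac]; last first.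
  rewrite ip_suml big1 // => b /eqP ba; rewrite ip_sumr big1 // => d _.
  by rewrite ipe // xpair_eqE (negPf ac).
apply: eq_bigr => a _; rewrite frob_sum_orth => [|b d /eqP ba _ bd].
  by apply: eq_bigr => b /eqP ba; rewrite frobZ frob_mu.
by rewrite ipe // xpair_eqE (negPf bd) andbF.
Qed.

Lemma frob_cexp X : frob (cexp X) =
  \sum_a \sum_(b | cl b == cl a) nsq (\tr ((e a b)^t* *m X)) / mu_wt a.
Proof.
rewrite frob_lincomb; apply: eq_bigr => a _; apply: eq_bigr => b _.
rewrite /mu_coef nsqM nsq_real mulrC mulrA mulrC; congr (_ * _).
by rewrite expr2 mulrA divff ?mul1r // gt_eqF ?mu_wt_gt0.
Qed.

End Expectation.

(** * Averaging over unitaries *)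

Section Averaging.
Variable R : realType.
Local Notation C := R[i].

Definition sgx (V : zmodType) (b : bool) (x : V) : V := if b then - x else x.

Lemma frob_sgx m n (b : bool) (X : 'M[C]_(m, n)) : frob (sgx b X) = frob X.
Proof. by case: b; rewrite //= frobN. Qed.

(* With [ep = 1] or [ep = -1] the random-sign average is bounded from either side. *)
Lemma signs_average m n (ep : R) (I : eqType) (s : seq I) (Y : I -> 'M[C]_(m, n)) :
  uniq s -> exists sg : I -> bool,
    ep * \sum_(a <- s) frob (Y a) <= ep * frob (\sum_(a <- s) sgx (sg a) (Y a)).
Proof.
elim: s => [_|a s IH /= /andP[as_ /IH{IH}[sg hsg]]].
  by exists xpredT; rewrite !big_nil frob0.
set Z := \sum_(a <- s) sgx _ _ in hsg.
have [b hb] : exists b, 0 <= ep * (2 * ip (sgx b (Y a)) Z).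
  have [h|h] := leP 0 (ep * (2 * ip (Y a) Z)); first by exists false.
  by exists true; rewrite /= ipNl !mulrN oppr_ge0 ltW.
exists (fun c => if c == a then b else sg c).
rewrite !big_cons eqxx [X in frob (_ + X)](_ : _ = Z); last first.
  rewrite /Z big_seq [RHS]big_seq; apply: eq_bigr => c cs.
  by case: eqP => // ca; rewrite ca (negPf as_) in cs.
rewrite frob_add frob_sgx !mulrDr -addrA lerD2l.
by apply: le_trans hsg _; rewrite lerDr.
Qed.

(** Under a uniformly random block-preserving permutation the image of [a] is uniform on its block.
    The double sum is therefore an expectation, and some permutation is at least as good; the sign
    of [ep] selects the direction. *)
Lemma perm_average r (cl : 'I_r -> 'I_r) (F : 'I_r -> 'I_r -> R) (ep : R) :
  exists2 s : {perm 'I_r}, forall a, cl (s a) = cl a &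
    ep * (\sum_a \sum_(b | cl b == cl a) (mu_size R cl a)^-1 * F a b)
      <= ep * (\sum_a F a (s a)).
Proof.
pose P (s : {perm 'I_r}) := [forall a, cl (s a) == cl a].
pose N : R := (#|P|)%:R.
pose n a b : nat := #|[pred s | P s & s a == b]|.
have P1 : P 1%g by apply/forallP => a; rewrite perm1.
have N0 : 0 < N by rewrite ltr0n; apply/card_gt0P; exists 1%g.
(* Composing with the transposition of [b] and [b'] injects the permutations sending [a] to [b] into
   those sending [a] to [b']. *)
have nle a b b' : cl b = cl a -> cl b' = cl a -> (n a b <= n a b')%N.
  move=> ba b'a; rewrite /n -(card_imset _ (mulIg (tperm b b'))).
  apply/subset_leq_card/fintype.subsetP => x /imsetP[s].
  rewrite inE => /andP[/forallP Ps /eqP sa] ->; rewrite inE permM sa tpermL eqxx andbT.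
  apply/forallP => c; rewrite permM; case: tpermP => [h|h|_ _]; last exact: Ps.
    by rewrite b'a -ba -h; apply: Ps.
  by rewrite ba -b'a -h; apply: Ps.
have neq a b b' : cl b = cl a -> cl b' = cl a -> n a b = n a b'.
  by move=> ba b'a; apply/eqP; rewrite eqn_leq !nle.
have sumF a : \sum_(s | P s) F a (s a) = \sum_(b | cl b == cl a) (n a b)%:R * F a b.
  rewrite (partition_big (fun s : {perm 'I_r} => s a) (fun b => cl b == cl a)) /=; last first.
    by move=> s /forallP.
  apply: eq_bigr => b _; rewrite (eq_bigr (fun=> F a b)) => [|s /andP[_ /eqP->] //].
  by rewrite sumr_const mulr_natl.
have nE a b : cl b = cl a -> (n a b)%:R = N * (mu_size R cl a)^-1.
  move=> ba; apply: canRL (mulfK _) _; first by rewrite gt_eqF ?mu_size_gt0.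
  have -> : N = \sum_(s | P s) 1 by rewrite sumr_const.
  rewrite (partition_big (fun s : {perm 'I_r} => s a) (fun b => cl b == cl a)) /=; last first.
    by move=> s /forallP.
  rewrite (eq_bigr (fun=> (n a b)%:R)) => [|c /eqP ca]; last first.
    by rewrite sumr_const (neq a b c).
  by rewrite sumr_const /mu_size mulr_natr.
apply: contrapT => hN.
have : \sum_(s | P s) ep * (\sum_a F a (s a)) <
    \sum_(s | P s) ep * (\sum_a \sum_(b | cl b == cl a) (mu_size R cl a)^-1 * F a b).
  apply: ltr_sum.
    by apply/hasP; exists 1%g; rewrite ?mem_index_enum.
  move=> s /forallP Ps; rewrite ltNge; apply/negP => h; apply: hN.
  by exists s => // a; apply/eqP.
rewrite -mulr_sumr exchange_big /= sumr_const -mulr_natr -/N.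
rewrite [X in X < _](_ : _ =
   ep * (\sum_a \sum_(b | cl b == cl a) (mu_size R cl a)^-1 * F a b) * N) ?ltxx //.
rewrite -mulrA; congr (_ * _); rewrite mulr_suml; apply: eq_bigr => a _.
rewrite sumF mulr_suml; apply: eq_bigr => b /eqP ba.
by rewrite nE //; ring.
Qed.

Variables (m : nat) (A : {vspace 'M[C]_m}).
Variables (r : nat) (cl : 'I_r -> 'I_r) (e : 'I_r -> 'I_r -> 'M[C]_m).
Hypothesis mu : matrix_units A cl e.

(* The average of [frob (L v)] over the unitaries [v] of [A]. *)
Definition mu_avg p q (L : 'M[C]_m -> 'M[C]_(p, q)) : R :=
  \sum_a \sum_(b | cl b == cl a) (mu_size R cl a)^-1 * frob (L (e a b)).

Variables (p q : nat) (L : 'M[C]_m -> 'M[C]_(p, q)).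
Hypothesis LD : {morph L : x y / x + y}.
Hypothesis LN : {morph L : x / - x}.

Let Lsum (s : 'I_r -> bool) (X : 'I_r -> 'M[C]_m) :
  L (\sum_a sgx (s a) (X a)) = \sum_a sgx (s a) (L (X a)).
Proof.
have L0 : L 0 = 0 by rewrite -(subrr 0) LD LN subrr.
by rewrite (big_morph L LD L0); apply: eq_bigr => a _; case: (s a) => //=; rewrite LN.
Qed.

Lemma unitary_perm_signs (s : 'I_r -> bool) (g : {perm 'I_r}) :
  (forall a, cl (g a) = cl a) ->
  let v := \sum_a sgx (s a) (e a (g a)) in v \in A /\ v^t* *m v = 1%:M.
Proof.
move=> gcl v; split.
  by rewrite memv_suml // => a _; case: (s a); rewrite /= ?memvN (mu_mem mu).
rewrite /v ctrmx_sum mulmx_suml.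
have := mu_sum mu; rewrite (reindex_inj (@perm_inj _ g)) /= => <-; apply: eq_bigr => a _.
rewrite mulmx_sumr (bigD1 a) //= big1 ?addr0 => [|b ba].
  by case: (s a) => /=; rewrite ?ctrmxN ?mulNmx ?mulmxN ?opprK (mu_ctr mu) (mu_mul mu) ?gcl ?eqxx.
have -> : (sgx (s a) (e a (g a)))^t* *m sgx (s b) (e b (g b)) =
  sgx (s a) (sgx (s b) ((e a (g a))^t* *m e b (g b))).
  by case: (s a); case: (s b); rewrite /= ?ctrmxN ?mulNmx ?mulmxN ?opprK.
rewrite (mu_ctr mu) (mu_mul mu) ?gcl // eq_sym (negPf ba).
by case: (s a); case: (s b); rewrite /= ?oppr0.
Qed.

(** Signed permutations inside the blocks replace Haar measure: permutations average the entries,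
    and random signs remove the cross terms. *)
Lemma mu_average (ep : R) : exists v, [/\ v \in A, v^t* *m v = 1%:M &
  ep * mu_avg L <= ep * frob (L v)].
Proof.
have [g gcl hg] := perm_average cl (fun a b => frob (L (e a b))) ep.
have [s hs] := signs_average ep (fun a => L (e a (g a))) (index_enum_uniq 'I_r).
have [vA vv] := unitary_perm_signs s gcl.
exists (\sum_a sgx (s a) (e a (g a))); split => //.
by rewrite Lsum; apply: le_trans hg hs.
Qed.

(** With signs alone, one unitary controls the defects of all minimal projections together. *)
Lemma mu_diag_average : exists v, [/\ v \in A, v^t* *m v = 1%:M &
  \sum_a frob (L (e a a)) <= frob (L v)].
Proof.
have [s hs] := signs_average 1 (fun a => L (e a a)) (index_enum_uniq 'I_r).
have [|vA vv] := @unitary_perm_signs s 1%g; first by move=> a; rewrite perm1.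
exists (\sum_a sgx (s a) (e a a)); split => //.
- by under eq_bigr => a _ do rewrite -[X in e _ X](perm1 a).
- by under eq_bigr => a _ do rewrite -[X in e _ X](perm1 a).
- by rewrite Lsum; rewrite !mul1r in hs.
Qed.

End Averaging.

(** * Overlaps of two systems of matrix units *)

Section Overlap.
Variables (R : realType) (m : nat).
Local Notation C := R[i].

Definition overlap r s (e : 'I_r -> 'I_r -> 'M[C]_m) (f : 'I_s -> 'I_s -> 'M[C]_m) c a : R :=
  rtr (e c c *m f a a).

Definition overlap2 r s (cle : 'I_r -> 'I_r) (clf : 'I_s -> 'I_s)
    (e : 'I_r -> 'I_r -> 'M[C]_m) (f : 'I_s -> 'I_s -> 'M[C]_m) c a : R :=
  \sum_(d | cle d == cle c) \sum_(b | clf b == clf a) nsq (\tr ((e c d)^t* *m f a b)).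

Lemma overlapC r s (e : 'I_r -> 'I_r -> 'M[C]_m) (f : 'I_s -> 'I_s -> 'M[C]_m) c a :
  overlap e f c a = overlap f e a c.
Proof. by rewrite /overlap rtrC. Qed.

Lemma nsq_trC (X Y : 'M[C]_m) : nsq (\tr (X^t* *m Y)) = nsq (\tr (Y^t* *m X)).
Proof. by rewrite -nsqC -mxtrace_ctr ctrmxM ctrmxK. Qed.

Lemma overlap2C r s (cle : 'I_r -> 'I_r) (clf : 'I_s -> 'I_s) e f c a :
  overlap2 cle clf e f c a = overlap2 clf cle f e a c.
Proof.
rewrite /overlap2 exchange_big; apply: eq_bigr => b _; apply: eq_bigr => d _.
exact: nsq_trC.
Qed.

Variables (A B : {vspace 'M[C]_m}).
Variables (r : nat) (cle : 'I_r -> 'I_r) (e : 'I_r -> 'I_r -> 'M[C]_m).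
Variables (s : nat) (clf : 'I_s -> 'I_s) (f : 'I_s -> 'I_s -> 'M[C]_m).
Hypothesis mue : matrix_units A cle e.
Hypothesis muf : matrix_units B clf f.

Lemma overlap_ge0 c a : 0 <= overlap e f c a.
Proof.
suff -> : overlap e f c a = frob (e c c *m f a a) by exact: frob_ge0.
rewrite frobE ctrmxM (mu_ctr mue) (mu_ctr muf) mulmxA -(mulmxA (f a a)) (mu_diag mue).
by rewrite rtrC mulmxA (mu_diag muf) rtrC.
Qed.

Lemma sum_overlap_l a : \sum_c overlap e f c a = mu_wt f a.
Proof. by rewrite -rtr_sum -mulmx_suml (mu_sum mue) mul1mx (rtr_mu muf). Qed.

(** Bessel's inequality for the orthogonal row [f a b], each entry of squared norm [mu_wt f a], is
    applied to every [e c d]; the sum over [d] produces the factor [mu_size]. *)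
Lemma overlap2_le c a :
  overlap2 cle clf e f c a <= mu_size R cle c * mu_wt f a * overlap e f c a.
Proof.
have bessel X : \sum_(b | clf b == clf a) nsq (\tr ((f a b)^t* *m X))
    <= mu_wt f a * frob (f a a *m X).
  rewrite mulrC -ler_pdivrMr ?(mu_wt_gt0 muf) // (cexp_frob muf (f a a *m X)).
  rewrite (frob_cexp muf) [X in _ + X](bigD1 a) //= addrCA mulr_suml.
  apply: le_trans (_ : _ <= \sum_(b | clf b == clf a)
      nsq (\tr ((f a b)^t* *m (f a a *m X))) / mu_wt f a) _.
    apply: ler_sum => b /eqP ba.
    by rewrite mulmxA !(mu_ctr muf) (mu_mul muf) ?eqxx.
  rewrite lerDl addr_ge0 ?frob_ge0 // sumr_ge0 // => i _; rewrite sumr_ge0 // => j _.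
  by rewrite divr_ge0 ?nsq_ge0 // ltW // (mu_wt_gt0 muf).
apply: le_trans (_ : _ <= \sum_(d | cle d == cle c) mu_wt f a * overlap e f c a) _.
  apply: ler_sum => d /eqP dc; under eq_bigr do rewrite nsq_trC.
  apply: le_trans (bessel _) _; rewrite ler_pM2l ?(mu_wt_gt0 muf) //.
  rewrite frobE ctrmxM (mu_ctr muf) mulmxA -(mulmxA _ (f a a) (f a a)) (mu_diag muf).
  by rewrite rtrC mulmxA (mu_ctr mue) (mu_mul mue) ?eqxx.
by rewrite sumr_const -[leLHS]mulr_natl mulrA.
Qed.

(** Pythagoras for [cexp e], with the norm of the expectation expanded in matrix units, splits the
    average defect over pairs of minimal projections. *)
Lemma mu_avg_overlap : mu_avg clf f (fun X => X - cexp e X) =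
  \sum_a \sum_c (overlap e f c a
    - overlap2 cle clf e f c a / (mu_size R clf a * mu_wt e c)).
Proof.
apply: eq_bigr => a _; rewrite sumrB sum_overlap_l.
transitivity (\sum_(b | clf b == clf a) ((mu_size R clf a)^-1 * mu_wt f a -
   \sum_c \sum_(d | cle d == cle c) (mu_size R clf a)^-1 *
      (nsq (\tr ((e c d)^t* *m f a b)) / mu_wt e c))).
  apply: eq_bigr => b /eqP ba; rewrite -(frob_mu muf (esym ba)).
  rewrite (cexp_frob mue (f a b)) (frob_cexp mue) mulrDr.
  apply/esym/eqP; rewrite subr_eq addrC [eqbRHS]addrC; apply/eqP; congr (_ + _).
  by rewrite mulr_sumr; apply: eq_bigr => c _; rewrite mulr_sumr.
rewrite sumrB sumr_const; congr (_ - _).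
  by rewrite -[LHS]mulr_natl mulrA divff ?mul1r // gt_eqF ?mu_size_gt0.
rewrite exchange_big; apply: eq_bigr => c _ /=.
rewrite exchange_big /overlap2 mulr_suml; apply: eq_bigr => d _ /=.
rewrite mulr_suml; apply: eq_bigr => b _.
by rewrite invfM; ring.
Qed.

End Overlap.

(** * Monotonicity of block ratios *)

Section Monotone.
Variables (R : realType) (m : nat).
Local Notation C := R[i].
Variables (A B : {vspace 'M[C]_m}).
Variables (r : nat) (cle : 'I_r -> 'I_r) (e : 'I_r -> 'I_r -> 'M[C]_m).
Variables (s : nat) (clf : 'I_s -> 'I_s) (f : 'I_s -> 'I_s -> 'M[C]_m).
Hypothesis mue : matrix_units A cle e.
Hypothesis muf : matrix_units B clf f.

Let xe := mu_ratio cle e.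
Let xf := mu_ratio clf f.

(** [overlap2_le] applies with either algebra in the first role; the two bounds give the two entries
    of the minimum. *)
Lemma overlap2_le2 c a : overlap2 cle clf e f c a / (mu_size R clf a * mu_wt e c)
  <= overlap e f c a * Num.min 1 (xe c / xf a).
Proof.
have [se sf] := (mu_size_gt0 R cle c, mu_size_gt0 R clf a).
have [we wf] := (mu_wt_gt0 mue c, mu_wt_gt0 muf a).
rewrite ler_pdivrMr ?mulr_gt0 // minEle; case: ifP => _.
  rewrite overlap2C overlapC; apply: le_trans (overlap2_le muf mue a c) _.
  by rewrite le_eqVlt; apply/orP; left; apply/eqP; ring.
apply: le_trans (overlap2_le mue muf c a) _.
rewrite le_eqVlt /xe /xf /mu_ratio; apply/orP; left; apply/eqP; field.
by rewrite !gt_eqF.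
Qed.

(* Blocks of an almost-subalgebra sit under blocks of larger or equal ratio size / weight. *)
Lemma mu_monotone : \sum_a \sum_c overlap e f c a * Num.max 0 (1 - xe c / xf a)
  <= mu_avg clf f (fun X => X - cexp e X).
Proof.
rewrite (mu_avg_overlap mue muf); apply: ler_sum => a _; apply: ler_sum => c _.
apply: le_trans (_ : _ <= overlap e f c a - overlap e f c a * Num.min 1 (xe c / xf a)) _.
  rewrite -{2}[overlap e f c a]mulr1 -mulrBr ler_wpM2l ?(overlap_ge0 mue muf) //.
  by rewrite ge_max subr_ge0 ge_min lexx /= lerD2l lerN2 ge_min lexx orbT.
by rewrite lerD2l lerN2 overlap2_le2.
Qed.

(** Both averages involve the same [overlap2], and their normalizations differ by the factor
    [x = xf a / xe c]. If [x <= 1], passing from [t] to [t * x] loses [t * (1 - x)], at most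
    [rho * (1 - x)]; if [x > 1], nothing is lost. *)
Lemma mu_reverse : mu_avg cle e (fun X => X - cexp f X) <=
  mu_avg clf f (fun X => X - cexp e X)
  + \sum_a \sum_c overlap e f c a * Num.max 0 (1 - xf a / xe c).
Proof.
rewrite (mu_avg_overlap muf mue) (mu_avg_overlap mue muf) exchange_big.
rewrite -big_split ler_sum //= => a _; rewrite -big_split ler_sum //= => c _.
have [se sf] := (mu_size_gt0 R cle c, mu_size_gt0 R clf a).
have [we wf] := (mu_wt_gt0 mue c, mu_wt_gt0 muf a).
rewrite (overlapC f) (overlap2C clf); set rho := overlap _ _ _ _.
have rho0 : 0 <= rho by exact: overlap_ge0 mue muf _ _.
have := overlap2_le2 c a; rewrite -/rho; set N := overlap2 _ _ _ _ _ _.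
set t := N / _ => ht.
have -> : N / (mu_size R cle c * mu_wt f a) = t * (xf a / xe c).
  by rewrite /t /xf /xe /mu_ratio; field; rewrite !gt_eqF.
have N0 : 0 <= t.
  apply: divr_ge0; last by rewrite ltW ?mulr_gt0.
  by apply: sumr_ge0 => d _; apply: sumr_ge0 => b _; exact: nsq_ge0.
have trho : t <= rho by apply: le_trans ht _; rewrite ler_piMr // ge_min lexx.
set x := xf a / xe c.
have x0 : 0 <= x by rewrite ltW // divr_gt0 ?(mu_ratio_gt0 mue) ?(mu_ratio_gt0 muf).
have [x1|x1] := leP x 1.
  have -> : Num.max 0 (1 - x) = 1 - x by apply/max_idPr; rewrite subr_ge0.
  rewrite -subr_ge0.
  have -> : rho - t + rho * (1 - x) - (rho - t * x) = (rho - t) * (1 - x) by ring.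
  by rewrite mulr_ge0 ?subr_ge0.
have -> : Num.max 0 (1 - x) = 0 by apply/max_idPl; rewrite subr_le0 ltW.
by rewrite mulr0 addr0 lerD2l lerN2 ler_peMr // ltW.
Qed.

End Monotone.

(** * Contractivity of the expectation and of left multiplication *)

Section Contraction.
Variables (R : realType) (m : nat) (A : {vspace 'M[R[i]]_m}).
Variables (r : nat) (cl : 'I_r -> 'I_r) (e : 'I_r -> 'I_r -> 'M[R[i]]_m).
Hypothesis uA : unital_star_algebra A.
Hypothesis mu : matrix_units A cl e.
Local Notation C := R[i].

(** For the largest eigenvalue [l], the form bound is the positivity of [l - h], seen through its
    square root, and [f] is the indicator of [l]. *)
Lemma spectral_max (h : 'M[C]_m) : (0 < m)%N -> h^t* = h ->
  exists l, (exists f, fc f h != 0 /\ h *m fc f h = l%:C%C *: fc f h) /\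
    forall n (Z : 'M[C]_(m, n)), rtr (Z^t* *m h *m Z) <= l * frob Z.
Proof.
case: m h => // m' h _ hh.
have [i _ imax] := @arg_maxP _ _ _ (ord0 : 'I_m'.+1) xpredT (ev h) isT.
exists (ev h i); split.
  exists (fun x => (x == ev h i)%:R); split.
    by apply/eqP => /(@fc_eq0 _ _ _ _ i) /eqP; rewrite eqxx oner_eq0.
  rewrite -{1}(fc_id hh) fcM (fc_ext (g := fun x => ev h i * (x == ev h i)%:R)).
    by rewrite -(fcM (fun=> ev h i)) fcC mul_scalar_mx.
  by move=> j /=; case: eqP => [->|]; rewrite ?mulr0.
move=> n Z; set g := fc (fun x => Num.sqrt (ev h i - x)) h.
have gg : g *m g = (ev h i)%:C%C%:M - h.
  rewrite fcM (fc_ext (g := fun x => ev h i + -1 * x)) => [|j]; last first.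
    by rewrite -expr2 sqr_sqrtr ?mulN1r // subr_ge0; exact: imax.
  rewrite -fcD -(fcM (fun=> -1) id) !fcC fc_id // mul_scalar_mx.
  by rewrite rmorphN /= scaleNr rmorph1 scale1r.
have : 0 <= frob (g *m Z) by exact: frob_ge0.
rewrite frobE ctrmxM fc_ctr mulmxA -(mulmxA _ g g) gg mulmxBr mulmxBl rtrB.
by rewrite mul_mx_scalar -scalemxAl rtrZ -frobE subr_ge0.
Qed.

Lemma frob_cexp_le X : frob (cexp e X) <= frob X.
Proof. by rewrite (cexp_frob mu X) lerDr frob_ge0. Qed.

(* On the top spectral projection [y] of [b^* b], [b y] is the expectation of [X y]. *)
Lemma opnorm_cexp (X : 'M[C]_m) M : (0 < m)%N -> opnorm X <= M -> opnorm (cexp e X) <= M.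
Proof.
move=> m0 XM; have M0 := le_trans (opnorm_ge0 X) XM; set b := cexp e X.
have bA : b \in A by exact: cexp_mem mu _.
have hA : b^t* *m b \in A by rewrite usalg_mul ?usalg_ctr.
have hh : (b^t* *m b)^t* = b^t* *m b by rewrite ctrmxM ctrmxK.
have [l [[f [y0 hy]] hl]] := spectral_max m0 hh.
have yA : fc f (b^t* *m b) \in A by exact: fc_mem.
set y := fc f _ in y0 hy yA.
have lM : l <= M ^+ 2.
  rewrite -(ler_pM2r (frob_gt0 y0)); apply: le_trans (opnorm_frob XM y).
  apply: le_trans (frob_cexp_le _); rewrite (cexp_modr uA mu) // -/b.
  by rewrite (frobE (b *m y)) ctrmxM -mulmxA (mulmxA (b^t*)) hy -scalemxAr rtrZ -frobE.
apply: opnorm_le_frob => // v.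
apply: le_trans (_ : _ <= l * frob v) _; last by rewrite ler_wpM2r ?frob_ge0.
by apply: le_trans (hl _ v); rewrite frobE ctrmxM -!mulmxA.
Qed.

Lemma cexpZ (k : C) X : cexp e (k *: X) = k *: cexp e X.
Proof.
rewrite /cexp scaler_sumr; apply: eq_bigr => a _; rewrite scaler_sumr.
apply: eq_bigr => b _; rewrite scalerA; congr (_ *: _).
by rewrite /mu_coef -scalemxAr mxtraceZ mulrCA.
Qed.

Lemma frob_mu_col b (z : 'I_r -> C) :
  frob (\sum_(a | cl a == cl b) z a *: e a b) = mu_wt e b * \sum_(a | cl a == cl b) nsq (z a).
Proof.
rewrite frob_sum_orth => [|a c /eqP ab /eqP cb ac].
  rewrite mulr_sumr; apply: eq_bigr => a /eqP ab.
  by rewrite frobZ (frob_mu mu ab) (mu_wt_cl mu ab) mulrC.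
rewrite /ip /rtr ctrmxZ -scalemxAl -scalemxAr !mxtraceZ (mxtrace_mu2 mu) //.
by rewrite (negPf ac) !mulr0.
Qed.

(** A contraction of [A] acts contractively on each column of matrix units, hence its coefficients
    act contractively on scalar columns. *)
Lemma contraction_col (k : 'I_r -> 'I_r -> C) b (y : 'I_r -> C) :
  opnorm (\sum_a \sum_c k a c *: e a c) <= 1 ->
  \sum_(a | cl a == cl b) nsq (\sum_(c | cl c == cl b) k c a * y c)
    <= \sum_(c | cl c == cl b) nsq (y c).
Proof.
set v := \sum_a _ => v1.
(* The conjugates turn the action of [v^t*] into the transpose of [k] that the goal contains. *)
pose X := \sum_(c | cl c == cl b) (y c)^* *: e c b.
have ve c : cl c = cl b -> v^t* *m e c b = \sum_(a | cl a == cl b) (k c a)^* *: e a b.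
  move=> cb; rewrite -[e c b](mu_ctr mu) -ctrmxM.
  have -> : e b c *m v = \sum_(a | cl a == cl b) k c a *: e b a.
    rewrite mulmx_sumr (bigD1 c) //= [X in _ + X]big1 => [|d dc]; last first.
      rewrite mulmx_sumr big1 // => a _; rewrite -scalemxAr (mu_mul mu) //.
      by rewrite eq_sym (negPf dc) scaler0.
    rewrite addr0 mulmx_sumr [RHS]big_mkcond; apply: eq_bigr => a _.
    rewrite -scalemxAr (mu_mul mu) // eqxx; case: eqP => // ab.
    by rewrite (mu_off mu) ?scaler0 //; apply/eqP => ba; apply: ab.
  rewrite ctrmx_sum; apply: eq_bigr => a _; by rewrite ctrmxZ (mu_ctr mu).
have vX : v^t* *m X = \sum_(a | cl a == cl b)
    (\sum_(c | cl c == cl b) k c a * y c)^* *: e a b.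
  rewrite mulmx_sumr.
  transitivity (\sum_(c | cl c == cl b) \sum_(a | cl a == cl b) ((k c a * y c)^* *: e a b)).
    apply: eq_bigr => c /eqP cb; rewrite -scalemxAr ve // scaler_sumr.
    by apply: eq_bigr => a _; rewrite scalerA rmorphM mulrC.
  by rewrite exchange_big; apply: eq_bigr => a _; rewrite rmorph_sum scaler_suml.
have := frobMl_le X (opnorm_boundC ltr01 v1); rewrite vX !frob_mu_col.
rewrite ler_pM2l ?(mu_wt_gt0 mu) //.
by under eq_bigr do rewrite nsqC; under [X in _ <= X]eq_bigr do rewrite nsqC.
Qed.

(** For unitary [v] this would be invariance of the average. A contraction mixes the matrices
    [L (e c b)] of one column, and [contraction_col] handles this entry by entry. *)
Lemma mu_avg_mull p q (L : 'M[C]_m -> 'M[C]_(p, q)) v :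
  {morph L : x y / x + y} -> (forall k x, L (k *: x) = k *: L x) ->
  v \in A -> opnorm v <= 1 ->
  mu_avg cl e (fun X => L (v *m X)) <= mu_avg cl e L.
Proof.
move=> LD LZ vA; have [k ->] := mu_span mu vA => v1.
have L0 : L 0 = 0 by rewrite -(scale0r 0) LZ scale0r.
have ve a b : cl a = cl b -> L ((\sum_a \sum_c k a c *: e a c) *m e a b) =
    \sum_(c | cl c == cl b) k c a *: L (e c b).
  move=> ab; rewrite mulmx_suml (big_morph L LD L0) [RHS]big_mkcond.
  apply: eq_bigr => c _; rewrite mulmx_suml (bigD1 a) //= [X in _ + X]big1 => [|d da].
    rewrite addr0 -scalemxAl; case: eqP => cb.
      by rewrite (mu_mul mu) ?ab // eqxx LZ.
    rewrite (mu_off mu (b := a)) ?mul0mx ?scaler0 ?L0 //.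
    by apply/eqP => ca; apply: cb; rewrite ca.
  have [cd|/(mu_off mu)->] := eqVneq (cl c) (cl d); last by rewrite scaler0 mul0mx.
  by rewrite -scalemxAl (mu_mul mu) // (negPf da) scaler0.
rewrite /mu_avg.
have swap (F : 'I_r -> 'I_r -> R) :
    \sum_a \sum_(b | cl b == cl a) (mu_size R cl a)^-1 * F a b =
    \sum_b (mu_size R cl b)^-1 * \sum_(a | cl a == cl b) F a b.
  rewrite (exchange_big_dep predT) //=; apply: eq_bigr => b _; rewrite mulr_sumr.
  by apply: eq_big => a; [exact: eq_sym|move=> /eqP ab; rewrite (mu_size_cl R ab)].
rewrite !swap; apply: ler_sum => b _; rewrite ler_pM2l ?invr_gt0 ?mu_size_gt0 //.
rewrite (eq_bigr (fun a => \sum_i \sum_j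
    nsq (\sum_(c | cl c == cl b) k c a * L (e c b) i j))) => [|a /eqP ab]; last first.
  rewrite ve //; apply: eq_bigr => i _; apply: eq_bigr => j _.
  by rewrite summxE; congr nsq; apply: eq_bigr => c _; rewrite mxE.
rewrite /frob exchange_big [leRHS]exchange_big; apply: ler_sum => i _ /=.
rewrite exchange_big [leRHS]exchange_big; apply: ler_sum => j _ /=.
exact: contraction_col v1.
Qed.

End Contraction.

Lemma frob_row_mx (R : realType) m n p (X : 'M[R[i]]_(m, n)) (Y : 'M[R[i]]_(m, p)) :
  frob (row_mx X Y) = frob X + frob Y.
Proof.
rewrite /frob -big_split; apply: eq_bigr => i _ /=; rewrite big_split_ord.
by congr (_ + _); apply: eq_bigr => j _; rewrite (row_mxEl, row_mxEr).
Qed.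

(** * From average closeness to closeness of every contraction *)

Section Closeness.
Variables (R : realType) (m : nat).
Local Notation C := R[i].
Variables (A B : {vspace 'M[C]_m}).
Variables (r : nat) (cle : 'I_r -> 'I_r) (e : 'I_r -> 'I_r -> 'M[C]_m).
Variables (s : nat) (clf : 'I_s -> 'I_s) (f : 'I_s -> 'I_s -> 'M[C]_m).
Hypothesis uB : unital_star_algebra B.
Hypothesis mue : matrix_units A cle e.
Hypothesis muf : matrix_units B clf f.

(* For a unitary [w] of [A], [v = (v w) w^*], and both factors are close to [B] on average. *)
Lemma mu_close v : (0 < m)%N -> v \in A -> opnorm v <= 1 ->
  frob (v - cexp f v) <= 4 * mu_avg cle e (fun X => X - cexp f X).
Proof.
move=> m0 vA v1; pose L0 X : 'M[C]_m := X - cexp f X.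
have L0D : {morph L0 : x y / x + y}.
  by move=> x y; rewrite /L0 cexpD opprD addrACA.
have L0Z k x : L0 (k *: x) = k *: L0 x by rewrite /L0 cexpZ scalerBr.
have L0N : {morph L0 : x / - x} by move=> x; rewrite -scaleN1r L0Z scaleN1r.
(* One row holds both maps, so that a single unitary is good for [w] and for [v *m w]. *)
pose L X := row_mx (L0 X) (L0 (v *m X)).
have [||w [wA ww]] := @mu_average _ _ _ _ _ _ mue _ _ L _ _ (-1).
- by move=> x y; rewrite /L mulmxDr !L0D add_row_mx.
- by move=> x; rewrite /L mulmxN !L0N opp_row_mx.
rewrite !mulN1r lerN2 {1}/L frob_row_mx => hw.
have hL : mu_avg cle e L <= 2 * mu_avg cle e L0.
  have -> : mu_avg cle e L = mu_avg cle e L0 + mu_avg cle e (fun X => L0 (v *m X)).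
    rewrite /mu_avg -big_split; apply: eq_bigr => a _; rewrite -big_split.
    by apply: eq_bigr => b _; rewrite /L frob_row_mx mulrDr.
  by rewrite mulrDl !mul1r lerD2l (mu_avg_mull mue).
have vw1 : opnorm (v *m w) <= 1.
  by have := opnorm_boundM v1 (opnorm_unitary ww); rewrite mulr1.
have bB : cexp f (v *m w) *m (cexp f w)^t* \in B.
  by rewrite usalg_mul ?usalg_ctr ?(cexp_mem muf).
apply: le_trans (cexp_dist muf v bB) _.
have -> : v - cexp f (v *m w) *m (cexp f w)^t* =
    L0 (v *m w) *m w^t* + cexp f (v *m w) *m (L0 w)^t*.
  rewrite /L0 mulmxBl -mulmxA (unitary_swap ww) mulmx1 ctrmxB mulmxBr.
  by rewrite addrA subrK.
apply: le_trans (frobD _ _) _.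
(* One factor 2 comes from [frobD], the other from the two averages in [hL]. *)
have -> : 4 = 2 * 2 :> R by rewrite -natrM.
rewrite -mulrA -mulrDr ler_pM2l //; apply: le_trans hL; apply: le_trans hw.
rewrite addrC lerD //.
  apply: le_trans (frobMl_le _ _) _; last by rewrite frobC.
  exact: (opnorm_cexp uB muf).
by rewrite frob_unitaryr // ctrmxK.
Qed.

End Closeness.

(** * Positive operator valued measures and couplings *)

Record pvm (R : realType) m (I : finType) (p : I -> 'M[R[i]]_m) : Prop := Pvm {
  pvm_ctr : forall i, (p i)^t* = p i;
  pvm_mul : forall i j, p i *m p j = if i == j then p i else 0;
  pvm_sum : \sum_i p i = 1%:M
}.

Section Povm.
Variables (R : realType) (m : nat).
Local Notation C := R[i].

Lemma rtr_pos_mul (X Y : 'M[C]_m) : rtr (X^t* *m X *m (Y^t* *m Y)) = frob (X *m Y^t*).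
Proof. by rewrite frobE ctrmxM ctrmxK mulmxA rtrC !mulmxA. Qed.

Lemma rtrMZr (r : R) (X Y : 'M[C]_m) : rtr (X *m (r%:C%C *: Y)) = r * rtr (X *m Y).
Proof. by rewrite -scalemxAr rtrZ. Qed.

Lemma rtrMZl (r : R) (X Y : 'M[C]_m) : rtr ((r%:C%C *: X) *m Y) = r * rtr (X *m Y).
Proof. by rewrite -scalemxAl rtrZ. Qed.

Definition wsum (I : finType) (w : I -> R) (E : I -> 'M[C]_m) : 'M[C]_m :=
  \sum_a (w a)%:C%C *: E a.

Lemma wsum_ctr (I : finType) (w : I -> R) (E : I -> 'M[C]_m) :
  (forall a, (E a)^t* = E a) -> (wsum w E)^t* = wsum w E.
Proof.
by move=> hE; rewrite ctrmx_sum; apply: eq_bigr => a _; rewrite ctrmxZ conj_real hE.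
Qed.

Variables (I J : finType) (X : I -> 'M[C]_m) (Y : J -> 'M[C]_m).
Let E a := (X a)^t* *m X a.
Let F b := (Y b)^t* *m Y b.
Hypothesis E1 : \sum_a E a = 1%:M.
Hypothesis F1 : \sum_b F b = 1%:M.

Lemma povm_marginal_l (g : I -> R) :
  \sum_a \sum_b rtr (E a *m F b) * g a = \sum_a rtr (E a) * g a.
Proof.
apply: eq_bigr => a _; rewrite -mulr_suml; congr (_ * _).
by rewrite -rtr_sum -mulmx_sumr F1 mulmx1.
Qed.

Lemma povm_marginal_r (g : J -> R) :
  \sum_a \sum_b rtr (E a *m F b) * g b = \sum_b rtr (F b) * g b.
Proof.
rewrite exchange_big; apply: eq_bigr => b _ /=; rewrite -mulr_suml; congr (_ * _).
by rewrite -rtr_sum -mulmx_suml E1 mul1mx.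
Qed.

Lemma ctrE a : (E a)^t* = E a.
Proof. by rewrite /E ctrmxM ctrmxK. Qed.

Lemma povm_ip (w : I -> R) (v : J -> R) :
  ip (wsum w E) (wsum v F) = \sum_a \sum_b rtr (E a *m F b) * (w a * v b).
Proof.
rewrite /ip wsum_ctr; last exact: ctrE.
rewrite mulmx_suml rtr_sum; apply: eq_bigr => a _.
rewrite mulmx_sumr rtr_sum; apply: eq_bigr => b _.
by rewrite rtrMZl rtrMZr; ring.
Qed.

(** The numbers [rtr (E a *m F b)] are nonnegative with marginals [rtr (E a)] and [rtr (F b)]: they
    form a coupling even though the operators need not commute. *)
Lemma povm_pair (w : I -> R) (v : J -> R) :
  \sum_a \sum_b rtr (E a *m F b) * (w a - v b) ^+ 2 =
  \sum_a rtr (E a) * w a ^+ 2 + \sum_b rtr (F b) * v b ^+ 2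
    - 2 * ip (wsum w E) (wsum v F).
Proof.
rewrite -(povm_marginal_l (fun a => w a ^+ 2)) -(povm_marginal_r (fun b => v b ^+ 2)).
rewrite povm_ip mulr_sumr -big_split -sumrB; apply: eq_bigr => a _ /=.
rewrite mulr_sumr -big_split -sumrB; apply: eq_bigr => b _ /=.
by ring.
Qed.

(** The difference of the two sides is an operator variance, the sum of the squared norms of
    [X a *m (w a - S)]. *)
Lemma povm_var (w : I -> R) : frob (wsum w E) <= \sum_a rtr (E a) * w a ^+ 2.
Proof.
set S := wsum w E.
have SS : S^t* = S by rewrite wsum_ctr //; exact: ctrE.
suff : 0 <= \sum_a rtr (E a) * w a ^+ 2 - 2 * frob S + frob S by rewrite -addrA; lra.
have -> : \sum_a rtr (E a) * w a ^+ 2 - 2 * frob S + frob S =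
    \sum_a frob (X a *m ((w a)%:C%C *: 1%:M - S)); last first.
  by apply: sumr_ge0 => a _; exact: frob_ge0.
have e1 : frob S = \sum_a w a * rtr (E a *m S).
  rewrite frobE SS {1}/S mulmx_suml rtr_sum; apply: eq_bigr => a _.
  by rewrite rtrMZl.
have e2 : frob S = \sum_a rtr (S *m E a *m S).
  by rewrite -rtr_sum -mulmx_suml -mulmx_sumr E1 mulmx1 frobE SS.
rewrite {1}e1 e2 mulr_sumr -sumrB -big_split; apply: eq_bigr => a _ /=.
rewrite frobE ctrmxM ctrmxB ctrmxZ conj_real ctrmx1 SS; set T := _ - S.
have -> : T *m (X a)^t* *m (X a *m T) = T *m E a *m T by rewrite /E !mulmxA.
rewrite /T.
move: (E a) => P.
rewrite !mulmxBl !mulmxBr -!scalemxAl !mul1mx -!scalemxAr !mulmx1 !rtrB !rtrZ.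
by rewrite (rtrC S) expr2; ring.
Qed.

End Povm.

(** Expanding the coupled square leaves the two second moments, which [povm_var] compares with
    squared norms. *)
Lemma povm_dist (R : realType) m (I J : finType)
    (X : I -> 'M[R[i]]_m) (Y : J -> 'M[R[i]]_m) (w : I -> R) (v : J -> R) :
  \sum_a (X a)^t* *m X a = 1%:M -> \sum_b (Y b)^t* *m Y b = 1%:M ->
  frob (wsum w (fun a => (X a)^t* *m X a) - wsum v (fun b => (Y b)^t* *m Y b)) <=
  \sum_a \sum_b rtr ((X a)^t* *m X a *m ((Y b)^t* *m Y b)) * (w a - v b) ^+ 2.
Proof.
move=> E1 F1; rewrite povm_pair // frob_sub.
have := povm_var E1 w; have := povm_var F1 v.
move: (frob _) (frob _) => s t; move: (ip _ _) => k; lra.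
Qed.

(** * A bounded comparison of ratios *)

Section RatioDefect.
Variable R : realType.
Implicit Types x y : R.

(** With [x / y = exp s] this is [tanh (s / 2)]: scale invariant, increasing in [x], zero exactly at
    [x = y], and bounded however large the ratios are. *)
Definition psi x y : R := (x - y) / (x + y).

Lemma psi_le1 x y : 0 < x -> 0 < y -> psi x y <= 1.
Proof. by move=> x0 y0; rewrite /psi ler_pdivrMr ?addr_gt0 // mul1r; lra. Qed.

Lemma psi_geN1 x y : 0 < x -> 0 < y -> -1 <= psi x y.
Proof. by move=> x0 y0; rewrite /psi ler_pdivlMr ?addr_gt0 //; lra. Qed.

Lemma psiB x x' y : 0 < x -> 0 < x' -> 0 < y ->
  psi x' y - psi x y = 2 * y * (x' - x) / ((x' + y) * (x + y)).
Proof. by move=> x0 x'0 y0; rewrite /psi; field; rewrite !gt_eqF ?addr_gt0. Qed.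

Lemma psiB_le x x' y : 0 < x -> 0 < x' -> 0 < y -> x <= x' ->
  psi x' y - psi x y <= 2 * (1 - x / x').
Proof.
move=> x0 x'0 y0 xx'; rewrite psiB // ler_pdivrMr ?mulr_gt0 ?addr_gt0 //.
have -> : 1 - x / x' = (x' - x) / x' by field; rewrite gt_eqF.
have -> : 2 * ((x' - x) / x') * ((x' + y) * (x + y)) =
   2 * y * (x' - x) + 2 * (x' - x) * ((x' * x + y * x + y ^+ 2) / x').
  by field; rewrite gt_eqF.
have P : 0 <= (x' * x + y * x + y ^+ 2) / x'.
  by rewrite divr_ge0 ?addr_ge0 ?mulr_ge0 ?sqr_ge0 ?ltW.
by rewrite lerDl mulr_ge0 // mulr_ge0 ?subr_ge0.
Qed.

(** [b] marks mismatched labels, where a constant suffices. Otherwise, if [x' <= x], the difference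
    lies between 0 and 2 and its square is at most twice itself; if [x < x'], the difference is
    negative and [1 - x / x'] pays for it. The signed linear term is kept because it cancels in the
    mean. *)
Lemma psi_sqr_le (b : bool) x x' y y' : 0 < x -> 0 < x' -> 0 < y -> 0 < y' ->
  (~~ b -> y = y') ->
  (psi x y - psi x' y') ^+ 2 <=
    8 * b%:R + (2 * (psi x y - psi x' y') + 8 * Num.max 0 (1 - x / x')).
Proof.
move=> x0 x'0 y0 y'0 hb.
have m0 : 0 <= Num.max 0 (1 - x / x') by rewrite le_max lexx.
have [p1 p2] := (psi_le1 x0 y0, psi_geN1 x0 y0).
have [q1 q2] := (psi_le1 x'0 y'0, psi_geN1 x'0 y'0).
case: b hb => [_|/(_ isT) yy].
  rewrite mulr1; move: (psi x y) (psi x' y') p1 p2 q1 q2 => s t p1 p2 q1 q2.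
  have : 0 <= (s - t + 2) * (4 - (s - t)) by rewrite mulr_ge0 //; lra.
  by nra.
rewrite -{}yy in q1 q2 *; rewrite mulr0 add0r.
have [xx|xx] := leP x' x.
  have h : psi x' y <= psi x y.
    by rewrite -subr_ge0 psiB // divr_ge0 // !mulr_ge0 ?subr_ge0 ?addr_ge0 // ?ltW.
  have : 0 <= (psi x y - psi x' y) * (2 - (psi x y - psi x' y)).
    by rewrite mulr_ge0 ?subr_ge0 //; lra.
  by nra.
have h := psiB_le x0 x'0 y0 (ltW xx).
have h2 : 2 * (1 - x / x') <= 2 * Num.max 0 (1 - x / x').
  by rewrite ler_pM2l // le_max lexx orbT.
have h3 : 0 <= psi x' y - psi x y.
  by rewrite psiB // divr_ge0 // !mulr_ge0 ?subr_ge0 ?addr_ge0 // ?ltW.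
have : 0 <= (psi x' y - psi x y) * (2 - (psi x' y - psi x y)).
  by rewrite mulr_ge0 //; lra.
by nra.
Qed.

(* Both sides are compared through [max (1 - y / x) 0 + max (1 - x' / y) 0]. *)
Lemma ratio_defect_le (b : bool) x x' y y' : 0 < x -> 0 < x' -> 0 < y -> 0 < y' ->
  (~~ b -> y = y') ->
  Num.max 0 (1 - x' / x) <= b%:R + (2 * `|psi x y| + 2 * `|psi x' y'|).
Proof.
move=> x0 x'0 y0 y'0 hb; set M := Num.max _ _.
have n0 : 0 <= 2 * `|psi x y| + 2 * `|psi x' y'| by rewrite addr_ge0 ?mulr_ge0.
have M1 : M <= 1 by rewrite /M ge_max ler01 lerBlDr lerDl divr_ge0 ?ltW.
case: b hb => [_|/(_ isT) yy]; first by rewrite -[leLHS]addr0 lerD.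
rewrite -{}yy in n0 *; rewrite add0r /M ge_max n0 /=.
have hx : 1 - y / x <= 2 * `|psi x y|.
  have [xy|xy] := leP x y.
    apply: le_trans (_ : _ <= 0) _; last by rewrite mulr_ge0.
    by rewrite subr_le0 ler_pdivlMr // mul1r.
  rewrite ger0_norm; last by rewrite /psi divr_ge0 ?subr_ge0 ?addr_ge0 // ?ltW.
  rewrite -subr_ge0 /psi.
  have -> : 2 * ((x - y) / (x + y)) - (1 - y / x) = (x - y) ^+ 2 / (x * (x + y)).
    by field; rewrite !gt_eqF ?addr_gt0.
  by rewrite divr_ge0 ?sqr_ge0 ?mulr_ge0 ?addr_ge0 ?ltW.
have hx' : 1 - x' / y <= 2 * `|psi x' y|.
  have [xy|xy] := leP y x'.
    apply: le_trans (_ : _ <= 0) _; last by rewrite mulr_ge0.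
    by rewrite subr_le0 ler_pdivlMr // mul1r.
  rewrite ler0_norm; last first.
    by rewrite /psi mulr_le0_ge0 ?invr_ge0 ?subr_le0 ?addr_ge0 ?ltW.
  rewrite -subr_ge0 /psi.
  have -> : 2 * - ((x' - y) / (x' + y)) - (1 - x' / y) = (y - x') ^+ 2 / (y * (x' + y)).
    by field; rewrite !gt_eqF ?addr_gt0.
  by rewrite divr_ge0 ?sqr_ge0 ?mulr_ge0 ?addr_ge0 ?ltW.
have px : 0 <= `|psi x y| by []. have px' : 0 <= `|psi x' y| by [].
have [h|h] := leP y x'.
  apply: le_trans (_ : _ <= 1 - y / x) _; last by lra.
  by rewrite lerD2l lerN2 ler_pM2r ?invr_gt0.
have [h'|h'] := leP x y.
  apply: le_trans (_ : _ <= 1 - x' / y) _; last by lra.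
  by rewrite lerD2l lerN2 ler_pM2l // lef_pV2.
apply: le_trans (_ : _ <= (1 - y / x) + (1 - x' / y)) _; last by lra.
rewrite -subr_ge0.
have -> : 1 - y / x + (1 - x' / y) - (1 - x' / x) = (x - y) * (y - x') / (x * y).
  by field; rewrite !gt_eqF.
by rewrite divr_ge0 ?mulr_ge0 ?subr_ge0 ?ltW.
Qed.

End RatioDefect.

(** * Pinchings and compressed projections *)

Section Pinching.
Variables (R : realType) (m : nat).
Local Notation C := R[i].

Definition pinch (I : finType) (p : I -> 'M[C]_m) (X : 'M[C]_m) : 'M[C]_m :=
  \sum_i p i *m X *m p i.

Lemma pinch_ip (I : finType) (p : I -> 'M[C]_m) X :
  pvm p -> ip X (pinch p X) = frob (pinch p X).
Proof.
move=> hp; rewrite -ipAA [in RHS]/pinch ip_suml {1}/pinch ip_sumr.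
apply: eq_bigr => i _; rewrite -/(pinch p X) /ip.
have E : p i *m X *m p i = p i *m pinch p X *m p i.
  rewrite /pinch mulmx_sumr mulmx_suml (bigD1 i) //= [X in _ + X]big1 => [|j ji].
    by rewrite addr0 !mulmxA (pvm_mul hp) eqxx -!mulmxA (pvm_mul hp) eqxx.
  by rewrite !mulmxA (pvm_mul hp) eq_sym (negPf ji) !mul0mx.
by rewrite [in LHS]E !ctrmxM (pvm_ctr hp) -!mulmxA [RHS]rtrC !mulmxA.
Qed.

Lemma pinch_frob (I : finType) (p : I -> 'M[C]_m) X :
  pvm p -> frob (X - pinch p X) = frob X - frob (pinch p X).
Proof. by move=> hp; rewrite frob_sub pinch_ip //; ring. Qed.

Lemma pvm_diag (I : finType) (p : I -> 'M[C]_m) i : pvm p -> p i *m p i = p i.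
Proof. by move=> hp; rewrite (pvm_mul hp) eqxx. Qed.

Lemma pvm_frob_sum (I : finType) (p : I -> 'M[C]_m) :
  pvm p -> \sum_i frob (p i) = m%:R.
Proof.
move=> hp; rewrite -(rtr1 R m) -(pvm_sum hp) rtr_sum; apply: eq_bigr => i _.
by rewrite frobE (pvm_ctr hp) pvm_diag.
Qed.

(** For projections this is [p i *m z j *m p i]; the square form exhibits a positive operator valued
    measure on pairs although [p] and [z] need not commute. *)
Definition compr (I J : finType) (p : I -> 'M[C]_m) (z : J -> 'M[C]_m) (a : I * J) :=
  (z a.2 *m p a.1)^t* *m (z a.2 *m p a.1).

Lemma comprE (I J : finType) (p : I -> 'M[C]_m) (z : J -> 'M[C]_m) i j :
  pvm p -> pvm z -> compr p z (i, j) = p i *m z j *m p i.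
Proof.
move=> hp hz; rewrite /compr ctrmxM (pvm_ctr hp) (pvm_ctr hz) /=.
by rewrite mulmxA -(mulmxA (p i) (z j) (z j)) (pvm_diag _ hz).
Qed.

Lemma compr_sum_r (I J : finType) (p : I -> 'M[C]_m) (z : J -> 'M[C]_m) i :
  pvm p -> pvm z -> \sum_j compr p z (i, j) = p i.
Proof.
move=> hp hz; under eq_bigr do rewrite comprE //.
by rewrite -mulmx_suml -mulmx_sumr (pvm_sum hz) mulmx1 pvm_diag.
Qed.

Lemma compr_sum_l (I J : finType) (p : I -> 'M[C]_m) (z : J -> 'M[C]_m) j :
  pvm p -> pvm z -> \sum_i compr p z (i, j) = pinch p (z j).
Proof. by move=> hp hz; under eq_bigr do rewrite comprE //. Qed.

Lemma compr_sum (I J : finType) (p : I -> 'M[C]_m) (z : J -> 'M[C]_m) :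
  pvm p -> pvm z -> \sum_a compr p z a = 1%:M.
Proof.
move=> hp hz; rewrite -(pair_bigA _ (fun i j => compr p z (i, j))) /=.
by under eq_bigr do rewrite compr_sum_r //; exact: pvm_sum hp.
Qed.

Lemma sum_indic (I : finType) (i : I) (F : I -> R) :
  \sum_j F j * (i == j)%:R = F i.
Proof.
rewrite (bigD1 i) //= eqxx mulr1 big1 ?addr0 // => j.
by rewrite eq_sym => /negPf->; rewrite mulr0.
Qed.

End Pinching.

(** * Coupling two configurations with equal traces *)

Section Coupling.
Variables (R : realType) (m : nat) (I J : finType).
Local Notation C := R[i].
Variables (p p' : I -> 'M[C]_m) (z z' : J -> 'M[C]_m).
Hypotheses (hp : pvm p) (hp' : pvm p') (hz : pvm z) (hz' : pvm z').
Variables (x : I -> R) (y : J -> R).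
Hypotheses (x0 : forall i, 0 < x i) (y0 : forall j, 0 < y j).

Let E := compr p z.
Let E' := compr p' z'.
Let pr (a b : I * J) : R := rtr (E a *m E' b).
Let ps (a : I * J) : R := psi (x a.1) (y a.2).

Let E1 : \sum_a E a = 1%:M. Proof. exact: compr_sum. Qed.
Let E'1 : \sum_a E' a = 1%:M. Proof. exact: compr_sum. Qed.
Let pr0 a b : 0 <= pr a b. Proof. by rewrite /pr rtr_pos_mul frob_ge0. Qed.

Let sum_pr : \sum_a \sum_b pr a b = m%:R.
Proof.
have := povm_marginal_l (fun a => z a.2 *m p a.1) E'1 (fun=> 1).
under eq_bigr do under eq_bigr do rewrite mulr1.
move=> ->; under eq_bigr do rewrite mulr1.
by rewrite -rtr_sum E1 rtr1.
Qed.

Let sum_pr_l (g : I -> I -> R) :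
  \sum_a \sum_b pr a b * g a.1 b.1 = \sum_i \sum_k rtr (p i *m p' k) * g i k.
Proof.
rewrite -(pair_bigA _ (fun i j => \sum_b pr (i, j) b * g i b.1)) /=.
apply: eq_bigr => i _; rewrite exchange_big /=.
rewrite -(pair_bigA _ (fun k l => \sum_j pr (i, j) (k, l) * g i k)) /=.
apply: eq_bigr => k _; under eq_bigr do rewrite -mulr_suml.
rewrite -mulr_suml; congr (_ * _).
under eq_bigr do rewrite -rtr_sum -mulmx_suml compr_sum_r //.
by rewrite -rtr_sum -mulmx_sumr compr_sum_r.
Qed.

Let sum_pr_eq2 : \sum_a \sum_b pr a b * (a.2 == b.2)%:R
  = \sum_j rtr (pinch p (z j) *m pinch p' (z' j)).
Proof.
rewrite -(pair_bigA _ (fun i j => \sum_b pr (i, j) b * (j == b.2)%:R)) /= exchange_big.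
apply: eq_bigr => j _ /=.
transitivity (\sum_i \sum_k pr (i, j) (k, j)).
  apply: eq_bigr => i _.
  rewrite -(pair_bigA _ (fun k l => pr (i, j) (k, l) * (j == l)%:R)) /=.
  by apply: eq_bigr => k _; rewrite sum_indic.
under eq_bigr do rewrite -rtr_sum -mulmx_sumr compr_sum_l //.
by rewrite -rtr_sum -mulmx_suml compr_sum_l.
Qed.

Let sum_pr_neq2 : \sum_a \sum_b pr a b * (a.2 != b.2)%:R
  = m%:R - \sum_j rtr (pinch p (z j) *m pinch p' (z' j)).
Proof.
rewrite -sum_pr -sum_pr_eq2 -sumrB; apply: eq_bigr => a _.
rewrite -sumrB; apply: eq_bigr => b _.
by case: (a.2 == b.2); rewrite /= ?mulr1 ?mulr0 ?subrr ?subr0.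
Qed.

Variable eps : R.
Hypothesis hzp : \sum_j frob (z j - pinch p (z j)) <= eps.
Hypothesis hzp' : \sum_j frob (z' j - pinch p' (z' j)) <= eps.
Hypothesis hzz' : \sum_j frob (z j - z' j) <= eps.

Lemma pinch_ctr (q : I -> 'M[C]_m) X : pvm q -> X^t* = X -> (pinch q X)^t* = pinch q X.
Proof.
move=> hq hX; rewrite ctrmx_sum; apply: eq_bigr => i _.
by rewrite !ctrmxM hX (pvm_ctr hq) mulmxA.
Qed.

(** The diagonal mass is a sum of traces of products, which polarization turns into norms and a
    distance; the errors add up to [(3 + 5 + 4) / 2 = 6]. *)
Lemma off_diagonal_le : \sum_a \sum_b pr a b * (a.2 != b.2)%:R <= 6 * eps.
Proof.
rewrite sum_pr_neq2.
have key j : 2 * rtr (pinch p (z j) *m pinch p' (z' j)) =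
    frob (pinch p (z j)) + frob (pinch p' (z' j)) - frob (pinch p (z j) - pinch p' (z' j)).
  by rewrite frob_sub /ip pinch_ctr ?(pvm_ctr hz) //; ring.
have tri j : frob (pinch p (z j) - pinch p' (z' j)) <= 2 * frob (z j - pinch p (z j)) +
    4 * frob (z j - z' j) + 4 * frob (z' j - pinch p' (z' j)).
  have -> : pinch p (z j) - pinch p' (z' j) = - (z j - pinch p (z j)) +
     ((z j - z' j) + (z' j - pinch p' (z' j))).
    by rewrite subrKA addrA opprB subrK.
  apply: le_trans (frobD _ _) _; rewrite frobN.
  have := frobD (z j - z' j) (z' j - pinch p' (z' j)); lra.
have : \sum_j (2 * rtr (pinch p (z j) *m pinch p' (z' j))) >=
    \sum_j (frob (z j) - 3 * frob (z j - pinch p (z j))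
     + frob (z' j) - 5 * frob (z' j - pinch p' (z' j)) - 4 * frob (z j - z' j)).
  apply: ler_sum => j _; rewrite key.
  have := pinch_frob (z j) hp; have := pinch_frob (z' j) hp'; have := tri j; lra.
rewrite !big_split /= !sumrN -!mulr_sumr (pvm_frob_sum hz) (pvm_frob_sum hz').
by move: hzp hzp' hzz'; lra.
Qed.

Hypothesis htr : forall a, rtr (E a) = rtr (E' a).

Let sum_pr_ps : \sum_a \sum_b pr a b * (ps a - ps b) = 0.
Proof.
transitivity (\sum_a \sum_b pr a b * ps a - \sum_a \sum_b pr a b * ps b).
  rewrite -sumrB; apply: eq_bigr => a _; rewrite -sumrB; apply: eq_bigr => b _.
  by rewrite mulrBr.
rewrite (povm_marginal_l (fun a => z a.2 *m p a.1) E'1).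
rewrite (povm_marginal_r (fun a => z' a.2 *m p' a.1) E1).
by apply/eqP; rewrite subr_eq0; apply/eqP; apply: eq_bigr => a _; rewrite htr.
Qed.

(** Equal traces give [ps] the same mean under both marginals, so the linear term of [psi_sqr_le]
    cancels and a one-sided defect controls a distance. The constant is [8 * 6 + 8]. *)
Lemma coupling_dist_le :
  \sum_i \sum_k rtr (p i *m p' k) * Num.max 0 (1 - x i / x k) <= eps ->
  frob (wsum ps E - wsum ps E') <= 56 * eps.
Proof.
rewrite -sum_pr_l => hK.
apply: le_trans (povm_dist ps ps E1 E'1) _.
apply: le_trans (_ : _ <= \sum_a \sum_b (8 * (pr a b * (a.2 != b.2)%:R) +
   (2 * (pr a b * (ps a - ps b)) + 8 * (pr a b * Num.max 0 (1 - x a.1 / x b.1))))) _.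
  apply: ler_sum => a _; apply: ler_sum => b _.
  have h := @psi_sqr_le _ (a.2 != b.2) (x a.1) (x b.1) (y a.2) (y b.2).
  have {}h := h (x0 _) (x0 _) (y0 _) (y0 _).
  have {h}/(ler_wpM2l (pr0 a b)) : (ps a - ps b) ^+ 2 <= 8 * (a.2 != b.2)%:R +
      (2 * (ps a - ps b) + 8 * Num.max 0 (1 - x a.1 / x b.1)).
    by apply: h => /negPn /eqP ->.
  by rewrite -/(pr a b); move: (pr a b) => q; lra.
have split3 (F G H : I * J -> I * J -> R) :
    \sum_a \sum_b (8 * F a b + (2 * G a b + 8 * H a b)) =
    8 * (\sum_a \sum_b F a b) + (2 * (\sum_a \sum_b G a b) + 8 * (\sum_a \sum_b H a b)).
  rewrite !mulr_sumr -!big_split; apply: eq_bigr => a _ /=.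
  by rewrite !mulr_sumr -!big_split.
rewrite split3 sum_pr_ps mulr0 add0r.
by have := off_diagonal_le; lra.
Qed.

(** The reverse defect is paid for by [|ps|] at both ends, and [eta] is the parameter in
    [|ps| <= eta / 2 + ps ^+ 2 / (2 * eta)]. *)
Lemma coupling_reverse (eta : R) : 0 < eta ->
  \sum_i \sum_k rtr (p i *m p' k) * Num.max 0 (1 - x k / x i) <=
    6 * eps + 2 * eta * m%:R + 2 * (\sum_a rtr (E a) * ps a ^+ 2) / eta.
Proof.
move=> eta0; rewrite -(sum_pr_l (fun i k => Num.max 0 (1 - x k / x i))).
apply: le_trans (_ : _ <= \sum_a \sum_b (pr a b * (a.2 != b.2)%:R) +
   (2 * (\sum_a \sum_b pr a b * `|ps a|) + 2 * (\sum_a \sum_b pr a b * `|ps b|))) _.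
  rewrite !mulr_sumr -!big_split; apply: ler_sum => a _ /=.
  rewrite !mulr_sumr -!big_split; apply: ler_sum => b _ /=.
  have h := @ratio_defect_le _ (a.2 != b.2) (x a.1) (x b.1) (y a.2) (y b.2).
  have {}h := h (x0 _) (x0 _) (y0 _) (y0 _).
  have {h}/(ler_wpM2l (pr0 a b)) : Num.max 0 (1 - x b.1 / x a.1) <= (a.2 != b.2)%:R +
      (2 * `|ps a| + 2 * `|ps b|).
    by apply: h => /negPn /eqP ->.
  by rewrite -/(pr a b); move: (pr a b) => q; lra.
rewrite (povm_marginal_l (fun a => z a.2 *m p a.1) E'1 (fun a => `|ps a|)).
rewrite (povm_marginal_r (fun a => z' a.2 *m p' a.1) E1 (fun a => `|ps a|)).
rewrite -addrA lerD ?off_diagonal_le // -mulrDr.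
rewrite [X in _ + X](_ : _ = \sum_a rtr (E a) * `|ps a|); last first.
  by apply: eq_bigr => a _; rewrite htr.
have w0 a : 0 <= rtr (E a) by rewrite -frobE frob_ge0.
have : \sum_a rtr (E a) * `|ps a| <=
    \sum_a (eta / 2 * rtr (E a) + (2 * eta)^-1 * (rtr (E a) * ps a ^+ 2)).
  apply: ler_sum => a _; rewrite mulrCA (mulrC (eta / 2)) -mulrDr ler_wpM2l //.
  rewrite -(real_normK (num_real (ps a))) -subr_ge0.
  have -> : eta / 2 + (2 * eta)^-1 * `|ps a| ^+ 2 - `|ps a| =
     (eta - `|ps a|) ^+ 2 / (2 * eta) by field; rewrite gt_eqF.
  by rewrite divr_ge0 ?sqr_ge0 ?mulr_ge0 // ltW.
rewrite big_split /= -!mulr_sumr -rtr_sum E1 rtr1.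
set T := \sum_a _ * `|_|; set Q := \sum_a _ => h.
have -> : 2 * eta * m%:R + 2 * Q / eta = 4 * (eta / 2 * m%:R + (2 * eta)^-1 * Q).
  by field; rewrite gt_eqF.
by lra.
Qed.

End Coupling.

(** * Second moment of the deviation *)

Section Concentration.
Variables (R : realType) (m : nat) (I J : finType).
Local Notation C := R[i].
Variables (p : I -> 'M[C]_m) (z : J -> 'M[C]_m).
Hypotheses (hp : pvm p) (hz : pvm z).
Variables (x : I -> R) (y : J -> R).
Hypotheses (x0 : forall i, 0 < x i) (y0 : forall j, 0 < y j).

Let E := compr p z.
(** The compression in the other order, [z j *m p i *m z j] for projections. Weighted sums in this
    order can be made exactly orthogonal to [D], as in [deviation_orth]. *)
Definition compr_swap (a : I * J) := (p a.1 *m z a.2)^t* *m (p a.1 *m z a.2).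
Let F := compr_swap.
Let pr (a b : I * J) : R := rtr (E a *m F b).
Let ps (a : I * J) : R := psi (x a.1) (y a.2).

Let FE i j : F (i, j) = compr z p (j, i). Proof. by []. Qed.

Let E1 : \sum_a E a = 1%:M. Proof. exact: compr_sum. Qed.
Let F1 : \sum_a F a = 1%:M.
Proof.
rewrite -(pair_bigA _ (fun i j => F (i, j))) exchange_big /=.
under eq_bigr do rewrite compr_sum_r //; exact: pvm_sum hz.
Qed.
Let pr0 a b : 0 <= pr a b. Proof. by rewrite /pr rtr_pos_mul frob_ge0. Qed.

Let sum_pr : \sum_a \sum_b pr a b = m%:R.
Proof.
under eq_bigr do rewrite -rtr_sum -mulmx_sumr F1 mulmx1.
by rewrite -rtr_sum E1 rtr1.
Qed.

Let wE i j : rtr (compr p z (i, j)) = rtr (p i *m z j).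
Proof. by rewrite comprE // rtrC mulmxA (pvm_diag _ hp). Qed.

Let T : R := \sum_j frob (pinch p (z j)).

Let TE : T = m%:R - \sum_j frob (z j - pinch p (z j)).
Proof.
rewrite /T -(pvm_frob_sum hz) -sumrB; apply: eq_bigr => j _.
by rewrite pinch_frob //; ring.
Qed.

Let T_ip j : rtr (pinch p (z j) *m z j) = frob (pinch p (z j)).
Proof. by rewrite -pinch_ip // /ip (pvm_ctr hz) rtrC. Qed.

Let sum_pr_eq2 : \sum_a \sum_b pr a b * (a.2 == b.2)%:R = T.
Proof.
rewrite -(pair_bigA _ (fun i j => \sum_b pr (i, j) b * (j == b.2)%:R)) /= exchange_big.
apply: eq_bigr => j _ /=.
transitivity (\sum_i \sum_k pr (i, j) (k, j)).
  apply: eq_bigr => i _.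
  rewrite -(pair_bigA _ (fun k l => pr (i, j) (k, l) * (j == l)%:R)) /=.
  by apply: eq_bigr => k _; rewrite sum_indic.
rewrite -T_ip -compr_sum_l // mulmx_suml rtr_sum; apply: eq_bigr => i _.
by rewrite -rtr_sum -mulmx_sumr; under eq_bigr do rewrite FE; rewrite compr_sum_r.
Qed.

Let sum_pr_eq1 : \sum_a \sum_b pr a b * (a.1 == b.1)%:R = T.
Proof.
rewrite -(pair_bigA _ (fun i j => \sum_b pr (i, j) b * (i == b.1)%:R)) /=.
rewrite /T; under [RHS]eq_bigr do rewrite -T_ip -compr_sum_l // mulmx_suml rtr_sum.
rewrite [RHS]exchange_big; apply: eq_bigr => i _ /=.
transitivity (\sum_j \sum_l pr (i, j) (i, l)).
  apply: eq_bigr => j _; rewrite -(pair_bigA _ (fun k l => pr (i, j) (k, l) * (i == k)%:R)) /=.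
  by rewrite exchange_big; apply: eq_bigr => l _; rewrite sum_indic.
rewrite exchange_big; apply: eq_bigr => l _ /=.
rewrite -rtr_sum -mulmx_suml compr_sum_r // FE !comprE //.
by rewrite !mulmxA rtrC !mulmxA rtrC !mulmxA.
Qed.

Variable eps : R.
Hypothesis hzp : \sum_j frob (z j - pinch p (z j)) <= eps.

Let pair_le : \sum_a \sum_b pr a b * (ps a - ps b) ^+ 2 <= 8 * eps.
Proof.
(* Pairs agreeing in both labels cost nothing; for all others the bracket is at least [pr a b] and
   the square at most 4. *)
apply: le_trans (_ : _ <= \sum_a \sum_b (4 * (2 * pr a b - pr a b * (a.1 == b.1)%:R
   - pr a b * (a.2 == b.2)%:R))) _.
  apply: ler_sum => a _; apply: ler_sum => b _.
  have [p1 p2] := (psi_le1 (x0 a.1) (y0 a.2), psi_geN1 (x0 a.1) (y0 a.2)).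
  have [q1 q2] := (psi_le1 (x0 b.1) (y0 b.2), psi_geN1 (x0 b.1) (y0 b.2)).
  have h : (ps a - ps b) ^+ 2 <= 4.
    move: p1 p2 q1 q2; rewrite -/(ps a) -/(ps b); move: (ps a) (ps b) => s t *.
    have : 0 <= (2 + (s - t)) * (2 - (s - t)) by rewrite mulr_ge0 //; lra.
    by nra.
  have := pr0 a b; rewrite -/(pr a b); move: (pr a b) => q q0.
  have {h}h := ler_wpM2l q0 h.
  case: eqP => e1; case: eqP => e2 /=; rewrite ?mulr1 ?mulr0; try lra.
  by rewrite /ps e1 e2 subrr expr0n mulr0; lra.
under eq_bigr do rewrite -mulr_sumr !big_split /= !sumrN -mulr_sumr.
rewrite -mulr_sumr !big_split /= !sumrN -mulr_sumr sum_pr sum_pr_eq1 sum_pr_eq2 TE.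
by move: hzp; lra.
Qed.

Let Q : R := \sum_a rtr (E a) * ps a ^+ 2.

(** [S] is close to [W] because [p] and [z] almost commute, and [W], orthogonal to [d], is no longer
    than its distance to [d]. The coupling also gives [2 * Q <= 8 * eps + 2 * ip S W]. *)
Lemma concentration (d : 'M[C]_m) : ip (wsum ps F) d = 0 ->
  Q <= 32 * eps + 3 * frob (wsum ps E - d).
Proof.
set S := wsum ps E; set W := wsum ps F => Wd.
have hSW : frob (S - W) <= 8 * eps.
  by apply: le_trans pair_le; exact: povm_dist.
have wF : \sum_b rtr (F b) * ps b ^+ 2 = Q.
  apply: eq_bigr => -[i j] _; congr (_ * _).
  by rewrite FE wE comprE // rtrC mulmxA (pvm_diag _ hz) rtrC.
have := pair_le; rewrite (povm_pair E1 F1) wF -/Q -/S -/W => hQ.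
have W1 : frob W <= 2 * frob (S - W) + 2 * frob (S - d).
  have h1 : frob W <= frob (W - d).
    by rewrite frob_sub Wd mulr0 subr0 lerDl frob_ge0.
  apply: le_trans h1 _.
  have -> : W - d = (S - d) - (S - W) by rewrite opprB [RHS]addrC subrKA.
  by have := frobD (S - d) (- (S - W)); rewrite frobN; lra.
have h3 : 2 * ip S W <= frob (S - W) + 3 * frob W.
  have := frob_sub (S - W) W; have := frob_ge0 (S - W - W).
  by rewrite ipDl ipNl ipAA; lra.
lra.
Qed.

End Concentration.

(** Clearing denominators gives a polynomial in [y]; the intermediate value theorem applies between
    a point below all [x i] and a point above them. *)
Lemma median_exists (R : realType) (I : finType) (w x : I -> R) :
  (forall i, 0 <= w i) -> (forall i, 0 < x i) ->
  exists2 y, 0 < y & \sum_i w i * psi (x i) y = 0.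
Proof.
move=> w0 x0; pose q i : {poly R} := \prod_(k | k != i) ((x k)%:P + 'X).
pose P : {poly R} := \sum_i (w i)%:P * ('X - (x i)%:P) * q i.
have PE (y : R) : 0 < y -> P.[y] = - (\sum_i w i * psi (x i) y) * \prod_k (x k + y).
  move=> y0; rewrite horner_sum mulNr mulr_suml -sumrN; apply: eq_bigr => i _.
  rewrite /q !hornerE horner_prod [in RHS](bigD1 i) //= /psi.
  rewrite (eq_bigr (fun k => x k + y)) => [|k _]; last by rewrite !hornerE.
  by field; rewrite gt_eqF ?addr_gt0.
have prod0 y : 0 < y -> 0 < \prod_k (x k + y).
  by move=> y0; apply: prodr_gt0 => k _; rewrite addr_gt0.
pose a : R := (1 + \sum_i (x i)^-1)^-1; pose b : R := 1 + \sum_i x i.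
have sV : 0 <= \sum_i (x i)^-1 by apply: sumr_ge0 => i _; rewrite invr_ge0 ltW.
have s0 : 0 <= \sum_i x i by apply: sumr_ge0 => i _; rewrite ltW.
have a0 : 0 < a by rewrite invr_gt0 ltr_wpDr.
have b0 : 0 < b by rewrite ltr_wpDr.
have ab : a <= b.
  apply: le_trans (_ : _ <= 1) _; last by rewrite lerDl.
  by rewrite invf_le1 ?ltr_wpDr // lerDl.
have ax i : a <= x i.
  rewrite -[x i]invrK lef_pV2 ?posrE ?invr_gt0 ?ltr_wpDr // (bigD1 i) //= addrCA lerDl.
  by rewrite addr_ge0 // sumr_ge0 // => k _; rewrite invr_ge0 ltW.
have xb i : x i <= b.
  rewrite /b (bigD1 i) //= addrCA lerDl addr_ge0 // sumr_ge0 // => k _.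
  by rewrite ltW.
have Pa : P.[a] <= 0.
  rewrite PE // mulNr oppr_le0 mulr_ge0 ?(ltW (prod0 _ a0)) //.
  apply: sumr_ge0 => i _; rewrite mulr_ge0 // /psi divr_ge0 ?subr_ge0 //.
  by rewrite addr_ge0 ?ltW.
have Pb : 0 <= P.[b].
  rewrite PE // mulr_ge0 ?(ltW (prod0 _ b0)) // oppr_ge0.
  apply: sumr_le0 => i _; rewrite mulr_ge0_le0 // /psi mulr_le0_ge0 ?subr_le0 //.
  by rewrite invr_ge0 addr_ge0 ?ltW.
have [|y] := poly_ivt ab (p := P); first by rewrite Pa Pb.
move=> /andP[ay yb] /rootP; have y0 := lt_le_trans a0 ay.
rewrite PE // => /eqP; rewrite mulf_eq0 (gt_eqF (prod0 _ y0)) orbF oppr_eq0 => /eqP.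
by exists y.
Qed.

(** * Finite-dimensional rigidity *)

Section Conjugation.
Variables (R : realType) (m : nat).
Local Notation C := R[i].
Variable u : 'M[C]_m.
Hypothesis uu : u^t* *m u = 1%:M.

Definition conjm (X : 'M[C]_m) : 'M[C]_m := u^t* *m X *m u.

Lemma conjmM X Y : conjm (X *m Y) = conjm X *m conjm Y.
Proof.
by rewrite /conjm !mulmxA -(mulmxA _ u (u^t*)) (unitary_swap uu) mulmx1.
Qed.

Lemma conjm_ctr X : (conjm X)^t* = conjm (X^t*).
Proof. by rewrite /conjm !ctrmxM ctrmxK mulmxA. Qed.

Lemma conjm1 : conjm 1%:M = 1%:M.
Proof. by rewrite /conjm mulmx1. Qed.

Lemma conjmD X Y : conjm (X + Y) = conjm X + conjm Y.
Proof. by rewrite /conjm mulmxDr mulmxDl. Qed.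

Lemma conjmN X : conjm (- X) = - conjm X.
Proof. by rewrite /conjm mulmxN mulNmx. Qed.

Lemma conjmZ (k : C) X : conjm (k *: X) = k *: conjm X.
Proof. by rewrite /conjm -scalemxAr -scalemxAl. Qed.

Lemma conjm0 : conjm 0 = 0.
Proof. by rewrite /conjm mulmx0 mul0mx. Qed.

Lemma conjm_sum (I : Type) (s : seq I) (P : pred I) (F : I -> 'M[C]_m) :
  conjm (\sum_(i <- s | P i) F i) = \sum_(i <- s | P i) conjm (F i).
Proof. exact: (big_morph conjm conjmD conjm0). Qed.

Lemma frob_conjm X : frob (conjm X) = frob X.
Proof.
rewrite /conjm frob_unitaryr ?frob_unitaryl ?ctrmxK //; exact: unitary_swap.
Qed.

Lemma rtr_conjm X : rtr (conjm X) = rtr X.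
Proof. by rewrite /conjm rtrC mulmxA (unitary_swap uu) mul1mx. Qed.

Definition conj_algebra (A : {vspace 'M[C]_m}) : {vspace 'M[C]_m} :=
  (linfun (mulmxr u \o mulmx (u^t*)) @: A)%VS.

Lemma conj_algebraP (A : {vspace 'M[C]_m}) X :
  reflect (exists2 a, a \in A & X = conjm a) (X \in conj_algebra A).
Proof.
by apply: (iffP memv_imgP) => -[a aA ->]; exists a; rewrite // lfunE.
Qed.

Lemma conj_algebra_usalg (A : {vspace 'M[C]_m}) :
  unital_star_algebra A -> unital_star_algebra (conj_algebra A).
Proof.
move=> [[AM AS] A1]; split; last by apply/conj_algebraP; exists 1%:M; rewrite ?conjm1.
split.
  move=> _ _ /conj_algebraP[a aA ->] /conj_algebraP[b bA ->].
  by apply/conj_algebraP; exists (a *m b); rewrite ?conjmM // AM.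
move=> _ /conj_algebraP[a aA ->].
by apply/conj_algebraP; exists (a^t*); rewrite ?conjm_ctr // AS.
Qed.

Variables (A : {vspace 'M[C]_m}) (r : nat) (cl : 'I_r -> 'I_r).
Variable e : 'I_r -> 'I_r -> 'M[C]_m.
Hypothesis mu : matrix_units A cl e.

Lemma matrix_units_conj :
  matrix_units (conj_algebra A) cl (fun a b => conjm (e a b)).
Proof.
split.
- exact: mu_cl mu.
- by move=> a b; apply/conj_algebraP; exists (e a b); rewrite // (mu_mem mu).
- by move=> a b /(mu_off mu)->; exact: conjm0.
- move=> a b c d ab; rewrite -conjmM (mu_mul mu) //; case: eqP => // _; exact: conjm0.
- by move=> a b; rewrite conjm_ctr (mu_ctr mu).
- by rewrite -conjm_sum (mu_sum mu) conjm1.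
- move=> a; apply: contra_neq (mu_neq0 mu a) => h; apply: frob_eq0.
  by rewrite -frob_conjm h frob0.
- move=> _ /conj_algebraP[a /(mu_span mu)[k ->] ->]; exists k.
  rewrite conjm_sum; apply: eq_bigr => b _; rewrite conjm_sum.
  by apply: eq_bigr => c _; rewrite conjmZ.
Qed.

Lemma mu_ratio_conj a : mu_ratio cl (fun a b => conjm (e a b)) a = mu_ratio cl e a.
Proof. by rewrite /mu_ratio /mu_wt frob_conjm. Qed.

End Conjugation.

(** * Central projections of the blocks *)

Section Blocks.
Variables (R : realType) (m : nat) (A : {vspace 'M[R[i]]_m}).
Variables (r : nat) (cl : 'I_r -> 'I_r) (e : 'I_r -> 'I_r -> 'M[R[i]]_m).
Hypothesis mu : matrix_units A cl e.
Local Notation C := R[i].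

Lemma mu_pvm : pvm (fun a => e a a).
Proof.
split; [by move=> a; exact: mu_ctr mu _ _| |exact: mu_sum mu].
by move=> a b; rewrite (mu_mul mu) //; case: eqP => // ->.
Qed.

(* The central projection of the block with representative [i]; [0] for other [i]. *)
Definition block i : 'M[C]_m := \sum_(a | cl a == i) e a a.

Lemma block_pvm : pvm block.
Proof.
split.
- by move=> i; rewrite ctrmx_sum; apply: eq_bigr => a _; exact: mu_ctr mu _ _.
- move=> i j; rewrite mulmx_suml; case: eqVneq => [<-|ij].
    apply: eq_bigr => a ai; rewrite mulmx_sumr (bigD1 a) //= (mu_diag mu).
    rewrite big1 ?addr0 // => b /andP[_ ba].
    by rewrite (mu_mul mu) // eq_sym (negPf ba).
  rewrite big1 // => a /eqP ai; rewrite mulmx_sumr big1 // => b /eqP bj.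
  rewrite (mu_mul mu) //; case: eqP => // ab; case/eqP: ij.
  by rewrite -ai -bj ab.
- by rewrite -(mu_sum mu) [RHS](partition_big cl predT).
Qed.

Lemma block_comm X i : X \in A -> block i *m X = X *m block i.
Proof.
case/(mu_span mu) => k ->; rewrite mulmx_sumr mulmx_suml; apply: eq_bigr => a _.
rewrite mulmx_sumr mulmx_suml; apply: eq_bigr => b _.
rewrite -scalemxAr -scalemxAl; congr (_ *: _).
have [ab|/(mu_off mu)->] := eqVneq (cl a) (cl b); last by rewrite mulmx0 mul0mx.
have dl c : e c c *m e a b = if c == a then e a b else 0.
  by rewrite (mu_mul mu) //; case: eqP => [->|].
have dr c : e a b *m e c c = if b == c then e a b else 0.
  by rewrite (mu_mul mu) //; case: eqP => [->|].
rewrite mulmx_suml mulmx_sumr.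
under eq_bigr do rewrite dl; under [RHS]eq_bigr do rewrite dr.
have [ai|ai] := boolP (cl a == i).
  rewrite (bigD1 a) //= eqxx big1 => [|c /andP[_ /negPf->]] //.
  rewrite (bigD1 b) -?ab //= eqxx big1 => [|c /andP[_]] //.
  by rewrite eq_sym => /negPf->.
rewrite !big1 // => c /eqP ci; case: eqP => // h; case/eqP: ai.
  by rewrite ab h.
by rewrite -h.
Qed.

Lemma pinch_block X : X \in A -> pinch block X = X.
Proof.
move=> XA; rewrite /pinch.
under eq_bigr do rewrite block_comm // -mulmxA (pvm_diag _ block_pvm).
by rewrite -mulmx_sumr (pvm_sum block_pvm) mulmx1.
Qed.

(** Pinching fixes [A], so [X] may be replaced by [X - cexp e X], whose distance to its pinching is
    at most its norm. *)
Lemma pinch_block_dist X : frob (X - pinch block X) <= frob (X - cexp e X).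
Proof.
have -> : X - pinch block X = (X - cexp e X) - pinch block (X - cexp e X).
  have -> : pinch block (X - cexp e X) = pinch block X - pinch block (cexp e X).
    rewrite /pinch -sumrB; apply: eq_bigr => i _.
    by rewrite mulmxBr mulmxBl.
  by rewrite (pinch_block (cexp_mem mu X)) opprB addrA subrK.
by rewrite pinch_frob ?lerBlDr ?lerDl ?frob_ge0 //; exact: block_pvm.
Qed.

End Blocks.

Lemma sum_block_overlap (R : realType) m (r s : nat) (cle : 'I_r -> 'I_r)
    (clf : 'I_s -> 'I_s) (e : 'I_r -> 'I_r -> 'M[R[i]]_m)
    (f : 'I_s -> 'I_s -> 'M[R[i]]_m) (G : 'I_r -> 'I_s -> R) :
  \sum_i \sum_k rtr (block cle e i *m block clf f k) * G i k =
  \sum_a \sum_b overlap e f a b * G (cle a) (clf b).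
Proof.
rewrite [RHS](partition_big cle predT) //=; apply: eq_bigr => i _.
rewrite [RHS]exchange_big [RHS](partition_big clf predT) //=; apply: eq_bigr => k _.
rewrite exchange_big mulmx_suml rtr_sum mulr_suml; apply: eq_bigr => a /eqP ai.
rewrite mulmx_sumr rtr_sum mulr_suml; apply: eq_bigr => b /eqP bk.
by rewrite ai bk.
Qed.

Lemma mxtrace_pvm2 (R : realType) m (I J : finType) (p : I -> 'M[R[i]]_m)
    (z : J -> 'M[R[i]]_m) i j : pvm p -> pvm z ->
  \tr (p i *m z j) = (frob (z j *m p i))%:C%C.
Proof.
move=> hp hz; rewrite -mxtrace_frob ctrmxM (pvm_ctr hp) (pvm_ctr hz).
rewrite mulmxA -(mulmxA (p i) (z j)) (pvm_diag _ hz) [RHS]mxtrace_mulC mulmxA.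
by rewrite (pvm_diag _ hp).
Qed.

(** * Medians and the deviation operator *)

Section Deviation.
Variables (R : realType) (m : nat).
Local Notation C := R[i].
Variables (A D : {vspace 'M[C]_m}).
Variables (r : nat) (cl : 'I_r -> 'I_r) (e : 'I_r -> 'I_r -> 'M[C]_m).
Variables (s : nat) (cd : 'I_s -> 'I_s) (g : 'I_s -> 'I_s -> 'M[C]_m).
Hypothesis mu : matrix_units A cl e.
Hypothesis nu : matrix_units D cd g.

Let p := block cl e.
Let z j := g j j.
Let x := mu_ratio cl e.

Definition median (y : 'I_s -> R) := forall j, 0 < y j /\
  \sum_i rtr (p i *m z j) * psi (x i) (y j) = 0.

Lemma medians_exist : exists y, median y.
Proof.
have H j : exists t, 0 < t /\ \sum_i rtr (p i *m z j) * psi (x i) t = 0.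
  have [|i|t t0 ht] := @median_exists R 'I_r (fun i => rtr (p i *m z j)) x; last by exists t.
  - by move=> i; rewrite /rtr (mxtrace_pvm2 _ _ (block_pvm mu) (mu_pvm nu)) frob_ge0.
  - exact: mu_ratio_gt0 mu i.
by have [y hy] := choice H; exists y.
Qed.

Variable y : 'I_s -> R.
Hypothesis hy : median y.

(* Measures how far the block ratios [x] of [A] are from being constant under the minimal
   projections of [D]; the medians make the compressed form orthogonal to [D]. *)
Definition deviation : 'M[C]_m := wsum (fun a => psi (x a.1) (y a.2)) (compr p z).
Definition deviation_sq : R :=
  \sum_a rtr (compr p z a) * psi (x a.1) (y a.2) ^+ 2.

(** Minimality makes [z j *m d *m z j] a multiple of [z j], so [d] sees only the traces
    [rtr (p i *m z j)], whose weighted sum vanishes by the choice of [y j]. *)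
Lemma deviation_orth d : d \in D ->
  ip (wsum (fun a => psi (x a.1) (y a.2)) (compr_swap p z)) d = 0.
Proof.
case/(mu_span nu) => k dk; have zp := mu_pvm nu.
have zdz j : z j *m d *m z j = k j j *: z j.
  rewrite dk mulmx_sumr mulmx_suml (bigD1 j) //= [X in _ + X]big1 => [|a aj].
    rewrite addr0 mulmx_sumr mulmx_suml (bigD1 j) //= [X in _ + X]big1 => [|b bj].
      by rewrite addr0 -scalemxAr -scalemxAl !(mu_diag nu).
    rewrite -scalemxAr -scalemxAl (mu_mul nu) // eqxx.
    have [jb|/(mu_off nu)->] := eqVneq (cd j) (cd b); last by rewrite mul0mx scaler0.
    by rewrite (mu_mul nu) // (negPf bj) scaler0.
  rewrite mulmx_sumr mulmx_suml big1 // => b _.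
  by rewrite -scalemxAr -scalemxAl (mu_mul nu) // eq_sym (negPf aj) mul0mx scaler0.
rewrite /ip ctrmx_sum mulmx_suml rtr_sum.
rewrite -(pair_bigA _ (fun i j => rtr (((psi (x i) (y j))%:C%C *:
   compr_swap p z (i, j))^t* *m d))) /= exchange_big big1 //= => j _.
transitivity (\sum_i complex.Re (k j j) * (rtr (p i *m z j) * psi (x i) (y j))).
  apply: eq_bigr => i _; rewrite ctrmxZ conj_real rtrMZl.
  have -> : compr_swap p z (i, j) = z j *m p i *m z j.
    exact: comprE _ _ zp (block_pvm mu).
  rewrite !ctrmxM (pvm_ctr (block_pvm mu)) (pvm_ctr zp) -!mulmxA rtrC.
  rewrite -!mulmxA (mulmxA (z j) d) zdz -scalemxAr.
  (* This trace is real, so the complex coefficient of [z j] enters only through its real part. *)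
  have trE := mxtrace_pvm2 i j (block_pvm mu) zp.
  rewrite /rtr mxtraceZ trE [k j j * _]mulrC ReZ /=.
  by ring.
by rewrite -mulr_sumr (hy j).2 mulr0.
Qed.

End Deviation.

Lemma pvm_conj (R : realType) m (I : finType) (u : 'M[R[i]]_m) (p : I -> 'M[R[i]]_m) :
  u^t* *m u = 1%:M -> pvm p -> pvm (fun i => conjm u (p i)).
Proof.
move=> uu hp; split.
- by move=> i; rewrite conjm_ctr (pvm_ctr hp).
- move=> i j; rewrite -conjmM // (pvm_mul hp); case: eqP => // _; exact: conjm0.
- by rewrite -conjm_sum (pvm_sum hp) conjm1.
Qed.

(** * Estimates in one matrix algebra *)

Section FiniteLevel.
Variables (R : realType) (m : nat).
Local Notation C := R[i].
Variables (A D : {vspace 'M[C]_m}).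
Variables (r : nat) (cl : 'I_r -> 'I_r) (e : 'I_r -> 'I_r -> 'M[C]_m).
Variables (s : nat) (cd : 'I_s -> 'I_s) (g : 'I_s -> 'I_s -> 'M[C]_m).
Hypothesis uA : unital_star_algebra A.
Hypothesis mu : matrix_units A cl e.
Hypothesis nu : matrix_units D cd g.
Variable y : 'I_s -> R.
Hypothesis hy : median cl e g y.

Let p := block cl e.
Let z j := g j j.
Let x := mu_ratio cl e.
Let hp : pvm p. Proof. exact: block_pvm mu. Qed.
Let hz : pvm z. Proof. exact: mu_pvm nu. Qed.
Let x0 i : 0 < x i. Proof. exact: mu_ratio_gt0 mu i. Qed.
Let y0 j : 0 < y j. Proof. by case: (hy j). Qed.
Let S := deviation cl e g y.
Let Q := deviation_sq cl e g y.

Variable eps : R.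
Hypothesis DA : forall v, v \in D -> v^t* *m v = 1%:M -> frob (v - cexp e v) <= eps.

(** A suitable signed sum of the [z j] is a unitary of [D] whose distance to [A] dominates all the
    individual distances together. *)
Let hzp : \sum_j frob (z j - pinch p (z j)) <= eps.
Proof.
have [||v [vD vv hv]] := @mu_diag_average _ _ _ _ _ _ nu _ _ (fun X => X - cexp e X).
- by move=> a b; rewrite cexpD opprD addrACA.
- by move=> a; rewrite cexpN opprD.
apply: le_trans (DA vD vv); apply: le_trans hv; apply: ler_sum => j _.
exact: pinch_block_dist mu _.
Qed.

Lemma deviation_sq_le d : d \in D -> Q <= 32 * eps + 3 * frob (S - d).
Proof. by move=> dD; apply: concentration => //; exact: (deviation_orth mu nu hy dD). Qed.

Variable u : 'M[C]_m.
Hypothesis uu : u^t* *m u = 1%:M.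
Hypothesis Du : forall v, v \in D -> v^t* *m v = 1%:M -> frob (v - conjm u v) <= eps.
Hypothesis uAu : forall v, v \in A -> v^t* *m v = 1%:M ->
  frob (conjm u v - cexp e (conjm u v)) <= eps.

Let f a b := conjm u (e a b).
Let muf : matrix_units (conj_algebra u A) cl f. Proof. exact: matrix_units_conj. Qed.
Let hp' : pvm (fun i => conjm u (p i)). Proof. exact: pvm_conj. Qed.
Let hz' : pvm (fun j => conjm u (z j)). Proof. exact: pvm_conj. Qed.

Let hzz' : \sum_j frob (z j - conjm u (z j)) <= eps.
Proof.
have [||v [vD vv hv]] := @mu_diag_average _ _ _ _ _ _ nu _ _ (fun X => X - conjm u X).
- by move=> a b; rewrite conjmD opprD addrACA.
- by move=> a; rewrite conjmN opprD.
exact: le_trans hv (Du vD vv).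
Qed.

Let hzp' : \sum_j frob (conjm u (z j) - pinch (fun i => conjm u (p i)) (conjm u (z j))) <= eps.
Proof.
apply: le_trans hzp; apply: ler_sum => j _.
have -> : pinch (fun i => conjm u (p i)) (conjm u (z j)) = conjm u (pinch p (z j)).
  by rewrite /pinch conjm_sum; apply: eq_bigr => i _; rewrite -!conjmM.
by rewrite -conjmN -conjmD frob_conjm.
Qed.

Let comprJ a : compr (fun i => conjm u (p i)) (fun j => conjm u (z j)) a
  = conjm u (compr p z a).
Proof. by rewrite /compr -!conjmM // conjm_ctr -conjmM. Qed.

Let htr a : rtr (compr p z a) =
  rtr (compr (fun i => conjm u (p i)) (fun j => conjm u (z j)) a).
Proof. by rewrite comprJ rtr_conjm. Qed.

Let hT : mu_avg cl f (fun X => X - cexp e X) <= eps.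
Proof.
have [||v [vB vv]] := @mu_average _ _ _ _ _ _ muf _ _ (fun X => X - cexp e X) _ _ 1.
- by move=> a b; rewrite cexpD opprD addrACA.
- by move=> a; rewrite cexpN opprD.
rewrite !mul1r => hv; apply: le_trans hv _.
have /conj_algebraP[a aA va] := vB; rewrite va; apply: uAu => //.
have : conjm u (a^t* *m a) = 1%:M by rewrite conjmM // -conjm_ctr -va.
move=> /(congr1 (fun X => u *m X *m u^t*)); rewrite mulmx1 (unitary_swap uu).
by rewrite /conjm !mulmxA (unitary_swap uu) mul1mx -!mulmxA (unitary_swap uu) mulmx1.
Qed.

(** Indices representing no block have zero projection and ratios are constant on blocks, so sums
    over blocks become sums over minimal projections. *)
Let sum_pp (G : R -> R -> R) : \sum_i \sum_k rtr (p i *m conjm u (p k)) * G (x i) (x k) =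
  \sum_a \sum_c overlap e f c a * G (x c) (x a).
Proof.
have -> : \sum_i \sum_k rtr (p i *m conjm u (p k)) * G (x i) (x k) =
    \sum_i \sum_k rtr (block cl e i *m block cl f k) * G (x i) (x k).
  by apply: eq_bigr => i _; apply: eq_bigr => k _; rewrite /p conjm_sum.
rewrite (sum_block_overlap cl cl e f (fun i k => G (x i) (x k))) exchange_big.
apply: eq_bigr => a _; apply: eq_bigr => c _; congr (_ * G _ _).
  by apply: (mu_ratio_cl mu); exact: mu_cl mu c.
by apply: (mu_ratio_cl mu); exact: mu_cl mu a.
Qed.

Let xf a : mu_ratio cl f a = x a. Proof. exact: mu_ratio_conj. Qed.

Lemma deviation_comm : frob (S - conjm u S) <= 56 * eps.
Proof.
have -> : conjm u S = wsum (fun a => psi (x a.1) (y a.2))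
    (compr (fun i => conjm u (p i)) (fun j => conjm u (z j))).
  by rewrite conjm_sum; apply: eq_bigr => a _; rewrite conjmZ comprJ.
apply: coupling_dist_le => //.
rewrite (sum_pp (fun s t => Num.max 0 (1 - s / t))); apply: le_trans hT.
apply: le_trans (mu_monotone mu muf).
by apply: ler_sum => a _; apply: ler_sum => c _; rewrite xf.
Qed.

(** The defect that [mu_reverse] asks for is supplied by [coupling_reverse], where [Q] enters. The 7
    is 6 for the mismatched labels plus 1 for [hT]. *)
Lemma conj_algebra_close (eta : R) v : (0 < m)%N -> 0 < eta -> v \in A -> opnorm v <= 1 ->
  frob (v - cexp f v) <= 4 * (7 * eps + 2 * eta * m%:R + 2 * Q / eta).
Proof.
move=> m0 eta0 vA v1.
apply: le_trans (mu_close (conj_algebra_usalg uu uA) mu muf m0 vA v1) _.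
rewrite ler_pM2l //; apply: le_trans (mu_reverse mu muf) _.
have := coupling_reverse hp hp' hz hz' x0 y0 hzp hzp' hzz' htr eta0.
rewrite (sum_pp (fun s t => Num.max 0 (1 - t / s))).
rewrite -/Q; under [in X in _ -> X]eq_bigr do under eq_bigr do rewrite xf.
by have := hT; rewrite /Q /deviation_sq; lra.
Qed.

End FiniteLevel.

(** * Lifting from the ultraproduct *)

Section UnitaryApproximation.
Variables (R : realType) (m : nat).
Local Notation C := R[i].

Lemma rtr_fc (f : R -> R) (h : 'M[C]_m) : rtr (fc f h) = \sum_i f (ev h i).
Proof.
rewrite /fc rtrC mulmxA spectralmxr mul1mx /rtr mxtrace_diag Re_sum.
by apply: eq_bigr => i _; rewrite mxE.
Qed.

(** The characteristic polynomial of [- x] cannot vanish at all of the infinitely many points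
    [delta / k.+1]. *)
Lemma unit_shift (x : 'M[C]_m) (delta : R) : 0 < delta ->
  exists2 t : R, 0 < t <= delta & x + t%:C%C%:M \in unitmx.
Proof.
move=> d0; pose p := char_poly (- x).
have p0 : p != 0 by apply/monic_neq0/char_poly_monic.
pose q k : R := delta / k.+1%:R.
have q0 k : 0 < q k <= delta.
  by rewrite divr_gt0 //= ler_pdivrMr // ler_peMr ?ler1n // ltW.
have [k hk] : exists k, ~~ root p (q k)%:C%C.
  apply: contrapT => hN; move/eqP: p0; apply.
  pose s := [seq (q k)%:C%C | k <- iota 0 (size p)].
  apply: (@roots_geq_poly_eq0 _ _ s).
  - apply/allP => _ /mapP[k _ ->]; apply: contrapT => h; apply: hN; exists k.
    exact/negP.
  - rewrite map_inj_uniq ?iota_uniq // => k l [] /(mulfI (lt0r_neq0 d0)) /invr_inj /eqP.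
    by rewrite eqr_nat => /eqP [].
  - by rewrite size_map size_iota.
exists (q k) => //; move: hk; rewrite -eigenvalue_root_char /eigenvalue negbK.
rewrite /eigenspace kermx_eq0 row_free_unit -opprD.
by rewrite -scaleN1r unitmxZ // unitrN unitr1.
Qed.

(** [u] is the unitary part of the polar decomposition; for each singular value [s > 0] the claim is
    that [|1 - s|] is at most [|1 - s ^+ 2|]. *)
Lemma polar_unitary (x : 'M[C]_m) : x \in unitmx ->
  exists2 u, u^t* *m u = 1%:M & frob (u - x) <= frob (x^t* *m x - 1%:M).
Proof.
move=> xU; set h := x^t* *m x.
have hh : h^t* = h by rewrite /h ctrmxM ctrmxK.
have ev0 i : 0 < ev h i.
  pose q := fc (fun t => (t == ev h i)%:R) h.
  have q0 : q != 0.
    by apply/eqP => /(@fc_eq0 _ _ _ _ i) /eqP; rewrite eqxx oner_eq0.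
  have hq : h *m q = (ev h i)%:C%C *: q.
    rewrite -{1}(fc_id hh) fcM (fc_ext (g := fun x => ev h i * (x == ev h i)%:R)).
      by rewrite -(fcM (fun=> ev h i)) fcC mul_scalar_mx.
    by move=> j /=; case: eqP => [->|]; rewrite ?mulr0.
  have xq0 : x *m q != 0.
    by apply: contra_neq q0 => /(congr1 (mulmx (invmx x))); rewrite mulKmx // mulmx0.
  rewrite -(pmulr_lgt0 _ (frob_gt0 q0)).
  have <- : frob (x *m q) = ev h i * frob q by
    rewrite (frobE (x *m q)) ctrmxM -mulmxA (mulmxA _ x) hq -scalemxAr rtrZ -frobE.
  exact: frob_gt0.
pose g := fc (fun t => (Num.sqrt t)^-1) h.
have sq i : Num.sqrt (ev h i) ^+ 2 = ev h i by rewrite sqr_sqrtr ?ltW.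
have s0 i : Num.sqrt (ev h i) != 0 by rewrite gt_eqF ?sqrtr_gt0.
have ghg (k : R -> R) : fc k h *m h *m fc k h = fc (fun t => k t ^+ 2 * t) h.
  rewrite -{2}(fc_id hh) !fcM; apply: fc_ext => i /=; ring.
exists (x *m g).
  rewrite ctrmxM fc_ctr mulmxA -(mulmxA _ _ x) -/h ghg -(fc1 h); apply: fc_ext => i.
  by rewrite -[X in _ * X]sq exprVn mulVf // expf_neq0.
have -> : x *m g - x = x *m fc (fun t => (Num.sqrt t)^-1 + -1) h.
  by rewrite -fcD fcC mulmxDr rmorphN /= rmorph1 mul_mx_scalar scaleN1r.
have -> : h - 1%:M = fc (fun t => t + -1) h.
  by rewrite -(fcD id) fc_id // fcC rmorphN /= rmorph1 -scalemx1 scaleN1r.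
rewrite !frobE ctrmxM !fc_ctr mulmxA -(mulmxA _ _ x) -/h ghg fcM !rtr_fc.
apply: ler_sum => i _; rewrite -{2 3 4}sq.
set s := Num.sqrt _; have sp : 0 < s by rewrite sqrtr_gt0.
have -> : (s^-1 - 1) ^+ 2 * s ^+ 2 = (1 - s) ^+ 2 by field; rewrite gt_eqF.
have -> : (s ^+ 2 - 1) * (s ^+ 2 - 1) = (1 - s) ^+ 2 * (1 + s) ^+ 2 by ring.
rewrite ler_peMr ?sqr_ge0 // exprn_ege1 // lerDl ltW //.
Qed.

Lemma unitary_approx (x : 'M[C]_m) (delta : R) : 0 < delta ->
  exists2 u, u^t* *m u = 1%:M & frob (u - x) <= 4 * frob (x^t* *m x - 1%:M) + delta.
Proof.
move=> d0; pose K : R := 32 * frob x + 10 * m%:R + 1.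
have x0 : 0 <= frob x := frob_ge0 x.
have m0 : 0 <= m%:R :> R by [].
have K0 : 0 < K by rewrite /K; lra.
have dK : 0 < Num.min 1 (delta / K) by rewrite lt_min ltr01 divr_gt0.
have [t /andP[t0]] := unit_shift x dK; rewrite le_min => /andP[t1 tK].
set x' := x + _ => /polar_unitary[u uu hu]; exists u => //.
have frobT : frob (t%:C%C%:M : 'M[C]_m) = t ^+ 2 * m%:R.
  by rewrite -scalemx1 frobZ nsq_real frob1.
have e1 : frob (u - x) <= 2 * frob (u - x') + 2 * (t ^+ 2 * m%:R).
  have -> : u - x = (u - x') + t%:C%C%:M by rewrite /x' opprD addrA subrK.
  by rewrite -frobT frobD.
have e2 : frob (x'^t* *m x' - 1%:M) <= 2 * frob (x^t* *m x - 1%:M) +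
    2 * (t ^+ 2 * (8 * frob x + 2 * (t ^+ 2 * m%:R))).
  have -> : x'^t* *m x' - 1%:M = (x^t* *m x - 1%:M) + t%:C%C *: (x + x^t* + t%:C%C%:M).
    have ctrT : (t%:C%C%:M : 'M[C]_m)^t* = t%:C%C%:M.
      by rewrite -scalemx1 ctrmxZ conj_real ctrmx1.
    rewrite /x' ctrmxD ctrT mulmxDl !mulmxDr mul_mx_scalar !mul_scalar_mx !scalerDr.
    rewrite (addrAC _ _ (- 1%:M)) (addrAC _ _ (- 1%:M)) -addrA; congr (_ + _).
    by rewrite addrA (addrC (_ *: x^t*)).
  apply: le_trans (frobD _ _) _; rewrite lerD2l ler_pM2l // frobZ nsq_real.
  rewrite ler_wpM2l ?sqr_ge0 //; apply: le_trans (frobD _ _) _; rewrite frobT.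
  by have := frobD x (x^t*); rewrite frobC; lra.
have t2 : t ^+ 2 <= t by rewrite expr2 ler_piMl // ltW.
have t20 : 0 <= t ^+ 2 by exact: sqr_ge0.
have tKd : t * K <= delta by rewrite -ler_pdivlMr.
have e3 : t ^+ 2 * (32 * frob x + 10 * m%:R) <= delta.
  apply: le_trans tKd; apply: ler_pM => //; first by lra.
  by rewrite /K; lra.
have e4 : t ^+ 2 * (t ^+ 2 * m%:R) <= t ^+ 2 * m%:R.
  rewrite ler_wpM2l // ler_piMl //; apply: le_trans t2 t1.
nra.
Qed.

End UnitaryApproximation.

(** * Adjoining the identity matrix *)

Section Unitalization.
Variables (R : realType) (m : nat).
Local Notation C := R[i].
Variable A : {vspace 'M[C]_m}.
Hypothesis sA : star_subalgebra A.

Definition unitalize : {vspace 'M[C]_m} := (A + <[1%:M]>)%VS.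

Lemma unitalizeP X :
  reflect (exists2 a, a \in A & exists c : C, X = a + c%:M) (X \in unitalize).
Proof.
apply: (iffP memv_addP) => [[a aA [_ /vlineP[c ->] ->]]|[a aA [c ->]]].
  by exists a => //; exists c; rewrite scalemx1.
by exists a => //; exists c%:M => //; apply/vlineP; exists c; rewrite scalemx1.
Qed.

Lemma unitalize_usalg : unital_star_algebra unitalize.
Proof.
case: sA => AM AS; split; last by apply/unitalizeP; exists 0; [exact: mem0v|exists 1; rewrite add0r].
split=> [_ _ /unitalizeP[a aA [c ->]] /unitalizeP[b bA [k ->]]|_ /unitalizeP[a aA [c ->]]].
  apply/unitalizeP; exists (a *m b + k *: a + c *: b).
    by rewrite !memvD ?memvZ // AM.
  exists (c * k); rewrite mulmxDl !mulmxDr mul_mx_scalar mul_scalar_mx -scalar_mxM.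
  by rewrite !addrA.
apply/unitalizeP; exists (a^t*); first exact: AS.
by exists (c^*); rewrite ctrmxD -(scalemx1 _ c) ctrmxZ ctrmx1 scalemx1.
Qed.

(* Multiplication by an invertible [a] of [A] permutes [A], so it hits [a] at [1]. *)
Lemma unit_mem a : a \in A -> a \in unitmx -> 1%:M \in A.
Proof.
move=> aA aU; pose f := linfun (mulmx a : 'M[C]_m -> 'M[C]_m).
have fA : (f @: A <= A)%VS.
  by apply/subvP => _ /memv_imgP[b bA ->]; rewrite lfunE; apply: (proj1 sA).
have kf : (A :&: lker f)%VS = 0%VS.
  apply/eqP; rewrite -subv0; apply/subvP => b; rewrite memv_cap => /andP[_].
  rewrite memv_ker lfunE /= => /eqP /(congr1 (mulmx (invmx a))).
  by rewrite mulKmx // mulmx0 => ->; exact: mem0v.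
have : a \in (f @: A)%VS.
  suff -> : (f @: A)%VS = A by [].
  by apply/eqP; rewrite eqEdim fA limg_dim_eq /=.
case/memv_imgP => b bA; rewrite lfunE /= => /(congr1 (mulmx (invmx a))).
by rewrite mulKmx // mulVmx // => ->.
Qed.

(** Without the identity matrix in [A], [a] is singular, and on its left kernel [a + c%:M] acts as
    [c]. Thus scalar parts of a bounded sequence are bounded. *)
Lemma scalar_part_bound a (c : C) M : a \in A -> 1%:M \notin A ->
  0 < M -> opnorm (a + c%:M) <= M -> nsq c <= M ^+ 2.
Proof.
move=> aA A1 M0 hM.
have : a \notin unitmx by apply: contra A1; exact: unit_mem.
rewrite unitmxE unitfE negbK => /det0P[v v0 va].
have hv : v *m (a + c%:M) = c *: v by rewrite mulmxDr va add0r mul_mx_scalar.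
have := opnorm_frob (opnorm_boundC M0 hM) (v^t*).
by rewrite -ctrmxM !frobC hv frobZ ler_pM2r ?frob_gt0.
Qed.

End Unitalization.

(* The quadratic form of [S] at [(S v, v)] is at most the mean of the norms of [S v] and [v]. *)
Lemma opnorm_povm (R : realType) m (I : finType) (X : I -> 'M[R[i]]_m) (w : I -> R) :
  \sum_a (X a)^t* *m X a = 1%:M -> (forall a, -1 <= w a <= 1) ->
  opnorm (wsum w (fun a => (X a)^t* *m X a)) <= 1.
Proof.
move=> X1 hw; set S := wsum _ _; apply: opnorm_le_frob => // v.
have frobX (Y : 'cV[R[i]]_m) : \sum_a frob (X a *m Y) = frob Y.
  have -> : frob Y = rtr (Y^t* *m (1%:M *m Y)) by rewrite mul1mx -frobE.
  rewrite -X1 mulmx_suml mulmx_sumr rtr_sum.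
  by apply: eq_bigr => a _; rewrite frobE ctrmxM !mulmxA.
have : frob (S *m v) = \sum_a w a * ip (X a *m (S *m v)) (X a *m v).
  rewrite frobE {2}/S mulmx_suml mulmx_sumr rtr_sum; apply: eq_bigr => a _.
  by rewrite -scalemxAl -scalemxAr rtrZ /ip [in RHS]ctrmxM !mulmxA.
have : \sum_a w a * ip (X a *m (S *m v)) (X a *m v) <=
    \sum_a 2^-1 * (frob (X a *m (S *m v)) + frob (X a *m v)).
  apply: ler_sum => a _; have /andP[w1 w2] := hw a.
  have := frob_ge0 (X a *m (S *m v) + X a *m v); rewrite frob_add.
  have := frob_ge0 (X a *m (S *m v) - X a *m v); rewrite frob_sub.
  move: (frob _) (frob _) (ip _ _) => s t k h1 h2; nra.
rewrite -mulr_sumr big_split /= !frobX expr1n mul1r => h1 h2; lra.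
Qed.

Lemma opnorm_conj (R : realType) m (u X : 'M[R[i]]_m) M : u^t* *m u = 1%:M ->
  opnorm X <= M -> opnorm (u *m X *m u^t*) <= M.
Proof.
move=> uu XM; have -> : M = 1 * M * 1 by rewrite mul1r mulr1.
apply: opnorm_boundM; first apply: opnorm_boundM => //; apply: opnorm_unitary => //.
by rewrite ctrmxK unitary_swap.
Qed.

Definition nearly_into (R : realType) m (L : 'M[R[i]]_m -> 'M[R[i]]_m)
    (D A : {vspace 'M[R[i]]_m}) (eps : R) : Prop :=
  forall v, v \in D -> v^t* *m v = 1%:M -> exists2 a, a \in A & frob (L v - a) <= eps.

Definition nearly_fixes (R : realType) m (D : {vspace 'M[R[i]]_m}) u (eps : R) : Prop :=
  forall v, v \in D -> v^t* *m v = 1%:M -> frob (v - conjm u v) <= eps.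

(** The order of quantifiers is what passes to the ultraproduct: [S] and [Q] precede [u] and [eps],
    so one sequence serves all unitaries; [b] precedes [eps] and [eta], so one sequence serves all
    tolerances. *)
Lemma finite_level (R : realType) m (A D : {vspace 'M[R[i]]_m}) : (0 < m)%N ->
  unital_star_algebra A -> unital_star_algebra D ->
  exists (S : 'M[R[i]]_m) (Q : R), [/\ opnorm S <= 1,
    forall eps d, nearly_into id D A eps -> d \in D -> Q <= 32 * eps + 3 * frob (S - d),
    forall eps u, u^t* *m u = 1%:M -> nearly_into id D A eps -> nearly_fixes D u eps ->
      nearly_into (conjm u) A A eps -> frob (S - conjm u S) <= 56 * eps
    & forall u v, u^t* *m u = 1%:M -> v \in A -> opnorm v <= 1 ->
      exists b, [/\ b \in A, opnorm b <= 1 & forall eps eta, 0 < eta ->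
        nearly_into id D A eps -> nearly_fixes D u eps -> nearly_into (conjm u) A A eps ->
        frob (v - conjm u b) <= 4 * (7 * eps + 2 * eta * m%:R + 2 * Q / eta)]].
Proof.
move=> m0 uA uD; have [r [cl [e mu]]] := matrix_units_exist uA m0.
have [s [cd [g nu]]] := matrix_units_exist uD m0.
have [y hy] := medians_exist mu nu.
have y0 j : 0 < y j by case: (hy j).
have cexpA L D' eps : nearly_into L D' A eps ->
    forall v, v \in D' -> v^t* *m v = 1%:M -> frob (L v - cexp e (L v)) <= eps.
  by move=> h v vD /(h _ vD)[a aA]; apply: le_trans; exact: cexp_dist mu _ _ aA.
exists (deviation cl e g y), (deviation_sq cl e g y); split.
- apply: opnorm_povm; first exact: (compr_sum (block_pvm mu) (mu_pvm nu)).
  move=> a; have x0 := mu_ratio_gt0 mu a.1.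
  by rewrite psi_le1 ?psi_geN1.
- move=> eps d /cexpA DA dD; exact: (deviation_sq_le mu nu hy DA dD).
- move=> eps u uu /cexpA DA Du /cexpA uAu.
  exact: (deviation_comm mu nu hy DA uu Du uAu).
move=> u v uu vA v1; have muf := matrix_units_conj uu mu.
pose f a b := conjm u (e a b); set c := cexp f v.
have /conj_algebraP[b bA cb] : c \in conj_algebra u A by exact: cexp_mem muf v.
have c1 : opnorm c <= 1 by exact: (opnorm_cexp (conj_algebra_usalg uu uA) muf m0 v1).
exists b; split; first exact: bA.
  suff -> : b = u *m c *m u^t* by exact: opnorm_conj.
  rewrite cb /conjm !mulmxA (unitary_swap uu) mul1mx -mulmxA (unitary_swap uu).
  by rewrite mulmx1.
move=> eps eta eta0 /cexpA DA Du /cexpA uAu; rewrite -cb.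
exact: (conj_algebra_close uA mu nu hy DA uu Du uAu m0 eta0 vA v1).
Qed.

Lemma opnorm_scalar (R : realType) m (c : R[i]) M : 0 <= M -> nsq c <= M ^+ 2 ->
  opnorm (c%:M : 'M[R[i]]_m) <= M.
Proof.
move=> M0 hc; apply: opnorm_le_frob => // v.
by rewrite mul_scalar_mx frobZ ler_wpM2r ?frob_ge0.
Qed.

Lemma dependent_choice (I : Type) (T : I -> Type) (P : forall i, T i -> Prop) :
  (forall i, exists x, P i x) -> exists f : forall i, T i, forall i, P i (f i).
Proof.
by move=> h; exists (fun i => projT1 (cid (h i))) => i; exact: projT2 (cid (h i)).
Qed.

(** * Representatives of classes in the ultraproduct *)

Section UltraproductLifting.
Variables (R : realType) (U : nonprincipal_ultrafilter) (d : nat -> nat).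
Hypothesis d_pos : forall n, (0 < d n)%N.
Local Notation C := R[i].
Local Notation bseq := (Defs.bseq R d).
Local Notation cls := (@upclass R U d).
Local Notation internal := (@internal_set R U d).
Local Notation null_id := (@null_ideal R U d).
Implicit Types (x y u v : bseq) (A D : forall n, {vspace 'M[C]_(d n)}).

Lemma null_frobP x : x \in null_id <->
  forall eps : R, 0 < eps -> \forall n \near npu_sets U, frob (x n) <= eps * (d n)%:R.
Proof.
have dp n : 0 < (d n)%:R :> R by rewrite ltr0n.
split=> [/null_idealP /cvgr0Pnorm_le h eps eps0|h].
  have s0 : 0 < Num.sqrt eps by rewrite sqrtr_gt0.
  apply: filterS (h _ s0) => n; rewrite ger0_norm ?norm2_ge0 // norm2E.
  by rewrite (ler_sqrt _ (ltW eps0)) ler_pdivrMr.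
apply/null_idealP/cvgr0Pnorm_le => eps eps0.
apply: filterS (h _ (exprn_gt0 2 eps0)) => n hn.
rewrite ger0_norm ?norm2_ge0 // norm2E -[eps in leRHS](ger0_norm (ltW eps0)) -sqrtr_sqr.
by rewrite ler_sqrt ?sqr_ge0 // ler_pdivrMr.
Qed.

(* A choice of bad unitaries along the ultrafilter would itself be a bounded sequence. *)
Lemma unitary_uniform A (P : forall n, 'M[C]_(d n) -> Prop) :
  (forall n, 1%:M \in A n) ->
  (forall v, (forall n, v n \in A n) -> (forall n, (v n)^t* *m v n = 1%:M) ->
     \forall n \near npu_sets U, P n (v n)) ->
  \forall n \near npu_sets U, forall w, w \in A n -> w^t* *m w = 1%:M -> P n w.
Proof.
move=> A1 h; pose B := [set n | forall w, w \in A n -> w^t* *m w = 1%:M -> P n w].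
have [//|bad] := in_ultra_setVsetC B (npu_ultra U).
have H n : exists w : 'M[C]_(d n), [/\ w \in A n, w^t* *m w = 1%:M & (~` B) n -> ~ P n w].
  have [Bn|/existsNP[w]] := pselect (B n).
    by exists 1%:M; split; rewrite ?ctrmx1 ?mulmx1.
  by move=> /not_implyP[wA /not_implyP[ww Pw]]; exists w.
have [w wP] := dependent_choice H.
have wb : mxseq_bounded w.
  by exists 1 => n; apply: opnorm_unitary; case: (wP n).
have hP : \forall n \near npu_sets U, P n (w n).
  by apply: (h (BSeq wb)) => n /=; case: (wP n).
have : npu_sets U (~` B `&` [set n | P n (w n)]) by exact: filterI.
suff -> : ~` B `&` [set n | P n (w n)] = set0.
  by move/filter_not_empty.
by apply/seteqP; split=> // n [Bn Pn]; case: (wP n) => _ _ /(_ Bn).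
Qed.

Lemma unitary_lift (w : up_unitary R U d) :
  exists u, (forall n, (u n)^t* *m u n = 1%:M) /\ cls u = uval w.
Proof.
pose x := repr (uval w); have xw : cls x = uval w by rewrite /upclass reprK.
(* The 5 is the 4 of [unitary_approx] plus a tolerance equal to the error itself; when the error is
   zero no positive tolerance is left, but [x n] is already unitary. *)
have H n : exists u : 'M[C]_(d n), u^t* *m u = 1%:M /\
    frob (u - x n) <= 5 * frob ((x n)^t* *m x n - 1%:M).
  have [h0|h0] := eqVneq ((x n)^t* *m x n - 1%:M) 0.
    exists (x n); split; first exact: subr0_eq.
    by rewrite subrr frob0 mulr_ge0 ?frob_ge0.
  have [u uu hu] := unitary_approx (x n) (frob_gt0 h0).
  by exists u; split => //; move: hu; lra.
have [w' wP] := dependent_choice H.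
have wb : mxseq_bounded w'.
  by exists 1 => n; apply: opnorm_unitary; case: (wP n).
exists (BSeq wb); split; first by move=> n; case: (wP n).
rewrite -xw; apply/upclass_eq/null_frobP => eps eps0.
have : bseq_star x * x - 1 \in null_id.
  by apply/upclass_eq; rewrite upclassM upclass_star xw uval_starl.
move=> /null_frobP h; have e5 : 0 < eps / 5 by rewrite divr_gt0.
apply: filterS (h _ e5) => n /= hn; have [_] := wP n.
by move: hn; lra.
Qed.

(** If [e] in [A] represents 1, the scalar parts [c n] can be replaced by [c n *: e n] at the cost
    of a null sequence. *)
Lemma unitalize_internal A : (forall n, star_subalgebra (A n)) ->
  internal A 1 -> internal (fun n => unitalize (A n)) = internal A.
Proof.
move=> sA [e eA e1]; apply/seteqP; split=> x; last first.
  move=> [a aA ->]; exists a => // n; apply/unitalizeP; exists (a n); first exact: aA.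
  by exists 0; rewrite -scalemx1 scale0r addr0.
move=> [a aA ->]; have [M M0 aM] := bseq_pos a.
have H n : exists c : C, a n - c%:M \in A n /\ nsq c <= M ^+ 2.
  have [A1|A1] := boolP (1%:M \in A n).
    exists 0; rewrite -scalemx1 scale0r subr0 /nsq /= expr0n addr0 sqr_ge0; split => //.
    have /unitalizeP[b bA [c ->]] := aA n.
    by rewrite memvD // -scalemx1 memvZ.
  have /unitalizeP[b bA [c abc]] := aA n; exists c; split.
    by rewrite abc addrK.
  by apply: (scalar_part_bound (sA n) bA A1 M0); rewrite -abc.
have [c cP] := choice H.
have cb : @mxseq_bounded R d (fun n => (c n)%:M).
  by exists M => n; apply: opnorm_scalar (ltW M0) (cP n).2.
exists (a - BSeq cb * (1 - e)).
  move=> n; have -> : (a - BSeq cb * (1 - e) : bseq) n = (a n - (c n)%:M) + c n *: e n.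
    by rewrite /= mulmxBr mulmx1 opprB mul_scalar_mx addrCA addrC.
  have [cA _] := cP n; apply: memvD; first exact: cA.
  by rewrite memvZ ?eA.
apply/upclass_eq; rewrite opprB addrC subrK.
by apply: null_mull; apply/upclass_eq; rewrite -e1 upclass1.
Qed.

End UltraproductLifting.

(** * Rigidity in the ultraproduct *)

Section Rigidity.
Variables (R : realType) (U : nonprincipal_ultrafilter) (d : nat -> nat).
Hypothesis d_pos : forall n, (0 < d n)%N.
Local Notation C := R[i].
Local Notation bseq := (Defs.bseq R d).
Local Notation cls := (@upclass R U d).
Local Notation internal := (@internal_set R U d).
Local Notation null_id := (@null_ideal R U d).
Implicit Types (x y u v : bseq).

Variables A D : forall n, {vspace 'M[C]_(d n)}.
Hypothesis uA : forall n, unital_star_algebra (A n).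
Hypothesis uD : forall n, unital_star_algebra (D n).
Hypothesis DA : internal D `<=` internal A.

Variable T : set (up_unitary R U d).
Hypothesis TA : forall w, T w -> forall X, internal A X ->
  internal A (up_star (uval w) * X * uval w).
Hypothesis TD : forall w, T w -> forall X, internal D X -> X * uval w = uval w * X.
Hypothesis Dgen : forall X, (forall w, T w -> X * uval w = uval w * X) -> internal D X.

Let near_DA (eps : R) : 0 < eps ->
  \forall n \near npu_sets U, nearly_into id (D n) (A n) (eps * (d n)%:R).
Proof.
move=> eps0; apply: unitary_uniform => [n|v vD vv]; first by case: (uD n).
have [a aA /upclass_eq /(null_frobP U d_pos _) h] : internal A (cls v) by apply: DA; exists v.
by apply: filterS (h _ eps0) => n hn; exists (a n); [exact: aA|exact: hn].
Qed.

Lemma up_star_conj (w : up_unitary R U d) u (v : bseq) : cls u = uval w ->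
  cls (bseq_star u * v * u) = up_star (uval w) * cls v * uval w.
Proof. by move=> uw; rewrite !upclassM upclass_star uw. Qed.

Let near_fix w u (eps : R) : T w -> cls u = uval w -> 0 < eps ->
  \forall n \near npu_sets U, nearly_fixes (D n) (u n) (eps * (d n)%:R).
Proof.
move=> Tw uw eps0; apply: unitary_uniform => [n|v vD vv]; first by case: (uD n).
have : cls v = cls (bseq_star u * v * u).
  rewrite (up_star_conj v uw) -mulrA (TD Tw); last by exists v.
  by rewrite mulrA uval_starl mul1r.
by move=> /upclass_eq /(null_frobP U d_pos _) h; apply: filterS (h _ eps0).
Qed.

Let near_conj w u (eps : R) : T w -> cls u = uval w -> 0 < eps ->
  \forall n \near npu_sets U, nearly_into (conjm (u n)) (A n) (A n) (eps * (d n)%:R).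
Proof.
move=> Tw uw eps0; apply: unitary_uniform => [n|v vA vv]; first by case: (uA n).
have : internal A (cls (bseq_star u * v * u)).
  by rewrite (up_star_conj v uw); apply: TA => //; exists v.
move=> [a aA /upclass_eq /(null_frobP U d_pos _) h].
by apply: filterS (h _ eps0) => n hn; exists (a n); [exact: aA|exact: hn].
Qed.

Lemma internal_conj_surj w : T w -> forall X, internal A X ->
  exists2 Y, internal A Y & X = up_star (uval w) * Y * uval w.
Proof.
have fl n := finite_level (d_pos n) (uA n) (uD n).
have [S SP] := dependent_choice fl; have [Q QP] := choice SP.
have Sb : mxseq_bounded S by exists 1 => n; case: (QP n).
(* Commutation with all of [T] puts the class of [S] into the ultraproduct of the [D n] by [Dgen]; a
   representative there is the [d] that makes [Q] small. *)
have Scomm w' : T w' -> cls (BSeq Sb) * uval w' = uval w' * cls (BSeq Sb).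
  move=> Tw; have [u [uu uw]] := unitary_lift d_pos w'.
  suff e : cls (BSeq Sb) = up_star (uval w') * cls (BSeq Sb) * uval w'.
    by rewrite [in RHS]e !mulrA uval_starr mul1r.
  rewrite -(up_star_conj _ uw); apply/upclass_eq/(null_frobP U d_pos _) => eps eps0.
  have e0 : 0 < eps / 56 by rewrite divr_gt0.
  apply: filterS3 (near_DA e0) (near_fix Tw uw e0) (near_conj Tw uw e0) => n h1 h2 h3.
  have [_ _ h _] := QP n; apply: le_trans (h _ _ (uu n) h1 h2 h3) _.
  by lra.
have [s sD /upclass_eq /(null_frobP U d_pos _) hs] := Dgen Scomm.
have Qsmall (eps : R) : 0 < eps -> \forall n \near npu_sets U, Q n <= eps * (d n)%:R.
  (* Each term of the bound [32 * eps + 3 * frob (S - d)] receives half of the tolerance. *)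
  move=> eps0; have e1 : 0 < eps / 64 by rewrite divr_gt0.
  have e2 : 0 < eps / 6 by rewrite divr_gt0.
  apply: filterS2 (near_DA e1) (hs _ e2) => n h1 h2.
  have [_ h _ _] := QP n; apply: le_trans (h _ _ h1 (sD n)) _.
  by move: h2 => /=; lra.
move=> Tw X [a aA ->]; have [u [uu uw]] := unitary_lift d_pos w.
have [M M0 aM] := bseq_pos a.
have va n : M^-1%:C%C *: a n \in A n by rewrite memvZ ?aA.
have v1 n : opnorm (M^-1%:C%C *: a n) <= 1.
  apply: opnorm_le_frob => // z; rewrite -scalemxAl frobZ nsq_real expr1n mul1r exprVn.
  rewrite mulrC ler_pdivrMr ?exprn_gt0 // mulrC; exact: opnorm_frob.
have H n := let: And4 _ _ _ h := QP n in h _ _ (uu n) (va n) (v1 n).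
have [b bP] := dependent_choice H.
have bb : mxseq_bounded b by exists 1 => n; case: (bP n).
have Mb : @mxseq_bounded R d (fun n => M%:C%C%:M).
  by exists M => n; apply: opnorm_scalar; rewrite ?nsq_real // ltW.
exists (cls (BSeq Mb * BSeq bb)).
  exists (BSeq Mb * BSeq bb) => // n /=; have [bA _ _] := bP n.
  by rewrite mul_scalar_mx memvZ.
rewrite -(up_star_conj _ uw); apply/upclass_eq/(null_frobP U d_pos _) => eps eps0.
have M2 : 0 < M ^+ 2 by rewrite exprn_gt0.
(* With [eta = k] and [Q n <= k ^+ 2 * d n] the finite bound is [4 * (7 + 2 + 2) * k * d n]; undoing
   the scaling by [M] costs [M ^+ 2], and [44 <= 100]. *)
pose k := eps / (100 * M ^+ 2).
have k0 : 0 < k by rewrite divr_gt0 ?mulr_gt0.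
have kk : 0 < k ^+ 2 by rewrite exprn_gt0.
have near2 : \forall n \near npu_sets U, nearly_into id (D n) (A n) (k * (d n)%:R) /\
    nearly_fixes (D n) (u n) (k * (d n)%:R).
  by apply: filterS2 (near_DA k0) (near_fix Tw uw k0) => n.
apply: filterS3 near2 (near_conj Tw uw k0) (Qsmall _ kk) => n [h1 h2] h3 hQ.
have [_ _ h] := bP n; have {h} := h _ k k0 h1 h2 h3.
have -> : (a - bseq_star u * (BSeq Mb * BSeq bb) * u : bseq) n =
    M%:C%C *: (M^-1%:C%C *: a n - conjm (u n) (b n)).
  rewrite scalerBr scalerA -rmorphM /= mulfV ?gt_eqF // scale1r /conjm.
  by rewrite mul_scalar_mx -scalemxAr -scalemxAl.
rewrite frobZ nsq_real => h.
have hQk : 2 * Q n / k <= 2 * k * (d n)%:R.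
  rewrite ler_pdivrMr //; move: hQ => /=; rewrite expr2; lra.
apply: le_trans (_ : _ <= M ^+ 2 * (44 * (k * (d n)%:R))) _.
  apply: ler_wpM2l; first exact: ltW.
  by apply: le_trans h _; move: hQk; lra.
have -> : M ^+ 2 * (44 * (k * (d n)%:R)) = 44 / 100 * (eps * (d n)%:R).
  by rewrite /k; field; rewrite gt_eqF.
have : 0 <= eps * (d n)%:R by rewrite mulr_ge0 // ltW.
lra.
Qed.

End Rigidity.

(** * Invariance of the relative commutant *)

Theorem theorem1p2 (R : realType) (centralizer_pos : centralizer_problem R)
    (G : groupType) (G_kazhdan : kazhdan R G)
    (H : {pred G}) (sH : subGroupType H) (H_kazhdan : kazhdan R sH)
    (H_infranormal : infranormal H)
    (U : nonprincipal_ultrafilter) (d : nat -> nat)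
    (d_pos : forall n, (0 < d n)%N)
    (pi : {multiplicative G -> up_unitary R U d}) (g : G) :
  let piH' := commutant [set uval (pi h) | h in [set h | h \in H]] in
  [set uval (pi g) * x * uval (pi g)^-1%g | x in piH'] = piH'.
Proof.
move=> N.
have [D0 sD0 hD] := centralizer_pos _ G_kazhdan U d d_pos pi.
have [A0 sA0 hA] := centralizer_pos _ H_kazhdan U d d_pos
  (pi \o \val : {multiplicative sH -> up_unitary R U d}).
have NE : N = internal_set A0.
  rewrite -hA /N; congr commutant; apply/seteqP; split=> [_ [h hH <-]|_ [h _ <-]].
    by exists (Sub h hH : sH) => //=; rewrite SubK.
  by exists (\val h) => //; exact: valP.
(* The algebras given by the hypothesis may lack the identity matrix; as commutants contain 1,
   adjoining it does not change their ultraproducts. *)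
have c1 S : @commutant R U d S 1 by move=> s _; rewrite mulr1 mul1r.
have IA : @internal_set R U d (fun n => unitalize (A0 n)) = N.
  by rewrite unitalize_internal // -NE //; exact: c1.
have ID : @internal_set R U d (fun n => unitalize (D0 n)) =
    commutant (range (fun g => uval (pi g))).
  by rewrite unitalize_internal // -hD //; exact: c1.
pose uA n := unitalize_usalg (sA0 n); pose uD n := unitalize_usalg (sD0 n).
have piM a b : uval (pi (a * b)%g) = uval (pi a) * uval (pi b) by rewrite gmulfM.
have pi1g : pi 1%g = 1%g by apply: (mulgI (pi 1%g)); rewrite -gmulfM !mulg1.
have piVg a : pi a^-1%g = (pi a)^-1%g.
  by apply: (mulgI (pi a)); rewrite -gmulfM !mulgV.
have piV a : uval (pi a^-1%g) = up_star (uval (pi a)) by rewrite piVg.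
have pi1 : uval (pi 1%g) = 1 by rewrite pi1g.
pose P := [set t : G | forall h, h \in H -> (t * h * t^-1)%g \in H].
pose c (a : G) X := uval (pi a^-1%g) * X * uval (pi a).
have cM a b X : c (a * b)%g X = c b (c a X).
  by rewrite /c invgM !piM !mulrA.
have c1X X : c 1%g X = X by rewrite /c invg1 pi1 mul1r mulr1.
have cK a X : c a^-1%g (c a X) = X by rewrite -cM mulgV c1X.
have cVK a X : c a (c a^-1%g X) = X by rewrite -cM mulVg c1X.
have cN t : P t -> forall X, N X -> N (c t X).
  move=> Pt X NX _ [h hH <-].
  have th : (t * h = (t * h * t^-1) * t)%g by rewrite -[RHS]mulgA mulVg mulg1.
  have ht : (h * t^-1 = t^-1 * (t * h * t^-1))%g by rewrite !mulgA mulVg mul1g.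
  have XK : X * uval (pi (t * h * t^-1)%g) = uval (pi (t * h * t^-1)%g) * X.
    by apply: NX; exists (t * h * t^-1)%g => //; exact: Pt.
  by rewrite /c -!mulrA -piM th piM (mulrA X) XK !mulrA -piM -ht piM.
pose T := [set pi t | t in P].
have DA : internal_set (fun n => unitalize (D0 n)) `<=`
    @internal_set R U d (fun n => unitalize (A0 n)).
  by rewrite IA ID => X hX _ [h hH <-]; apply: hX; exists h.
have TA w : T w -> forall X, @internal_set R U d (fun n => unitalize (A0 n)) X ->
    internal_set (fun n => unitalize (A0 n)) (up_star (uval w) * X * uval w).
  by rewrite IA => -[t Pt <-] X; rewrite -piV; exact: cN.
have TD w : T w -> forall X, internal_set (fun n => unitalize (D0 n)) X ->
    X * uval w = uval w * X.
  by rewrite ID => -[t Pt <-] X; apply; exists t.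
have Dgen X : (forall w, T w -> X * uval w = uval w * X) ->
    internal_set (fun n => unitalize (D0 n)) X.
  move=> hX; rewrite ID => _ [a _ <-].
  (* The elements fixing [X] form a subgroup, so commuting with [pi t] for [t] in [P] is enough. *)
  pose K := [pred a : G | `[< c a X = X >]].
  have cE b : c b X = X <-> X * uval (pi b) = uval (pi b) * X.
    rewrite /c piV; split=> [e|e]; last by rewrite -mulrA e mulrA uval_starl mul1r.
    by rewrite -[in RHS]e !mulrA uval_starr mul1r.
  have /asboolP/cE // : a \in K.
  apply: H_infranormal => [|t Pt]; last by apply/asboolP/cE/hX; exists t.
  split=> [|b b' /asboolP hb /asboolP hb']; first by apply/asboolP; rewrite c1X.
  by apply/asboolP; rewrite cM hb -[in LHS]hb' cK.
have surj := internal_conj_surj d_pos uA uD DA TA TD Dgen.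
rewrite IA in surj.
have NcN a : forall X, N X <-> N (c a X).
  (* One-sided invariance does not pass to inverses, whereas the equivalence defines a subgroup;
     [surj] supplies the missing direction for [t] in [P]. *)
  pose K := [pred a : G | `[< forall X, N X <-> N (c a X) >]].
  suff /asboolP : a \in K by [].
  apply: H_infranormal => [|t Pt]; last first.
    apply/asboolP => X; split=> [|hX]; first exact: cN.
    have [|Y NY e] := surj (pi t) _ _ hX; first by exists t.
    suff -> : X = Y by [].
    by rewrite -(cK t X) e -piV -/(c t Y) cK.
  split=> [|b b' /asboolP hb /asboolP hb']; apply/asboolP => X; first by rewrite c1X.
  by rewrite cM (hb X) (hb' (c b'^-1%g _)) cVK.
have cg X : uval (pi g) * X * uval (pi g)^-1%g = c g^-1%g X.
  by rewrite /c invgK piVg.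
apply/seteqP; split=> [_ [X NX <-]|X NX].
  by rewrite cg -NcN.
exists (c g X); first by rewrite -NcN.
by rewrite cg cK.
Qed.
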